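(* For any quantum channel $\mathcal N$, its private classical capacity is bounded by its cost of degradable mixing: $C_p(\mathcal N)\le C_{\rm DM}(\mathcal N)$.
   Context: All systems finite-dimensional; $S$ is von Neumann entropy. For a channel $\mathcal N$ from $A$ to $B$, an isometric extension $U_{\mathcal N}:A\to B\otimes E$ satisfies $\mathcal N(\rho)=\mathrm{Tr}_EU_{\mathcal N}\rho U_{\mathcal N}^\dagger$; the complementary channel is $\widehat{\mathcal N}(\rho)=\mathrm{Tr}_BU_{\mathcal N}\rho U_{\mathcal N}^\dagger$. $\mathcal N$ is degradable if $\mathcal D\circ\mathcal N=\widehat{\mathcal N}$ for some CPTP $\mathcal D$, and anti-degradable if $\mathcal D\circ\widehat{\mathcal N}=\mathcal N$ for some CPTP $\mathcal D$. $Q^{(1)}(\mathcal N)=\sup_\phi(S(B)-S(RB))$ over pure states $|\phi\rangle$ on $R\otimes A$, evaluated on $(I_R\otimes\mathcal N)(|\phi\rangle\langle\phi|)$. Cost of degradable mixing: $C_{\rm DM}(\mathcal N)=\inf\sum_ip_iQ^{(1)}(\mathcal N_i)$, the infimum over finite collections $\{p_i,\mathcal N_i,\mathcal D_i\}$ with $(p_i)$ a probability distribution, channels $\mathcal N_i$ with input $A$ each of which is degradable or anti-degradable, and CPTP maps $\mathcal D_i$ from the output of $\mathcal N_i$ to $B$, such that $\mathcal N=\sum_ip_i\mathcal D_i\circ\mathcal N_i$. Private classical capacity: an $(n,K)$ key code is $K$ states $\rho_x$ on $A^{\otimes n}$ and a decoding measurement $\mathcal D_n$ on $B^{\otimes n}$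 with outcomes $\{1,\dots,K\}$; with $\rho_{XB^nE^n}=\frac1K\sum_x|x\rangle\langle x|\otimes U_{\mathcal N}^{\otimes n}\rho_x(U_{\mathcal N}^{\otimes n})^\dagger$, it is $\epsilon$-good if $\|(I\otimes\mathcal D_n\otimes I)(\rho_{XB^nE^n})-\frac1K\sum_x|x\rangle\langle x|\otimes|x\rangle\langle x|\otimes\rho_{E^n}\|_1<\epsilon$, $\rho_{E^n}$ the reduced state on $E^{\otimes n}$. A rate $R$ is achievable if for every $\epsilon>0$ and sufficiently large $n$ there is an $\epsilon$-good code $C_n$ for $\mathcal N^{\otimes n}$ with $\lim_n\frac{\log|C_n|}{n}\ge R$; $C_p(\mathcal N)$ is the supremum of achievable rates. *)

(* Defs.v *)
From HB Require Import structures.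
From mathcomp Require Import all_boot all_order all_algebra.
From mathcomp Require Import complex.
From mathcomp Require Import classical_sets boolp reals ereal exp.
Set Implicit Arguments.
Unset Strict Implicit.
Unset Printing Implicit Defensive.
Import Order.TTheory GRing.Theory Num.Theory.
Local Open Scope ring_scope.

Section QInfo.
Variable R : realType.
Local Notation C := (R[i]).

(* A quantum system is modelled by a finite type T indexing an orthonormal
   basis; operators on it are matrices 'M[C]_#|T|. *)
Notation op T := ('M[C]_#|T|).

Definition ent (S T : finType) (M : 'M[C]_(#|S|, #|T|)) (s : S) (t : T) : C :=
  M (enum_rank s) (enum_rank t).
Definition mxof (S T : finType) (f : S -> T -> C) : 'M[C]_(#|S|, #|T|) :=
  \matrix_(i, j) f (enum_val i) (enum_val j).

Definition adj m n (A : 'M[C]_(m, n)) : 'M[C]_(n, m) := (map_mx Num.conj A)^T.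

Definition psd n (X : 'M[C]_n) : Prop :=
  forall v : 'cV[C]_n, 0 <= (adj v *m X *m v) 0 0.
Definition density n (X : 'M[C]_n) : Prop := psd X /\ \tr X = 1.
Definition isometry m n (V : 'M[C]_(m, n)) : Prop := adj V *m V = 1%:M.
Definition unitary n (U : 'M[C]_n) : Prop := adj U *m U = 1%:M /\ U *m adj U = 1%:M.

Definition ptrR (S T : finType) (X : op {: S * T}) : op S :=
  mxof (fun s s' => \sum_(t : T) ent X (s, t) (s', t)).
Definition ptrL (S T : finType) (X : op {: S * T}) : op T :=
  mxof (fun t t' => \sum_(s : S) ent X (s, t) (s, t')).

(* (id_X (x) f (x) id_Z) for a map f on operators of the middle factor *)
Definition mid_map (X S S' Z : finType) (f : op S -> op S')
  (Y : op {: X * (S * Z)}) : op {: X * (S' * Z)} :=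
  mxof (fun (u v : X * (S' * Z)) =>
    ent (f (mxof (fun s1 s2 => ent Y (u.1, (s1, u.2.2)) (v.1, (s2, v.2.2)))))
        u.2.1 v.2.1).

Definition idtens (Rf S S' : finType) (f : op S -> op S') (Y : op {: Rf * S}) :
  op {: Rf * S'} :=
  mxof (fun (u v : Rf * S') =>
    ent (f (mxof (fun s1 s2 => ent Y (u.1, s1) (v.1, s2)))) u.2 v.2).

Definition is_channel (A B : finType) (N : op A -> op B) : Prop :=
  [/\ linear N,
      (forall X, \tr (N X) = \tr X) &
      (forall (Rf : finType) (X : op {: Rf * A}), psd X -> psd (idtens N X))].

Definition isom_ext (A B E : finType) (N : op A -> op B)
  (V : 'M[C]_(#|{: B * E}|, #|A|)) : Prop :=
  isometry V /\ forall rho, N rho = ptrR (V *m rho *m adj V).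

Definition compl (A B E : finType) (V : 'M[C]_(#|{: B * E}|, #|A|)) (rho : op A) :
  op E := ptrL (V *m rho *m adj V).

Definition degradable (A B : finType) (N : op A -> op B) : Prop :=
  exists (E : finType) (V : 'M[C]_(#|{: B * E}|, #|A|)) (D : op B -> op E),
    [/\ isom_ext N V, is_channel D & forall rho, D (N rho) = compl V rho].

Definition antidegradable (A B : finType) (N : op A -> op B) : Prop :=
  exists (E : finType) (V : 'M[C]_(#|{: B * E}|, #|A|)) (D : op E -> op B),
    [/\ isom_ext N V, is_channel D & forall rho, D (compl V rho) = N rho].

Definition realc (x : R) : C := Complex x 0.

(* von Neumann entropy S(X) = - Tr X ln X, computed from a spectral
   decomposition X = U diag(l) U^*  (natural logarithm, 0 ln 0 = 0). *)
Definition vN_entropy n (X : 'M[C]_n) : R :=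
  xget 0 [set s : R | exists (U : 'M[C]_n) (l : 'I_n -> R),
     [/\ unitary U, X = U *m diag_mx (\row_i realc (l i)) *m adj U &
         s = - \sum_i (l i * ln (l i))]].

Definition trnorm m n (X : 'M[C]_(m, n)) : R :=
  xget 0 [set t : R | exists (U : 'M[C]_m) (W : 'M[C]_n) (s : 'I_m -> 'I_n -> R),
     [/\ unitary U /\ unitary W, (forall (i : 'I_m) (j : 'I_n), nat_of_ord i != nat_of_ord j -> s i j = 0),
         (forall i j, 0 <= s i j),
         X = U *m (\matrix_(i, j) realc (s i j)) *m W &
         t = \sum_i \sum_(j : 'I_n | nat_of_ord i == nat_of_ord j) s i j]].

Local Open Scope ereal_scope.

Definition coh_info (A B Rf : finType) (N : op A -> op B)
  (phi : 'cV[C]_#|{: Rf * A}|) : R :=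
  let w := idtens N (phi *m adj phi) in
  (vN_entropy (ptrL w) - vN_entropy w)%R.

Definition Q1 (A B : finType) (N : op A -> op B) : \bar R :=
  ereal_sup [set x | exists (Rf : finType) (phi : 'cV[C]_#|{: Rf * A}|),
    adj phi *m phi = 1%:M /\ x = (coh_info N phi)%:E].

Definition C_DM (A B : finType) (N : op A -> op B) : \bar R :=
  ereal_inf [set x | exists (m : nat) (p : 'I_m -> R) (Bi : 'I_m -> finType)
      (Ni : forall i, op A -> op (Bi i)) (Di : forall i, op (Bi i) -> op B),
    [/\ (forall i, 0 <= p i)%R /\ (\sum_i p i = 1)%R,
        (forall i, is_channel (Ni i) /\ (degradable (Ni i) \/ antidegradable (Ni i))),
        (forall i, is_channel (Di i)),
        (forall rho, N rho = \sum_i realc (p i) *: Di i (Ni i rho))%R &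
        x = \sum_i (p i)%:E * Q1 (Ni i)]].

Local Close Scope ereal_scope.

Definition isom_pow (A B E : finType) (V : 'M[C]_(#|{: B * E}|, #|A|)) (n : nat) :
  'M[C]_(#|{: n.-tuple B * n.-tuple E}|, #|{: n.-tuple A}|) :=
  mxof (fun (be : n.-tuple B * n.-tuple E) (a : n.-tuple A) =>
    \prod_(k < n) ent V (tnth be.1 k, tnth be.2 k) (tnth a k)).

Definition meas (T : finType) K (M : 'I_K -> op T) (X : op T) : op 'I_K :=
  mxof (fun y y' => if y == y' then \tr (M y *m X) else 0).

Definition povm (T : finType) K (M : 'I_K -> op T) : Prop :=
  (forall y, psd (M y)) /\ \sum_y M y = 1%:M.

Definition cq_state (A B E : finType) (V : 'M[C]_(#|{: B * E}|, #|A|)) (n K : nat)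
  (rho : 'I_K -> op {: n.-tuple A}) :
  op {: 'I_K * (n.-tuple B * n.-tuple E)} :=
  mxof (fun u v => if u.1 == v.1 then
     (K%:R)^-1 * ent (isom_pow V n *m rho u.1 *m adj (isom_pow V n)) u.2 v.2
     else 0).

Definition good_code (A B E : finType) (V : 'M[C]_(#|{: B * E}|, #|A|)) (n K : nat)
  (rho : 'I_K -> op {: n.-tuple A}) (M : 'I_K -> op {: n.-tuple B}) (eps : R) : Prop :=
  let s := cq_state V rho in
  let rhoE := ptrL (ptrL s) in
  let target : op {: 'I_K * ('I_K * n.-tuple E)} :=
    mxof (fun u v => if (u.1 == v.1) && (u.2.1 == v.2.1) && (u.1 == u.2.1)
                     then (K%:R)^-1 * ent rhoE u.2.2 v.2.2 else 0) in
  [/\ forall x, density (rho x), povm M &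
      trnorm (mid_map (meas M) s - target) < eps].

Definition has_good_code (A B E : finType) (V : 'M[C]_(#|{: B * E}|, #|A|))
  (n K : nat) (eps : R) : Prop :=
  exists rho M, @good_code A B E V n K rho M eps.

(* R is achievable: for every eps > 0 there are codes C_n, eps-good for all
   sufficiently large n, with liminf_n log|C_n| / n >= R (liminf >= r written
   out as: for every delta > 0, eventually log|C_n|/n >= r - delta). *)
Definition achievable (A B E : finType) (V : 'M[C]_(#|{: B * E}|, #|A|)) (r : R) : Prop :=
  forall eps : R, 0 < eps ->
    exists (K : nat -> nat) (n0 : nat),
      (forall n, (n0 <= n)%N -> has_good_code V n (K n) eps) /\
      (forall delta : R, 0 < delta -> exists n1, forall n, (n1 <= n)%N ->
          r - delta <= ln (K n)%:R / n%:R).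

Definition C_p (A B E : finType) (V : 'M[C]_(#|{: B * E}|, #|A|)) : \bar R :=
  ereal_sup [set x | exists r, achievable V r /\ x = r%:E].

End QInfo.

(* Main.v *)
Require Import Defs.
From HB Require Import structures.
From mathcomp Require Import all_boot all_order all_algebra.
From mathcomp Require Import complex.
From mathcomp Require Import classical_sets boolp reals ereal exp.
From mathcomp Require Import ring lra zify.
From mathcomp Require Import functions topology normedtype derive realfun.
Set Implicit Arguments.
Unset Strict Implicit.
Unset Printing Implicit Defensive.
Import Order.TTheory GRing.Theory Num.Theory.
Import numFieldNormedType.Exports.
Local Open Scope ring_scope.

(** What is reduced to a single use is the coherent information rewritten as a conditional entropy.
    Dilate the degrading map of T to an isometry with outputs T' and F': the receiver holds T'F',
    the environment holds T, and T' and T are in the same state. The coherent information becomes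
    H(T'F') - H(T') = H(F'|T'), which strong subadditivity makes concave in the input and
    subadditive over uses. It is 0 on pure inputs, hence nonnegative by concavity.

    For an anti-degradable N_i the dilation has two outputs in the state N_i(rho) and a leftover
    system, which must go to one side and destroys the symmetry of T' and T. Two flags of weight p_i
    / 2 restore it: each side gets the leftover system once, T' and T carry opposite flags, and F'
    is trivial, so that the term contributes 0 <= Q1(N_i).

    Errors that are bounded in n, or of order eps times n, disappear in the rate, which is why Fano
    and Fannes are used in crude forms. *)

(* A decomposition N = sum_i p_i D_i o N_i extends N to the channel T that outputs
   N_i with probability p_i together with a flag i: processing the output of T by
   the D_i gives back N. An anti-degradable N_i is first replaced by a symmetric
   extension with two flag values, so that T is degradable. By data processing
   (concavity of the conditional entropy), replacing N by T increases the
   information of the receiver about the message and decreases that of the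
   environment. For a degradable channel the difference of the two is at most the
   coherent information of the average input, which is subadditive over the n
   uses and is bounded, for one use, by sum_i p_i Q1(N_i).

   Everything is expressed by kernels f : S -> T -> C, seen as bipartite vectors,
   and by the entropy of their marginal on S. Strong subadditivity follows from
   the monotonicity of the relative entropy, obtained by writing
   Tr P (ln P - ln Q) as an integral over s > 0 of quadratic forms that are suprema
   of functions linear in (P, Q). *)

(** * Entropy of the marginals of a bipartite vector *)

Section Kernels.
Variable R : realType.
Local Notation C := (R[i]).

Lemma realcE (x : R) : realc x = x%:C%C. Proof. by []. Qed.

Lemma realcD : {morph @realc R : x y / x + y}.
Proof. by move=> x y; rewrite !realcE rmorphD. Qed.
Lemma realcM : {morph @realc R : x y / x * y}.
Proof. by move=> x y; rewrite !realcE rmorphM. Qed.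
Lemma realcN : {morph @realc R : x / - x}.
Proof. by move=> x; rewrite !realcE rmorphN. Qed.
Lemma realc_sum I (r : seq I) (P : pred I) (F : I -> R) :
  realc (\sum_(i <- r | P i) F i) = \sum_(i <- r | P i) realc (F i).
Proof. by rewrite realcE rmorph_sum. Qed.
Lemma realc_inj : injective (@realc R). Proof. by move=> x y []. Qed.
Lemma realc1 : realc 1 = 1 :> C. Proof. by []. Qed.
Lemma realc0 : realc 0 = 0 :> C. Proof. by []. Qed.
Lemma realc_ge0 (x : R) : (0 <= realc x :> C) = (0 <= x).
Proof. by rewrite realcE ler0c. Qed.
Lemma realc_conj (x : R) : (realc x)^* = realc x :> C.
Proof. by apply/CrealP/complex_realP; exists x. Qed.
Lemma ReK (x : R) : complex.Re (realc x) = x. Proof. by []. Qed.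
Lemma realc_Re (z : C) : z \is Num.real -> realc (complex.Re z) = z.
Proof. by move=> zr; rewrite realcE RRe_real. Qed.

Lemma ReD (x y : C) : complex.Re (x + y) = complex.Re x + complex.Re y.
Proof. by case: x; case: y. Qed.
Lemma ReN (x : C) : complex.Re (- x) = - complex.Re x.
Proof. by case: x. Qed.
Lemma Re_sum I (r : seq I) (P : pred I) (F : I -> C) :
  complex.Re (\sum_(i <- r | P i) F i) = \sum_(i <- r | P i) complex.Re (F i).
Proof. by apply: (big_morph _ ReD). Qed.
Lemma ReZ (a : R) (x : C) : complex.Re (realc a * x) = a * complex.Re x.
Proof. by case: x => u v /=; rewrite mul0r subr0. Qed.
Lemma ReZr (a : R) (x : C) : complex.Re (x * realc a) = complex.Re x * a.
Proof. by rewrite mulrC ReZ mulrC. Qed.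

Definition nsq (z : C) : R := complex.Re (z * z^*).
Lemma nsqE z : realc (nsq z) = z * z^*.
Proof. by rewrite realc_Re // -normCK rpredX ?normr_real. Qed.
Lemma nsq_ge0 z : 0 <= nsq z.
Proof. by rewrite -realc_ge0 nsqE -normCK exprn_ge0. Qed.
Lemma nsq_eq0 z : (nsq z == 0) = (z == 0).
Proof.
rewrite -(inj_eq realc_inj) nsqE realc0 -normCK expf_eq0 /=.
exact: normr_eq0.
Qed.
Lemma nsqM x y : nsq (x * y) = nsq x * nsq y.
Proof. by apply: realc_inj; rewrite realcM !nsqE rmorphM mulrACA. Qed.
Lemma nsq_realc x : nsq (realc x) = x ^+ 2.
Proof. by rewrite /nsq realc_conj -realcM ReK expr2. Qed.

Lemma adjE m n (A : 'M[C]_(m, n)) i j : adj A i j = (A j i)^*.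
Proof. by rewrite !mxE. Qed.
Lemma adjM m n p (A : 'M[C]_(m, n)) (B : 'M[C]_(n, p)) :
  adj (A *m B) = adj B *m adj A.
Proof. by rewrite /adj map_mxM trmx_mul. Qed.
Lemma adjK m n (A : 'M[C]_(m, n)) : adj (adj A) = A.
Proof. by apply/matrixP => i j; rewrite !adjE conjCK. Qed.
Lemma adj_diag n (l : 'I_n -> R) :
  adj (diag_mx (\row_i realc (l i))) = diag_mx (\row_i realc (l i)).
Proof.
apply/matrixP => i j; rewrite !mxE eq_sym rmorphMn /= realc_conj.
by case: eqP => // ->.
Qed.
Lemma unitary_adj n (U : 'M[C]_n) : unitary U -> unitary (adj U).
Proof. by case=> h1 h2; split; rewrite adjK. Qed.
Lemma unitaryM n (U W : 'M[C]_n) : unitary U -> unitary W -> unitary (U *m W).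
Proof.
move=> [h1 h2] [h3 h4]; split; rewrite adjM.
  by rewrite mulmxA -(mulmxA (adj W)) h1 mulmx1.
by rewrite mulmxA -(mulmxA U) h4 mulmx1.
Qed.

Lemma hermitian_spectral n (X : 'M[C]_n) : adj X = X ->
  exists U (l : 'I_n -> R), unitary U /\
    X = U *m diag_mx (\row_i realc (l i)) *m adj U.
Proof.
move=> hX; have Xh : X \is hermsymmx.
  by apply/is_hermitianmxP; rewrite expr0 scale1r -{1}hX /adj -map_trmx.
have /hermitian_normalmx /orthomx_spectralP := Xh.
have := spectral_unitarymx X; have := hermitian_spectral_diag_real Xh.
move: (spectral_diag X) (spectralmx X) => d P dr Pu.
rewrite (invmx_unitary Pu) => XE.
have aP : (map_mx Num.conj P^T) = adj P by rewrite /adj map_trmx.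
have Pu1 : P *m adj P = 1%:M by rewrite -aP; exact/unitarymxP.
exists (adj P), (fun i => complex.Re (d 0 i)); split.
  by split; rewrite adjK //; exact: mulmx1C.
rewrite adjK {1}XE aP; congr (_ *m diag_mx _ *m _).
by apply/rowP => i; rewrite mxE realc_Re //; exact: (mxOverP dr).
Qed.

(** * Independence of the entropy from the chosen diagonalisation *)

Lemma unitary_row n (U : 'M[C]_n) i : unitary U -> \sum_j nsq (U i j) = 1.
Proof.
move=> [_ /matrixP/(_ i i)]; rewrite mxE [RHS]mxE eqxx => h.
apply: realc_inj; rewrite realc_sum -[RHS]h; apply: eq_bigr => j _.
by rewrite nsqE adjE.
Qed.
Lemma unitary_col n (U : 'M[C]_n) j : unitary U -> \sum_i nsq (U i j) = 1.
Proof.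
move=> [/matrixP/(_ j j) + _]; rewrite mxE [RHS]mxE eqxx => h.
apply: realc_inj; rewrite realc_sum -[RHS]h; apply: eq_bigr => i _.
by rewrite nsqE adjE mulrC.
Qed.

(** [w] couples the weights [a] and [b] and joins only equal values, so both sides are the [w]-sum
    of [g]. Squared moduli of a change of eigenbasis provide such couplings. *)
Lemma transport_sum (I J : finType) (w : I -> J -> R) (a l : I -> R)
  (b k : J -> R) (g : R -> R) :
  (forall i, \sum_j w i j = a i) -> (forall j, \sum_i w i j = b j) ->
  (forall i j, w i j != 0 -> l i = k j) ->
  \sum_i a i * g (l i) = \sum_j b j * g (k j).
Proof.
move=> wa wb h; under eq_bigr do rewrite -wa mulr_suml.
rewrite exchange_big /=; apply: eq_bigr => j _; rewrite -wb mulr_suml.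
apply: eq_bigr => i _.
by have [->|/h ->//] := eqVneq (w i j) 0; rewrite !mul0r.
Qed.

Lemma mul_diag_mxE n p (l : 'I_n -> R) (A : 'M[C]_(n, p)) i j :
  (diag_mx (\row_i realc (l i)) *m A) i j = realc (l i) * A i j.
Proof. by rewrite mul_diag_mx !mxE. Qed.
Lemma mul_mx_diagE n p (l : 'I_n -> R) (A : 'M[C]_(p, n)) i j :
  (A *m diag_mx (\row_i realc (l i))) i j = A i j * realc (l j).
Proof. by rewrite mul_mx_diag !mxE. Qed.

Lemma unitaryK n p (U : 'M[C]_n) (A : 'M_(n, p)) : unitary U -> adj U *m (U *m A) = A.
Proof. by move=> [h _]; rewrite mulmxA h mul1mx. Qed.
Lemma unitaryKV n p (U : 'M[C]_n) (A : 'M_(n, p)) : unitary U -> U *m (adj U *m A) = A.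
Proof. by move=> [_ h]; rewrite mulmxA h mul1mx. Qed.

(** [vN_entropy] selects a diagonalisation by choice. For two of them the squared overlaps of the
    eigenbases are doubly stochastic and vanish unless the eigenvalues agree. *)
Lemma vN_entropyE n (U : 'M[C]_n) (l : 'I_n -> R) : unitary U ->
  vN_entropy (U *m diag_mx (\row_i realc (l i)) *m adj U)
    = - \sum_i l i * ln (l i).
Proof.
move=> hU; rewrite /vN_entropy; set X := (X in xget _ X).
have : X (- \sum_i l i * ln (l i)) by exists U, l.
case: xgetP => [y _ [W [k [hW E ->]]] _|h /h [] //].
congr (- _).
pose T := adj U *m W; have hT : unitary T := unitaryM (unitary_adj hU) hW.
have TE : diag_mx (\row_i realc (l i)) *m T = T *m diag_mx (\row_i realc (k i)).
  move/(congr1 (fun X => adj U *m X *m W)): E.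
  rewrite -!mulmxA unitaryK // => ->.
  by rewrite (proj1 hW) mulmx1 !mulmxA.
have wE i j : nsq (T i j) != 0 -> l i = k j.
  rewrite nsq_eq0 => nz; apply: realc_inj; apply: (mulIf nz).
  by rewrite -mul_diag_mxE TE mul_mx_diagE mulrC.
have one (h : 'I_n -> R) : \sum_i h i = \sum_i 1 * h i.
  by under [RHS]eq_bigr do rewrite mul1r.
rewrite one [RHS]one; apply/esym.
exact: (transport_sum (fun x => x * ln x) (fun i => unitary_row i hT)
  (fun j => unitary_col j hT) wE).
Qed.

Lemma herm_mul m n (M : 'M[C]_(m, n)) : adj (M *m adj M) = M *m adj M.
Proof. by rewrite adjM adjK. Qed.

(** In eigenbases of the two products, [M] becomes a [T] whose squared moduli have row sums [l] and
    column sums [k] and join only equal eigenvalues. The weights are the eigenvalues themselves, so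
    the surplus zeros of the larger space do not count. *)
Lemma vN_swap m n (M : 'M[C]_(m, n)) :
  vN_entropy (M *m adj M) = vN_entropy (adj M *m M).
Proof.
have [U [l [hU lE]]] := hermitian_spectral (herm_mul M).
have h2 : adj (adj M *m M) = adj M *m M by rewrite adjM adjK.
have [W [k [hW kE]]] := hermitian_spectral h2.
rewrite {1}lE kE !vN_entropyE //; congr (- _).
pose T := adj U *m M *m W.
have E1 : T *m adj T = diag_mx (\row_i realc (l i)).
  rewrite /T !adjM adjK -!mulmxA unitaryKV // [M *m (adj M *m U)]mulmxA lE.
  by rewrite -!mulmxA unitaryK // (proj1 hU) mulmx1.
have E2 : adj T *m T = diag_mx (\row_i realc (k i)).
  rewrite /T !adjM adjK -!mulmxA unitaryKV // [adj M *m (M *m W)]mulmxA kE.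
  by rewrite -!mulmxA unitaryK // (proj1 hW) mulmx1.
have r i : \sum_j nsq (T i j) = l i.
  apply: realc_inj; move/matrixP/(_ i i): E1; rewrite mxE [RHS]mxE eqxx mulr1n mxE => <-.
  by rewrite realc_sum; apply: eq_bigr => j _; rewrite nsqE adjE.
have c j : \sum_i nsq (T i j) = k j.
  apply: realc_inj; move/matrixP/(_ j j): E2; rewrite mxE [RHS]mxE eqxx mulr1n mxE => <-.
  by rewrite realc_sum; apply: eq_bigr => i _; rewrite nsqE adjE mulrC.
have wE i j : nsq (T i j) != 0 -> l i = k j.
  rewrite nsq_eq0 => nz; apply: realc_inj; apply: (mulIf nz).
  by rewrite -mul_diag_mxE -E1 -mulmxA E2 mul_mx_diagE mulrC.
exact: transport_sum r c wE.
Qed.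

(** * Matrices and bipartite vectors indexed by finite types *)

Lemma entE (S T : finType) (f : S -> T -> C) s t : ent (mxof f) s t = f s t.
Proof. by rewrite /ent /mxof mxE !enum_rankK. Qed.
Lemma mxofK (S T : finType) (M : 'M[C]_(#|S|, #|T|)) : mxof (ent M) = M.
Proof. by apply/matrixP => i j; rewrite mxE /ent !enum_valK. Qed.
Lemma mxof_inj (S T : finType) (M N : 'M[C]_(#|S|, #|T|)) :
  (forall s t, ent M s t = ent N s t) -> M = N.
Proof.
move=> h; rewrite -(mxofK M) -(mxofK N).
by apply/matrixP => i j; rewrite !mxE.
Qed.
Lemma eq_mxof (S T : finType) (f g : S -> T -> C) : f =2 g -> mxof f = mxof g.
Proof. by move=> h; apply: mxof_inj => s t; rewrite !entE. Qed.

Lemma sum_enum_val (V : nmodType) (S : finType) (F : S -> V) :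
  \sum_(i < #|S|) F (enum_val i) = \sum_s F s.
Proof.
rewrite [RHS](reindex (@enum_val S (mem S))) //=.
by exists enum_rank => s _; rewrite ?enum_valK ?enum_rankK.
Qed.
Lemma sum_enum_rank (V : nmodType) (S : finType) (F : 'I_#|S| -> V) :
  \sum_i F i = \sum_(s : S) F (enum_rank s).
Proof. by rewrite -[RHS]sum_enum_val; apply: eq_bigr => i _; rewrite enum_valK. Qed.

Lemma ent_mul (S T Z : finType) (M : 'M[C]_(#|S|, #|T|)) (N : 'M[C]_(#|T|, #|Z|)) s z :
  ent (M *m N) s z = \sum_t ent M s t * ent N t z.
Proof. by rewrite /ent mxE sum_enum_rank. Qed.
Lemma ent_adj (S T : finType) (M : 'M[C]_(#|S|, #|T|)) t s :
  ent (adj M) t s = (ent M s t)^*.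
Proof. by rewrite /ent adjE. Qed.
Lemma ent_tr (S : finType) (M : 'M[C]_#|S|) : \tr M = \sum_s ent M s s.
Proof. by rewrite /mxtrace sum_enum_rank. Qed.
Lemma ent1 (S : finType) (s t : S) : ent (1%:M : 'M[C]_#|S|) s t = (s == t)%:R.
Proof. by rewrite /ent mxE (inj_eq enum_rank_inj). Qed.

Lemma adj_mxof (S T : finType) (f : S -> T -> C) :
  adj (mxof f) = mxof (fun t s => (f s t)^*).
Proof. by apply: mxof_inj => s t; rewrite ent_adj !entE. Qed.
Lemma mul_mxof (S T Z : finType) (f : S -> T -> C) (g : T -> Z -> C) :
  mxof f *m mxof g = mxof (fun s z => \sum_t f s t * g t z).
Proof.
apply: mxof_inj => s z; rewrite ent_mul entE.
by apply: eq_bigr => t _; rewrite !entE.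
Qed.

(* The entropy of the marginal on the first system of the (unnormalized)
   bipartite vector f. *)
Definition entropy (S T : finType) (f : S -> T -> C) : R :=
  vN_entropy (mxof f *m adj (mxof f)).

Lemma entropyE (S T : finType) (f : S -> T -> C) :
  entropy f = vN_entropy (mxof (fun s s' => \sum_t f s t * (f s' t)^*)).
Proof. by rewrite /entropy adj_mxof mul_mxof. Qed.

(** The second system only purifies, so any purification of the same marginal may be substituted.
    This is how systems are regrouped, dilated and replaced throughout. *)
Lemma eq_entropy_row (S T T' : finType) (f : S -> T -> C) (g : S -> T' -> C) :
  (forall s s', \sum_t f s t * (f s' t)^* = \sum_t g s t * (g s' t)^*) ->
  entropy f = entropy g.
Proof. by move=> h; rewrite !entropyE; congr vN_entropy; apply: eq_mxof. Qed.

Lemma conj_sum (I : Type) (r : seq I) (P : pred I) (F : I -> C) :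
  (\sum_(i <- r | P i) F i)^* = \sum_(i <- r | P i) (F i)^*.
Proof. by rewrite rmorph_sum. Qed.

Lemma entropy_adj (S T : finType) (f : S -> T -> C) : entropy f = entropy (fun t s => (f s t)^*).
Proof.
rewrite /entropy vN_swap; congr vN_entropy; rewrite !adj_mxof; congr (_ *m _).
by apply: eq_mxof => s t; rewrite conjCK.
Qed.

Lemma vN_conj n (X : 'M[C]_n) : adj X = X ->
  vN_entropy (map_mx Num.conj X) = vN_entropy X.
Proof.
move=> /hermitian_spectral[U [l [hU ->]]].
have E p q (A : 'M[C]_(p, q)) : map_mx Num.conj (adj A) = adj (map_mx Num.conj A).
  by apply/matrixP => i j; rewrite !mxE.
have -> : map_mx Num.conj (U *m diag_mx (\row_i realc (l i)) *m adj U) =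
  (map_mx Num.conj U) *m diag_mx (\row_i realc (l i)) *m adj (map_mx Num.conj U).
  rewrite !map_mxM E; congr (_ *m _ *m _).
  by apply/matrixP => i j; rewrite !mxE rmorphMn /= realc_conj.
rewrite !vN_entropyE //; case: hU => h1 h2; split; rewrite -E -map_mxM.
  by rewrite h1 map_mx1.
by rewrite h2 map_mx1.
Qed.

Lemma entropy_conj (S T : finType) (f : S -> T -> C) : entropy (fun s t => (f s t)^*) = entropy f.
Proof.
rewrite /entropy -[RHS](vN_conj (herm_mul _)) map_mxM; congr vN_entropy.
by congr (_ *m _); apply/matrixP => i j; rewrite !mxE.
Qed.

(** Both marginals of a pure vector have the same nonzero spectrum; [entropy_adj] says so up to
    complex conjugation, which keeps the entropy. *)
Lemma entropy_swap (S T : finType) (f : S -> T -> C) : entropy (fun t s => f s t) = entropy f.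
Proof. by rewrite entropy_adj entropy_conj. Qed.

Lemma eq_entropy (S T : finType) (f g : S -> T -> C) : f =2 g -> entropy f = entropy g.
Proof.
move=> h; apply: eq_entropy_row => s s'; apply: eq_bigr => t _; by rewrite !h.
Qed.

Lemma eq_entropy_col (S S' T : finType) (f : S -> T -> C) (g : S' -> T -> C) :
  (forall t t', \sum_s f s t * (f s t')^* = \sum_s g s t * (g s t')^*) ->
  entropy f = entropy g.
Proof. by move=> h; rewrite -entropy_swap -(entropy_swap g); apply: eq_entropy_row. Qed.

Lemma entropy_bij_row (S S' T : finType) (h : S' -> S) (f : S -> T -> C) :
  bijective h -> entropy (fun s' t => f (h s') t) = entropy f.
Proof.
move=> bh; apply: eq_entropy_col => t t'.
by rewrite [RHS](reindex h) //; exact: onW_bij.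
Qed.
Lemma entropy_bij_col (S T T' : finType) (h : T' -> T) (f : S -> T -> C) :
  bijective h -> entropy (fun s t' => f s (h t')) = entropy f.
Proof.
move=> bh; apply: eq_entropy_row => t t'.
by rewrite [RHS](reindex h) //; exact: onW_bij.
Qed.

Lemma entropy_spectral (S T : finType) (f : S -> T -> C) :
  exists (U : 'M[C]_#|S|) (l : 'I_#|S| -> R),
    [/\ unitary U, forall i, 0 <= l i,
        mxof f *m adj (mxof f) = U *m diag_mx (\row_i realc (l i)) *m adj U &
        entropy f = - \sum_i l i * ln (l i)].
Proof.
have [U [l [hU E]]] := hermitian_spectral (herm_mul (mxof f)).
exists U, l; split => //; last by rewrite /entropy E vN_entropyE.
move=> i; rewrite -realc_ge0.
have : adj U *m (mxof f *m adj (mxof f)) *m U = diag_mx (\row_i realc (l i)).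
  by rewrite E -!mulmxA unitaryK // (proj1 hU) mulmx1.
rewrite mulmxA -mulmxA => /matrixP/(_ i i).
rewrite [RHS]mxE eqxx mulr1n [RHS]mxE => <-.
rewrite mxE; apply: sumr_ge0 => j _.
have -> : (adj (mxof f) *m U) j i = ((adj U *m mxof f) i j)^*.
  by rewrite -adjE adjM adjK.
by rewrite -normCK exprn_ge0.
Qed.

End Kernels.

(** * Relative entropy and strong subadditivity *)

Section LogInequality.
Variable R : realType.

Lemma ln_shift_le (m d : R) : 0 < m -> 0 <= d -> 0 <= ln (m + d) - ln m <= d / m.
Proof.
move=> m0 d0.
have -> : ln (m + d) - ln m = ln (1 + d / m).
  by rewrite -ln_div ?posrE ?ltr_wpDr // mulrDl divff ?gt_eqF.
have dm : 0 <= d / m by rewrite divr_ge0 // ltW.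
apply/andP; split; first by rewrite ln_ge0 // lerDl.
by apply: le_ln1Dx; rewrite (lt_le_trans _ dm) // ltrN10.
Qed.

Lemma is_derive_ln_affine (m l s : R) : 0 < m + s * l ->
  is_derive s 1 (fun s => ln (m + s * l)) (l / (m + s * l)).
Proof.
move=> h; have -> : (fun s => ln (m + s * l)) = @ln R \o (fun s => m + s * l) by [].
have -> : l / (m + s * l) = (m + s * l)^-1 *: l by rewrite mulrC.
apply: is_derive1_comp; first exact: is_derive1_ln.
have -> : (fun s : R => m + s * l) = cst m + l *: id.
  by apply/funext => x; rewrite /= mulrC.
have := is_deriveD (is_derive_cst m s 1) (is_deriveZ l (is_derive_id s 1)).
by rewrite add0r scaler1.
Qed.

(** The last hypothesis is nonnegativity of the derivative of the compared function, so the mean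
    value theorem applies. *)
Lemma signed_ln_mono (n : nat) (c l m : 'I_n -> R) (a b : R) :
  0 < a -> a <= b ->
  (forall k, 0 < l k) -> (forall k, 0 < m k) ->
  (forall s : R, 0 < s -> 0 <= \sum_k c k * (l k / (m k + s * l k))) ->
  \sum_k c k * ln (m k + a * l k) <= \sum_k c k * ln (m k + b * l k).
Proof.
move=> a0 ab l0 m0 hs.
pose f := \sum_k (fun s => c k * ln (m k + s * l k)).
have fE s : f s = \sum_k c k * ln (m k + s * l k) by rewrite /f fct_sumE.
rewrite -!fE.
pose df s := \sum_k c k * (l k / (m k + s * l k)).
have fd (x : R) : 0 < x -> is_derive x 1 (f : R -> R) (df x).
  move=> x0; apply: is_derive_sum => k.
  apply: is_deriveZ; apply: is_derive_ln_affine.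
  by rewrite addr_gt0 ?mulr_gt0.
have [||c' hc E] := @MVT_segment R f df a b ab.
  by move=> x; rewrite in_itv /= => /andP[ax _]; apply: fd; exact: lt_trans ax.
  apply: derivable_within_continuous => x; rewrite in_itv /= => /andP[ax _].
  by have [] := fd x (lt_le_trans a0 ax).
rewrite -subr_ge0 E mulr_ge0 ?subr_ge0 //; apply: hs.
by move: hc; rewrite in_itv /= => /andP[/(lt_le_trans a0)].
Qed.

(* The integral representation of ln in disguise: s |-> sum_k c_k ln(m_k + s l_k)
   is nondecreasing; compare its behaviour at 0 and at infinity. *)
Lemma signed_ln_compare (K : finType) (c l m : K -> R) :
  (forall k, c k != 0 -> 0 < l k) -> (forall k, c k != 0 -> 0 < m k) ->
  \sum_k c k = 0 ->
  (forall s : R, 0 < s -> 0 <= \sum_k c k * (l k / (m k + s * l k))) ->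
  \sum_k c k * ln (m k) <= \sum_k c k * ln (l k).
Proof.
move=> l0 m0 c0 hs.
(* Where [c k = 0], the values [l k] and [m k] may be 0; replacing them by 1 changes no sum and
   keeps all logarithms regular. *)
pose l' k := if c k == 0 then 1 else l k.
pose m' k := if c k == 0 then 1 else m k.
have E (F : R -> R -> R) k : c k * F (l k) (m k) = c k * F (l' k) (m' k).
  by rewrite /l' /m'; case: eqP => // ->; rewrite !mul0r.
have l'0 k : 0 < l' k by rewrite /l'; case: eqP => // /eqP /l0.
have m'0 k : 0 < m' k by rewrite /m'; case: eqP => // /eqP /m0.
have {}hs s : 0 < s -> 0 <= \sum_k c k * (l' k / (m' k + s * l' k)).
  move=> /hs; congr (_ <= _); apply: eq_bigr => k _.
  exact: (E (fun l m => l / (m + s * l))).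
rewrite (eq_bigr _ (fun k _ => E (fun l m => ln m) k)).
rewrite [leRHS](eq_bigr _ (fun k _ => E (fun l m => ln l) k)).
(* Since ln (x + s y) - ln x lies between 0 and s y / x, [s * A] bounds the total error of dropping
   the [s]-terms at both ends. *)
pose A := \sum_k `|c k| * (l' k / m' k + m' k / l' k).
have A0 : 0 <= A.
  by apply: sumr_ge0 => k _; rewrite mulr_ge0 // addr_ge0 // divr_ge0 ?ltW.
have key s : 0 < s -> s <= 1 ->
    \sum_k c k * ln (m' k) <= \sum_k c k * ln (l' k) + s * A.
  move=> s0 s1.
  have s1V : s <= s^-1 by rewrite (le_trans s1) // invr_ge1 // unitf_gt0.
  have mono : \sum_k c k * ln (m' k + s * l' k) <=
              \sum_k c k * ln (m' k + s^-1 * l' k).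
    rewrite -[leLHS]sum_enum_val -[leRHS]sum_enum_val.
    apply: (@signed_ln_mono _ (fun i => c (enum_val i)) (fun i => l' (enum_val i))
      (fun i => m' (enum_val i))) => // t /hs.
    by rewrite -[X in _ <= X -> _]sum_enum_val.
  (* Infinity is moved to 0 by pulling out [s^-1]: the extra multiple of [ln s] has coefficient
     [\sum_k c k = 0], and [l] and [m] exchange roles. *)
  have E2 : \sum_k c k * ln (m' k + s^-1 * l' k) = \sum_k c k * ln (l' k + s * m' k).
    have -> : \sum_k c k * ln (l' k + s * m' k) =
       \sum_k (c k * ln (m' k + s^-1 * l' k) + c k * ln s).
      apply: eq_bigr => k _; rewrite -mulrDr -lnM ?posrE //.
        by rewrite mulrDl mulrAC mulVf ?gt_eqF // mul1r addrC (mulrC s).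
      by rewrite addr_gt0 // mulr_gt0 ?invr_gt0.
    by rewrite big_split /= -mulr_suml c0 mul0r addr0.
  have B (x y : K -> R) : (forall k, 0 < x k) -> (forall k, 0 < y k) ->
    `|\sum_k c k * ln (x k + s * y k) - \sum_k c k * ln (x k)|
       <= s * \sum_k `|c k| * (y k / x k).
    move=> x0 y0; rewrite -sumrB mulr_sumr (le_trans (ler_norm_sum _ _ _)) //.
    apply: ler_sum => k _; rewrite -mulrBr normrM mulrCA ler_wpM2l //.
    have /andP[h1 h2] := ln_shift_le (x0 k) (ltW (mulr_gt0 s0 (y0 k))).
    by rewrite ger0_norm // mulrA.
  have := B _ _ m'0 l'0; have := B _ _ l'0 m'0.
  move: mono; rewrite E2 /A.
  under [X in _ + s * X]eq_bigr do rewrite mulrDr.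
  rewrite big_split /= !ler_norml mulrDr => h /andP[_ h1] /andP[h2 _].
  lra.
apply/ler_addgt0Pr => e e0.
have [A00|Ap] := eqVneq A 0.
  by have := key 1 ltr01 (lexx _); rewrite A00 mulr0 addr0 => h; rewrite ler_wpDr // ltW.
have {}A0 : 0 < A by rewrite lt_neqAle eq_sym Ap.
pose s := Num.min 1 (e / A).
have s0 : 0 < s by rewrite lt_min ltr01 divr_gt0.
apply: (le_trans (key s s0 _)); first by rewrite ge_min lexx.
by rewrite lerD2l -ler_pdivlMr // ge_min lexx orbT.
Qed.

End LogInequality.

(** * Monotonicity of the relative entropy through quadratic forms *)

Section RelativeEntropy.
Variable R : realType.
Local Notation C := (R[i]).

Lemma tr_cyc n (U A : 'M[C]_n) : unitary U -> \tr (U *m A *m adj U) = \tr A.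
Proof. by move=> [h _]; rewrite mxtrace_mulC mulmxA h mul1mx. Qed.

Lemma conj_complex (a b : R) : Num.conj (Complex a b) = Complex a (- b).
Proof. by []. Qed.

Lemma tr_spectral n (U : 'M[C]_n) (l : 'I_n -> R) : unitary U ->
  \tr (U *m diag_mx (\row_i realc (l i)) *m adj U) = realc (\sum_i l i).
Proof.
move=> hU; rewrite tr_cyc // mxtrace_diag realc_sum.
by apply: eq_bigr => i _; rewrite mxE.
Qed.

(** The gap is |y a - t l|^2 / a. For [a = 0] the hypothesis gives [l = 0], and both sides are 0. *)
Lemma complete_square (y t : C) (l a : R) : 0 <= a -> (a = 0 -> l = 0) ->
  complex.Re (y^* * t) * l *+ 2 - nsq y * a <= nsq t * l * (l / a).
Proof.
case: y => y1 y2; case: t => t1 t2.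
rewrite /nsq !conj_complex /=.
rewrite le_eqVlt => /predU1P[<-|a0] al.
  by rewrite al // !mulr0 mul0rn mul0r subr0.
rewrite -subr_ge0.
have -> : (t1 * t1 - t2 * - t2) * l * (l / a) -
   ((y1 * t1 - - y2 * t2) * l *+ 2 - (y1 * y1 - y2 * - y2) * a) =
   ((y1 * a - t1 * l) ^+ 2 + (y2 * a - t2 * l) ^+ 2) / a.
  by field; rewrite gt_eqF.
by apply: divr_ge0; [apply: addr_ge0; exact: sqr_ge0|exact: ltW].
Qed.

Lemma complete_square_eq (t : C) (l a : R) : (a = 0 -> l = 0) ->
  complex.Re ((t * realc (l / a))^* * t) * l *+ 2 - nsq (t * realc (l / a)) * a
    = nsq t * l * (l / a).
Proof.
case: t => t1 t2; have [->->//|a0 _] := eqVneq a 0.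
  by rewrite !mulr0 mul0rn mul0r subr0.
have E : ((t1 +i* t2) * realc (l / a) = (t1 * (l / a)) +i* (t2 * (l / a)))%C.
  by rewrite /realc; apply/eqP; rewrite eq_complex /= !mulr0 subr0 add0r !eqxx.
rewrite E /nsq; set p := t1 * _; set q := t2 * _.
rewrite !conj_complex /=.
by rewrite /p /q; field.
Qed.

(* The maximum over X of this quadratic form is <P, (L_Q + s R_P)^-1 P>, with L_Q
   and R_P the left and right multiplications; integrated over s > 0 it gives
   Tr P (ln P - ln Q). Being linear in (P, Q) for fixed X, it makes the
   monotonicity of the relative entropy immediate. *)
Definition quad n (P Q : 'M[C]_n) (s : R) (X : 'M[C]_n) : R :=
  complex.Re (\tr (adj X *m P) *+ 2 - \tr (adj X *m Q *m X)
              - realc s * \tr (X *m P *m adj X)).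

Lemma quad_conj n (U W Y D M : 'M[C]_n) (s : R) : unitary U -> unitary W ->
  quad (W *m D *m adj W) (U *m M *m adj U) s (U *m Y *m adj W)
  = complex.Re (\tr (adj Y *m (adj U *m W) *m D) *+ 2 - \tr (adj Y *m (M *m Y))
      - realc s * \tr (Y *m D *m adj Y)).
Proof.
move=> hU hW; rewrite /quad !adjM adjK.
rewrite -[\tr (adj Y *m (adj U *m W) *m D)](tr_cyc _ hW) -[\tr (adj Y *m (M *m Y))](tr_cyc _ hW).
rewrite -[\tr (Y *m D *m adj Y)](tr_cyc _ hU) -!mulmxA.
by rewrite !(unitaryK _ hU) !(unitaryK _ hW).
Qed.

(** In eigenbases of [P] and [Q] the form splits into one scalar problem for each entry of [Y],
    which [complete_square] solves. *)
Lemma quadE n (U W Y : 'M[C]_n) (l m : 'I_n -> R) (s : R) :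
  unitary U -> unitary W ->
  quad (W *m diag_mx (\row_i realc (l i)) *m adj W)
       (U *m diag_mx (\row_i realc (m i)) *m adj U) s (U *m Y *m adj W)
  = \sum_j \sum_i (complex.Re ((Y j i)^* * (adj U *m W) j i) * l i *+ 2
                   - nsq (Y j i) * (m j + s * l i)).
Proof.
move=> hU hW; rewrite quad_conj //.
have -> : \tr (adj Y *m (adj U *m W) *m diag_mx (\row_i realc (l i))) =
   \sum_j \sum_i (Y j i)^* * (adj U *m W) j i * realc (l i).
  rewrite exchange_big; apply: eq_bigr => i _ /=.
  rewrite mul_mx_diagE mxE mulr_suml; apply: eq_bigr => j _.
  by rewrite adjE.
have -> : \tr (adj Y *m (diag_mx (\row_i realc (m i)) *m Y)) =
   \sum_j \sum_i realc (nsq (Y j i) * m j).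
  rewrite exchange_big; apply: eq_bigr => i _ /=.
  rewrite mxE; apply: eq_bigr => j _.
  by rewrite mul_diag_mxE adjE realcM nsqE; ring.
have -> : \tr (Y *m diag_mx (\row_i realc (l i)) *m adj Y) =
   \sum_j \sum_i realc (nsq (Y j i) * l i).
  apply: eq_bigr => j _; rewrite mxE; apply: eq_bigr => i _.
  by rewrite mul_mx_diagE adjE realcM nsqE; ring.
rewrite -sumrMnl mulr_sumr -!sumrB Re_sum; apply: eq_bigr => j _.
rewrite -sumrMnl mulr_sumr -!sumrB Re_sum; apply: eq_bigr => i _.
rewrite -realcM !mulr2n !ReD !ReN !ReK ReZr; ring.
Qed.

Lemma quad_le n (U W X : 'M[C]_n) (l m : 'I_n -> R) (s : R) :
  unitary U -> unitary W -> (forall i, 0 <= l i) -> (forall i, 0 <= m i) -> 0 < s ->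
  quad (W *m diag_mx (\row_i realc (l i)) *m adj W)
       (U *m diag_mx (\row_i realc (m i)) *m adj U) s X
  <= \sum_j \sum_i nsq ((adj U *m W) j i) * l i * (l i / (m j + s * l i)).
Proof.
move=> hU hW l0 m0 s0.
have -> : X = U *m (adj U *m X *m W) *m adj W.
  by rewrite -!mulmxA (proj2 hW) mulmx1 unitaryKV.
rewrite quadE //; apply: ler_sum => j _; apply: ler_sum => i _.
apply: complete_square; first by rewrite addr_ge0 ?mulr_ge0 // ltW.
move/eqP; rewrite paddr_eq0 ?mulr_ge0 ?(ltW s0) // => /andP[_].
by rewrite mulf_eq0 gt_eqF //= => /eqP.
Qed.

Lemma quad_attained n (U W : 'M[C]_n) (l m : 'I_n -> R) (s : R) :
  unitary U -> unitary W -> (forall i, 0 <= l i) -> (forall i, 0 <= m i) -> 0 < s ->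
  exists X,
  quad (W *m diag_mx (\row_i realc (l i)) *m adj W)
       (U *m diag_mx (\row_i realc (m i)) *m adj U) s X
  = \sum_j \sum_i nsq ((adj U *m W) j i) * l i * (l i / (m j + s * l i)).
Proof.
move=> hU hW l0 m0 s0.
pose Y := \matrix_(j, i) ((adj U *m W) j i * realc (l i / (m j + s * l i))).
exists (U *m Y *m adj W); rewrite quadE //.
apply: eq_bigr => j _; apply: eq_bigr => i _; rewrite [Y j i]mxE.
apply: complete_square_eq.
move/eqP; rewrite paddr_eq0 ?mulr_ge0 ?(ltW s0) // => /andP[_].
by rewrite mulf_eq0 gt_eqF //= => /eqP.
Qed.

Lemma expectE n (U W : 'M[C]_n) (l : 'I_n -> R) j : 
  complex.Re ((adj U *m (W *m diag_mx (\row_i realc (l i)) *m adj W) *m U) j j)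
   = \sum_i nsq ((adj U *m W) j i) * l i.
Proof.
have -> : adj U *m (W *m diag_mx (\row_i realc (l i)) *m adj W) *m U
  = (adj U *m W *m diag_mx (\row_i realc (l i))) *m adj (adj U *m W).
  by rewrite adjM adjK !mulmxA.
rewrite mxE Re_sum; apply: eq_bigr => i _.
by rewrite mul_mx_diagE adjE mulrAC -nsqE -realcM ReK.
Qed.

(* D(P2 || Q2) <= D(P1 || Q1) when (P2, Q2) is the image of (P1, Q1) under the
   adjoint of iota; e1 j and e2 j are the diagonal entries of P1 and P2 in the
   eigenbases of Q1 and Q2. *)
Lemma relent_mono n1 n2 (U1 W1 : 'M[C]_n1) (l1 m1 : 'I_n1 -> R)
  (U2 W2 : 'M[C]_n2) (l2 m2 : 'I_n2 -> R) (iota : 'M[C]_n2 -> 'M[C]_n1) :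
  let P1 := W1 *m diag_mx (\row_i realc (l1 i)) *m adj W1 in
  let Q1 := U1 *m diag_mx (\row_i realc (m1 i)) *m adj U1 in
  let P2 := W2 *m diag_mx (\row_i realc (l2 i)) *m adj W2 in
  let Q2 := U2 *m diag_mx (\row_i realc (m2 i)) *m adj U2 in
  let e1 j := complex.Re ((adj U1 *m P1 *m U1) j j) in
  let e2 j := complex.Re ((adj U2 *m P2 *m U2) j j) in
  [/\ unitary U1, unitary W1, unitary U2 & unitary W2] ->
  [/\ forall i, 0 <= l1 i, forall i, 0 <= m1 i,
      forall i, 0 <= l2 i & forall i, 0 <= m2 i] ->
  (forall j, m1 j = 0 -> e1 j = 0) -> (forall j, m2 j = 0 -> e2 j = 0) ->
  \tr P1 = \tr P2 ->
  (forall X, [/\ \tr (adj (iota X) *m P1) = \tr (adj X *m P2),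
     \tr (adj (iota X) *m Q1 *m iota X) = \tr (adj X *m Q2 *m X) &
     \tr (iota X *m P1 *m adj (iota X)) = \tr (X *m P2 *m adj X)]) ->
  \sum_i l2 i * ln (l2 i) - \sum_j e2 j * ln (m2 j) <=
  \sum_i l1 i * ln (l1 i) - \sum_j e1 j * ln (m1 j).
Proof.
move=> P1 Q1 P2 Q2 e1 e2 [hU1 hW1 hU2 hW2] [l10 m10 l20 m20] s1 s2 htr hi.
(* The support condition in usable form: an overlap of nonzero weight meets only positive
   eigenvalues of both matrices. *)
have sup n (U W : 'M[C]_n) (l m : 'I_n -> R) (e : 'I_n -> R) :
    (forall j, e j = \sum_i nsq ((adj U *m W) j i) * l i) ->
    (forall i, 0 <= l i) -> (forall i, 0 <= m i) ->
    (forall j, m j = 0 -> e j = 0) ->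
    forall j i, nsq ((adj U *m W) j i) * l i != 0 -> 0 < l i /\ 0 < m j.
  move=> eE l0 m0 sm j i nz; split.
    by rewrite lt_neqAle l0 andbT eq_sym; apply: contraNneq nz => ->; rewrite mulr0.
  rewrite lt_neqAle m0 andbT eq_sym; apply: contraNneq nz => /sm /eqP.
  rewrite eE psumr_eq0; last by move=> k _; rewrite mulr_ge0 ?nsq_ge0.
  by move=> /allP/(_ i (mem_index_enum _)).
have eE1 j := expectE U1 W1 l1 j.
have eE2 j := expectE U2 W2 l2 j.
pose w1 j i := nsq ((adj U1 *m W1) j i) * l1 i.
pose w2 j i := nsq ((adj U2 *m W2) j i) * l2 i.
(* Both relative entropies are merged into one signed family, the first pair counted positively and
   the second negatively. Equality of the traces makes the weights sum to 0, as [signed_ln_compare]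
   requires. *)
pose c (k : ('I_n1 * 'I_n1) + ('I_n2 * 'I_n2)) : R :=
  match k with inl p => w1 p.1 p.2 | inr p => - w2 p.1 p.2 end.
pose l (k : ('I_n1 * 'I_n1) + ('I_n2 * 'I_n2)) : R :=
  match k with inl p => l1 p.2 | inr p => l2 p.2 end.
pose m (k : ('I_n1 * 'I_n1) + ('I_n2 * 'I_n2)) : R :=
  match k with inl p => m1 p.1 | inr p => m2 p.1 end.
have cE (F : R -> R -> R) : \sum_k c k * F (l k) (m k) =
  \sum_j \sum_i w1 j i * F (l1 i) (m1 j) - \sum_j \sum_i w2 j i * F (l2 i) (m2 j).
  rewrite big_sumType /= !pair_bigA /= -sumrN; congr (_ + _).
  by apply: eq_bigr => k _; rewrite mulNr.
have rowS n (U W : 'M[C]_n) (l' : 'I_n -> R) (F : 'I_n -> R) : 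
    unitary U -> unitary W ->
    \sum_j \sum_i nsq ((adj U *m W) j i) * l' i * F i = \sum_i l' i * F i.
  move=> hU hW; rewrite exchange_big; apply: eq_bigr => i _ /=.
  rewrite -!mulr_suml unitary_col ?mul1r //.
  by apply: unitaryM => //; exact: unitary_adj.
have suml : \sum_i l1 i = \sum_i l2 i.
  by apply: realc_inj; rewrite -(tr_spectral _ hW1) -(tr_spectral _ hW2).
have := @signed_ln_compare R _ c l m.
have -> : \sum_k c k * ln (m k) =
    \sum_j e1 j * ln (m1 j) - \sum_j e2 j * ln (m2 j).
  rewrite (cE (fun _ m => ln m)); congr (_ - _); apply: eq_bigr => j _.
    by rewrite [e1 j]eE1 mulr_suml.
  by rewrite [e2 j]eE2 mulr_suml.
have -> : \sum_k c k * ln (l k) =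
    \sum_i l1 i * ln (l1 i) - \sum_i l2 i * ln (l2 i).
  rewrite (cE (fun l _ => ln l)); congr (_ - _).
    by rewrite (rowS _ _ _ _ (fun i => ln (l1 i))).
  by rewrite (rowS _ _ _ _ (fun i => ln (l2 i))).
move=> h.
suff: \sum_j e1 j * ln (m1 j) - \sum_j e2 j * ln (m2 j) <=
   \sum_i l1 i * ln (l1 i) - \sum_i l2 i * ln (l2 i) by lra.
apply: h.
- case=> -[j i] /=; rewrite ?oppr_eq0 => nz.
    by have [] := sup _ _ _ _ _ _ eE1 l10 m10 s1 _ _ nz.
  by have [] := sup _ _ _ _ _ _ eE2 l20 m20 s2 _ _ nz.
- case=> -[j i] /=; rewrite ?oppr_eq0 => nz.
    by have [] := sup _ _ _ _ _ _ eE1 l10 m10 s1 _ _ nz.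
  by have [] := sup _ _ _ _ _ _ eE2 l20 m20 s2 _ _ nz.
- have -> : \sum_k c k = \sum_k c k * 1 by under [RHS]eq_bigr do rewrite mulr1.
  rewrite (cE (fun _ _ => 1)) (rowS _ _ _ _ (fun=> 1)) // (rowS _ _ _ _ (fun=> 1)) //.
  by apply/eqP; rewrite subr_eq0; apply/eqP; under eq_bigr do rewrite mulr1;
     under [RHS]eq_bigr do rewrite mulr1.
move=> s s0; rewrite (cE (fun l m => l / (m + s * l))) subr_ge0.
(* The maximiser for the second pair, sent through [iota], is a competitor for the first pair with
   the same value. *)
have [X <-] := quad_attained hU2 hW2 l20 m20 s0.
apply: le_trans (quad_le (iota X) hU1 hW1 l10 m10 s0).
by rewrite /quad; have [-> -> ->] := hi X.
Qed.

End RelativeEntropy.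

(** * Strong subadditivity *)

Section StrongSubadditivity.
Variable R : realType.
Local Notation C := (R[i]).

Definition idtensor (A T : finType) (M : 'M[C]_#|T|) : 'M[C]_#|{: A * T}| :=
  mxof (fun u v : A * T => (u.1 == v.1)%:R * ent M u.2 v.2).

Lemma sum_pair (V : nmodType) (I J : finType) (F : I * J -> V) :
  \sum_p F p = \sum_i \sum_j F (i, j).
Proof. by rewrite pair_bigA; apply: eq_bigr => -[]. Qed.

Lemma sum_delta (I : finType) (i : I) (F : I -> C) :
  \sum_j (i == j)%:R * F j = F i.
Proof.
rewrite (bigD1 i) //= eqxx mul1r big1 ?addr0 // => j.
by rewrite eq_sym => /negPf->; rewrite mul0r.
Qed.
Lemma sum_delta' (I : finType) (i : I) (F : I -> C) :
  \sum_j (j == i)%:R * F j = F i.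
Proof. by rewrite -[RHS](sum_delta i); apply: eq_bigr => j _; rewrite eq_sym. Qed.

Lemma idtensorM (A T : finType) (M N : 'M[C]_#|T|) :
  idtensor A (M *m N) = idtensor A M *m idtensor A N.
Proof.
apply: mxof_inj => -[a t] [b u]; rewrite ent_mul !entE sum_pair /=.
transitivity (\sum_i (a == i)%:R * ((i == b)%:R * ent (M *m N) t u)).
  by rewrite sum_delta.
apply: eq_bigr => i _; rewrite ent_mul !mulr_sumr; apply: eq_bigr => j _.
by rewrite !entE /=; ring.
Qed.

Lemma idtensor_adj (A T : finType) (M : 'M[C]_#|T|) :
  adj (idtensor A M) = idtensor A (adj M).
Proof.
apply: mxof_inj => -[a t] [b u]; rewrite ent_adj !entE /= ent_adj.
by rewrite rmorphM /= conjC_nat eq_sym.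
Qed.

Lemma idtensor1 (A T : finType) : idtensor A (1%:M : 'M[C]_#|T|) = 1%:M.
Proof.
apply: mxof_inj => -[a t] [b u]; rewrite entE !ent1 /= xpair_eqE.
by case: eqP; rewrite ?mul1r ?mul0r.
Qed.

Lemma idtensor_diag (A T : finType) (m : 'I_#|T| -> R) :
  idtensor A (diag_mx (\row_i realc (m i))) =
  diag_mx (\row_i realc (m (enum_rank (enum_val i).2))).
Proof.
apply: mxof_inj => -[a t] [b u]; rewrite entE /ent !mxE enum_rankK /=.
rewrite !(inj_eq enum_rank_inj) xpair_eqE.
by case: eqP; rewrite ?mul1r ?mul0r.
Qed.

Lemma idtensor_unitary (A T : finType) (U : 'M[C]_#|T|) :
  unitary U -> unitary (idtensor A U).
Proof.
by case=> h1 h2; split; rewrite idtensor_adj -idtensorM ?h1 ?h2 idtensor1.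
Qed.

Lemma ptrL_idtensor (A T : finType) (M N : 'M[C]_#|T|) (X : 'M[C]_#|{: A * T}|) :
  ptrL (idtensor A M *m X *m idtensor A N) = M *m ptrL X *m N.
Proof.
apply: mxof_inj => t u; rewrite entE.
transitivity (\sum_a \sum_w \sum_v ent M t v * ent X (a, v) (a, w) * ent N w u).
  apply: eq_bigr => a _; rewrite ent_mul sum_pair /=.
  rewrite -[RHS](sum_delta' a (fun b => \sum_w \sum_v ent M t v * ent X (a, v) (b, w) * ent N w u)).
  apply: eq_bigr => b _; rewrite mulr_sumr; apply: eq_bigr => w _.
  rewrite entE /= mulrA [_ * (b == a)%:R]mulrC -mulrA; congr (_ * _).
  rewrite ent_mul -mulr_suml; congr (_ * _).
  rewrite sum_pair /= -[RHS](sum_delta a (fun a' => \sum_v ent M t v * ent X (a', v) (b, w))).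
  apply: eq_bigr => a' _; rewrite mulr_sumr; apply: eq_bigr => v _.
  by rewrite entE /= mulrA.
rewrite ent_mul exchange_big; apply: eq_bigr => w _ /=.
rewrite ent_mul mulr_suml exchange_big; apply: eq_bigr => v _ /=.
by rewrite -mulr_suml -mulr_sumr entE.
Qed.

(** For a state on A and T this is Tr rho_AT (1 tensor ln rho_T) = Tr rho_T ln rho_T. An eigenvalue
    of the marginal is the sum of the nonnegative diagonal entries above it, so if it is 0 they all
    vanish. *)
Lemma sum_expect_idtensor (A T : finType) (W : 'M[C]_#|{: A * T}|)
  (l : 'I_#|{: A * T}| -> R) (U : 'M[C]_#|T|) (m : 'I_#|T| -> R) :
  let X := W *m diag_mx (\row_i realc (l i)) *m adj W in
  let e j := complex.Re ((adj (idtensor A U) *m X *m idtensor A U) j j) in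
  let m' i := m (enum_rank (enum_val i).2) in
  unitary U -> (forall i, 0 <= l i) ->
  ptrL X = U *m diag_mx (\row_i realc (m i)) *m adj U ->
  (forall j, m' j = 0 -> e j = 0) /\
  \sum_j e j * ln (m' j) = \sum_k m k * ln (m k).
Proof.
move=> X e m' hU l0 hX.
have e0 j : 0 <= e j.
  by rewrite /e expectE; apply: sumr_ge0 => i _; rewrite mulr_ge0 ?nsq_ge0.
have se (t : T) : \sum_a e (enum_rank (a, t)) = m (enum_rank t).
  have : ent (ptrL (adj (idtensor A U) *m X *m idtensor A U)) t t =
         realc (m (enum_rank t)).
    rewrite idtensor_adj ptrL_idtensor hX !mulmxA (proj1 hU) mul1mx -mulmxA.
    by rewrite (proj1 hU) mulmx1 /ent !mxE eqxx mulr1n.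
  by rewrite entE => /(congr1 (@complex.Re R)); rewrite Re_sum ReK.
split=> [j mj|].
  have : \sum_a e (enum_rank (a, (enum_val j).2)) = 0 by rewrite se.
  move/eqP; rewrite psumr_eq0 // => /allP/(_ (enum_val j).1 (mem_index_enum _)).
  by rewrite -surjective_pairing enum_valK => /eqP.
rewrite !sum_enum_rank sum_pair exchange_big; apply: eq_bigr => t _ /=.
rewrite -[X in X * _]se mulr_suml; apply: eq_bigr => a _.
by rewrite /m' enum_rankK.
Qed.

(** The adjoint of the partial trace over [D], as [tr_righttensor] shows; it serves as the [iota] of
    [relent_mono]. *)
Definition righttensor (A B D : finType) (X : 'M[C]_#|{: A * B}|) :
  'M[C]_#|{: A * (B * D)}| :=
  mxof (fun u v : A * (B * D) =>
    (u.2.2 == v.2.2)%:R * ent X (u.1, u.2.1) (v.1, v.2.1)).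
Definition righttrace (A B D : finType) (M : 'M[C]_#|{: A * (B * D)}|) :
  'M[C]_#|{: A * B}| :=
  mxof (fun u v : A * B => \sum_d ent M (u.1, (u.2, d)) (v.1, (v.2, d))).

Lemma righttensorM (A B D : finType) (X Y : 'M[C]_#|{: A * B}|) :
  righttensor D (X *m Y) = righttensor D X *m righttensor D Y.
Proof.
apply: mxof_inj => -[a [b d]] [a' [b' d']]; rewrite ent_mul entE /= ent_mul.
rewrite mulr_sumr !sum_pair; apply: eq_bigr => i _ /=.
rewrite sum_pair; apply: eq_bigr => j _ /=.
under eq_bigr do rewrite !entE /= -!mulrA.
by rewrite sum_delta; ring.
Qed.

Lemma righttensor_adj (A B D : finType) (X : 'M[C]_#|{: A * B}|) :
  adj (righttensor D X) = righttensor D (adj X).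
Proof.
apply: mxof_inj => -[a [b d]] [a' [b' d']]; rewrite ent_adj !entE /= ent_adj.
by rewrite rmorphM /= conjC_nat eq_sym.
Qed.

Lemma tr_righttensor (A B D : finType) (X : 'M[C]_#|{: A * B}|)
  (M : 'M[C]_#|{: A * (B * D)}|) :
  \tr (righttensor D X *m M) = \tr (X *m righttrace M).
Proof.
rewrite !ent_tr !sum_pair; apply: eq_bigr => a _; rewrite sum_pair.
apply: eq_bigr => b _ /=; rewrite ent_mul.
under eq_bigr do rewrite ent_mul.
rewrite exchange_big !sum_pair; apply: eq_bigr => a' _ /=.
rewrite sum_pair; apply: eq_bigr => b' _ /=.
rewrite entE mulr_sumr; apply: eq_bigr => d _ /=.
by under eq_bigr do rewrite entE /= -mulrA; rewrite sum_delta'.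
Qed.

(** The relative entropy of rho_ABD with respect to 1_A tensor rho_BD is H(BD) - H(ABD). Tracing out
    [D] does not increase it and turns it into H(B) - H(AB). The system [Z] purifies. *)
Lemma strong_subadditivity (A B D Z : finType) (f : A -> B -> D -> Z -> C) :
  entropy (fun (u : A * (B * D)) z => f u.1 u.2.1 u.2.2 z)
  + entropy (fun b (v : A * (D * Z)) => f v.1 b v.2.1 v.2.2)
  <= entropy (fun (u : A * B) (v : D * Z) => f u.1 u.2 v.1 v.2)
     + entropy (fun (u : B * D) (v : A * Z) => f v.1 u.1 u.2 v.2).
Proof.
set fABD := fun (u : A * (B * D)) z => f u.1 u.2.1 u.2.2 z.
set fB := fun b (v : A * (D * Z)) => f v.1 b v.2.1 v.2.2.
set fAB := fun (u : A * B) (v : D * Z) => f u.1 u.2 v.1 v.2.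
set fBD := fun (u : B * D) (v : A * Z) => f v.1 u.1 u.2 v.2.
have [W1 [l1 [hW1 l10 E1 HE1]]] := entropy_spectral fABD.
have [V1 [m1 [hV1 m10 F1 HF1]]] := entropy_spectral fBD.
have [W2 [l2 [hW2 l20 E2 HE2]]] := entropy_spectral fAB.
have [V2 [m2 [hV2 m20 F2 HF2]]] := entropy_spectral fB.
rewrite HE1 HF1 HE2 HF2.
have P1 : ptrL (mxof fABD *m adj (mxof fABD)) = mxof fBD *m adj (mxof fBD).
  apply: mxof_inj => -[b d] [b' d']; rewrite entE.
  under eq_bigr do rewrite adj_mxof ent_mul.
  rewrite ent_mul adj_mxof sum_pair; apply: eq_bigr => a _; apply: eq_bigr => z _.
  by rewrite !entE.
have P2 : ptrL (mxof fAB *m adj (mxof fAB)) = mxof fB *m adj (mxof fB).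
  apply: mxof_inj => b b'; rewrite entE.
  under eq_bigr do rewrite adj_mxof ent_mul.
  rewrite ent_mul adj_mxof sum_pair; apply: eq_bigr => a _; apply: eq_bigr => z _.
  by rewrite !entE.
have P3 : righttrace (mxof fABD *m adj (mxof fABD)) = mxof fAB *m adj (mxof fAB).
  apply: mxof_inj => -[a b] [a' b']; rewrite entE.
  under eq_bigr do rewrite adj_mxof ent_mul.
  rewrite ent_mul adj_mxof sum_pair; apply: eq_bigr => d _; apply: eq_bigr => z _.
  by rewrite !entE.
have P4 : righttrace (idtensor A (mxof fBD *m adj (mxof fBD))) =
          idtensor A (mxof fB *m adj (mxof fB)).
  apply: mxof_inj => -[a b] [a' b']; rewrite !entE /=.
  under eq_bigr do rewrite entE /=.
  rewrite -mulr_sumr; congr (_ * _).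
  transitivity (\sum_d \sum_a0 \sum_z f a0 b d z * (f a0 b' d z)^*).
    apply: eq_bigr => d _; rewrite ent_mul sum_pair; apply: eq_bigr => a0 _.
    by apply: eq_bigr => z _; rewrite ent_adj !entE.
  rewrite exchange_big /= ent_mul sum_pair; apply: eq_bigr => a0 _.
  rewrite sum_pair; apply: eq_bigr => d _; apply: eq_bigr => z _.
  by rewrite ent_adj !entE.
rewrite E1 F1 in P1; rewrite E2 F2 in P2.
have [s1 S1] := sum_expect_idtensor hV1 l10 P1.
have [s2 S2] := sum_expect_idtensor hV2 l20 P2.
have := @relent_mono R _ _ (idtensor A V1) W1 l1
  (fun i => m1 (enum_rank (enum_val i).2)) (idtensor A V2) W2 l2
  (fun i => m2 (enum_rank (enum_val i).2)) (@righttensor A B D).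
rewrite /= S1 S2 => h; suff: \sum_i l2 i * ln (l2 i) - \sum_k m2 k * ln (m2 k)
  <= \sum_i l1 i * ln (l1 i) - \sum_k m1 k * ln (m1 k) by lra.
have tr3 X : \tr (righttensor D X *m (mxof fABD *m adj (mxof fABD)))
             = \tr (X *m (mxof fAB *m adj (mxof fAB))).
  by rewrite tr_righttensor P3.
have tr4 X : \tr (righttensor D X *m (idtensor A (mxof fBD *m adj (mxof fBD))))
             = \tr (X *m idtensor A (mxof fB *m adj (mxof fB))).
  by rewrite tr_righttensor P4.
have QE1 : idtensor A V1 *m diag_mx (\row_i realc (m1 (enum_rank (enum_val i).2)))
    *m adj (idtensor A V1) = idtensor A (mxof fBD *m adj (mxof fBD)).
  by rewrite F1 !idtensorM idtensor_diag idtensor_adj.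
have QE2 : idtensor A V2 *m diag_mx (\row_i realc (m2 (enum_rank (enum_val i).2)))
    *m adj (idtensor A V2) = idtensor A (mxof fB *m adj (mxof fB)).
  by rewrite F2 !idtensorM idtensor_diag idtensor_adj.
apply: h => //; first by split => //; exact: idtensor_unitary.
- rewrite -E1 -E2.
  rewrite -[mxof fABD *m _]mul1mx -[mxof fAB *m _]mul1mx -tr3; congr (\tr (_ *m _)).
  apply: mxof_inj => -[a [b d]] [a' [b' d']]; rewrite entE !ent1 /= !xpair_eqE.
  by do !case: eqP; rewrite ?mul1r ?mul0r ?mulr0 ?mulr1.
move=> X; rewrite -E1 -E2 righttensor_adj; split; first exact: tr3.
- rewrite QE1 QE2 mxtrace_mulC mulmxA -righttensorM tr4 -mulmxA.
  by rewrite mxtrace_mulC.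
by rewrite mxtrace_mulC mulmxA -righttensorM tr3 -mulmxA mxtrace_mulC.
Qed.

End StrongSubadditivity.

(** * Entropies of ensembles *)

Section Ensembles.
Variable R : realType.
Local Notation C := (R[i]).

(** Eigenbases of the blocks together form an eigenbasis of the block-diagonal operator. The blocks
    carry their own weights, so no separate entropy of the label appears. *)
Lemma entropy_block (I S T : finType) (g : I -> S -> T -> C) :
  entropy (fun (u : I * S) (v : I * T) => (u.1 == v.1)%:R * g u.1 u.2 v.2)
  = \sum_i entropy (g i).
Proof.
have /fin_all_exists[U hU] : forall i, exists Ul : 'M[C]_#|S| * ('I_#|S| -> R),
    [/\ unitary Ul.1, mxof (g i) *m adj (mxof (g i)) =
          Ul.1 *m diag_mx (\row_i realc (Ul.2 i)) *m adj Ul.1 &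
        entropy (g i) = - \sum_i Ul.2 i * ln (Ul.2 i)].
  by move=> i; have [V [l [h1 _ h2 h3]]] := entropy_spectral (g i); exists (V, l).
pose V : 'M[C]_#|{: I * S}| := mxof (fun u v : I * S => (u.1 == v.1)%:R * ent (U u.1).1 u.2 v.2).
pose l (k : 'I_#|{: I * S}|) := (U (enum_val k).1).2 (enum_rank (enum_val k).2).
have entd (d : 'I_#|{: I * S}| -> R) (u v : I * S) :
    ent (diag_mx (\row_k realc (d k))) u v = (u == v)%:R * realc (d (enum_rank u)).
  by rewrite /ent !mxE (inj_eq enum_rank_inj) mulr_natl.
have hV : unitary V.
  split; apply: mxof_inj => -[i s] [j t]; rewrite ent_mul ent1 xpair_eqE sum_pair /=.
    transitivity (\sum_k (i == k)%:R * ((i == j)%:R * \sum_s' (ent (U i).1 s' s)^* * ent (U i).1 s' t)).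
      apply: eq_bigr => k _; have [<-|nk] := eqVneq i k.
        rewrite mul1r mulr_sumr; apply: eq_bigr => s' _.
        by rewrite ent_adj !entE /= eqxx mul1r; ring.
      rewrite mul0r big1 // => s' _; rewrite ent_adj !entE /= eq_sym (negPf nk).
      by rewrite mul0r conjC0 mul0r.
    rewrite sum_delta -mulnb natrM; congr (_ * _).
    have [[/(congr1 (fun M => ent M s t)) h _] _ _] := hU i.
    rewrite ent_mul ent1 in h; rewrite -h; apply: eq_bigr => s' _.
    by rewrite ent_adj.
  transitivity (\sum_k (i == k)%:R * ((i == j)%:R * \sum_s' ent (U i).1 s s' * (ent (U i).1 t s')^*)).
    apply: eq_bigr => k _; have [<-|nk] := eqVneq i k.
      rewrite mul1r mulr_sumr; apply: eq_bigr => s' _.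
      rewrite ent_adj !entE /= eqxx mul1r eq_sym.
      by have [->|] := eqVneq i j; rewrite ?mul1r ?mul0r ?conjC0 ?mulr0.
    by rewrite mul0r big1 // => s' _; rewrite !entE /= (negPf nk) !mul0r.
  rewrite sum_delta -mulnb natrM; congr (_ * _).
  have [[_ /(congr1 (fun M => ent M s t)) h] _ _] := hU i.
  rewrite ent_mul ent1 in h; rewrite -h; apply: eq_bigr => s' _.
  by rewrite ent_adj.
rewrite entropyE; set M := mxof _.
have -> : M = V *m diag_mx (\row_k realc (l k)) *m adj V.
  apply: mxof_inj => -[i s] [j t]; rewrite entE sum_pair ent_mul sum_pair /=.
  have -> : \sum_k \sum_t0 (i == k)%:R * g i s t0 * ((j == k)%:R * g j t t0)^*
    = (i == j)%:R * \sum_t0 g i s t0 * (g i t t0)^*.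
    rewrite -[RHS](sum_delta i (fun=> (i == j)%:R * \sum_t0 g i s t0 * (g i t t0)^*)).
    apply: eq_bigr => k _; rewrite !mulr_sumr; apply: eq_bigr => t0 _.
    have [<-|] := eqVneq i k; last by rewrite !mul0r.
    rewrite eq_sym; have [->|] := eqVneq i j; first by rewrite !mul1r.
    by rewrite !mul0r conjC0 mulr0 mulr0.
  transitivity (\sum_k (i == k)%:R * ((i == j)%:R *
     \sum_s' ent (U i).1 s s' * realc ((U i).2 (enum_rank s')) * (ent (U i).1 t s')^*)).
    rewrite sum_delta; congr (_ * _).
    have [_ /(congr1 (fun M => ent M s t)) h _] := hU i.
    rewrite ent_mul in h; under eq_bigr do rewrite -{1}[g i s _](entE (g i)) -[g i t _](entE (g i)).
    under eq_bigr do rewrite -ent_adj.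
    rewrite h ent_mul; apply: eq_bigr => s' _; rewrite ent_adj; congr (_ * _).
    by rewrite /ent mul_mx_diagE.
  apply: eq_bigr => k _; rewrite !mulr_sumr; apply: eq_bigr => s' _.
  have -> : ent (V *m diag_mx (\row_k0 realc (l k0))) (i, s) (k, s') =
     ent V (i, s) (k, s') * realc (l (enum_rank (k, s'))).
    by rewrite /ent mul_mx_diagE.
  rewrite ent_adj !entE /l enum_rankK /=.
  have [<-|] := eqVneq i k; last by rewrite !mul0r.
  rewrite eq_sym; have [->|] := eqVneq i j; first by rewrite !mul1r.
  by rewrite !mul0r conjC0 !mulr0.
rewrite vN_entropyE // -sumrN sum_enum_rank sum_pair; apply: eq_bigr => i _.
have [_ _ ->] := hU i; rewrite -sumrN [RHS]sum_enum_rank.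
by apply: eq_bigr => s _; rewrite /l enum_rankK.
Qed.

Definition eta (t : R) : R := - (t * ln t).

(** The tangent bound ln x <= x - 1 at x = b / a; summed over an index it becomes Gibbs'
    inequality. *)
Lemma eta_gibbs (a b : R) : 0 <= a -> 0 <= b -> (0 < a -> 0 < b) ->
  eta a <= b - a - a * ln b.
Proof.
rewrite le_eqVlt => /predU1P[<-|a0] b0 ab.
  by rewrite /eta !mul0r !subr0 oppr0.
have {}b0 := ab a0; rewrite /eta.
have h : ln (b / a) <= b / a - 1.
  have := le_ln1Dx (_ : -1 < b / a - 1); rewrite addrCA subrr addr0; apply.
  by rewrite ltrBrDl subrr divr_gt0.
have : a * ln (b / a) <= b - a.
  by have -> : b - a = a * (b / a - 1); [field; rewrite gt_eqF|rewrite ler_pM2l].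
by rewrite ln_div ?posrE // mulrBr; lra.
Qed.

Definition mass (S T : finType) (f : S -> T -> C) : R := \sum_s \sum_t nsq (f s t).

Lemma mass_ge0 (S T : finType) (f : S -> T -> C) : 0 <= mass f.
Proof. by do 2 apply: sumr_ge0 => ? _; exact: nsq_ge0. Qed.

Lemma mass_trace (S T : finType) (f : S -> T -> C) :
  realc (mass f) = \tr (mxof f *m adj (mxof f)).
Proof.
rewrite ent_tr /mass realc_sum; apply: eq_bigr => s _.
rewrite ent_mul realc_sum; apply: eq_bigr => t _.
by rewrite ent_adj !entE nsqE.
Qed.

Lemma entropy_spectrum (S T : finType) (f : S -> T -> C) : exists l : 'I_#|S| -> R,
  [/\ forall i, 0 <= l i, \sum_i l i = mass f & entropy f = \sum_i eta (l i)].
Proof.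
have [U [l [hU l0 E ->]]] := entropy_spectral f; exists l; split=> //.
  by apply: realc_inj; rewrite mass_trace E tr_spectral.
by rewrite sumrN.
Qed.

Lemma sum_unit (V : nmodType) (F : unit -> V) : \sum_i F i = F tt.
Proof. by rewrite (bigD1 tt) //= big1 ?addr0 // => -[]. Qed.

Lemma entropy_unit (T : finType) (f : unit -> T -> C) : entropy f = eta (mass f).
Proof.
have [l [_ <- ->]] := entropy_spectrum f.
have E (F : 'I_#|{: unit}| -> R) : \sum_i F i = F (enum_rank tt).
  by rewrite sum_enum_rank sum_unit.
by rewrite !E.
Qed.

Lemma entropy_ge_eta (S T : finType) (f : S -> T -> C) : eta (mass f) <= entropy f.
Proof.
have [l [l0 <- ->]] := entropy_spectrum f; rewrite /eta mulr_suml -sumrN.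
apply: ler_sum => i _; rewrite lerN2.
have [->|li] := eqVneq (l i) 0; first by rewrite !mul0r.
have {}li : 0 < l i by rewrite lt_neqAle eq_sym li l0.
have ls : l i <= \sum_i l i.
  by rewrite (bigD1 i) //= lerDl sumr_ge0.
by rewrite ler_pM2l // ler_ln ?posrE // (lt_le_trans li).
Qed.

(** Gibbs' inequality against the uniform spectrum with the same total. *)
Lemma entropy_le_card (S T : finType) (f : S -> T -> C) :
  entropy f <= eta (mass f) + mass f * ln #|S|%:R.
Proof.
have [l [l0 ls ->]] := entropy_spectrum f; rewrite -ls; set t := \sum_i l i.
have t0 : 0 <= t by apply: sumr_ge0.
have [t00|tp] := eqVneq t 0.
  rewrite t00 !mul0r addr0 /eta mul0r oppr0.
  move/eqP: t00; rewrite psumr_eq0 // => /allP h; rewrite big1 // => i _.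
  by rewrite (eqP (h i (mem_index_enum _))) mul0r oppr0.
have {}tp : 0 < t by rewrite lt_neqAle eq_sym tp.
have d0 : (0 : R) < #|S|%:R.
  rewrite ltr0n lt0n; apply: contraTneq tp => S0.
  by rewrite /t big1 ?ltxx // => i; have := leq_ltn_trans (leq0n i) (ltn_ord i); rewrite lt0n => /eqP; case; exact: S0.
have b0 : 0 < t / #|S|%:R by rewrite divr_gt0.
apply: le_trans (_ : \sum_i (t / #|S|%:R - l i - l i * ln (t / #|S|%:R)) <= _).
  by apply: ler_sum => i _; apply: eta_gibbs => //; exact: ltW.
have E (n : nat) : (0 : R) < n%:R -> \sum_(i < n) t / n%:R = t.
  by move=> n0; rewrite sumr_const card_ord -[(t / _) *+ _]mulr_natr divfK ?gt_eqF.
rewrite !sumrB E // -mulr_suml -/t subrr sub0r ln_div ?posrE //.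
by rewrite mulrBr opprB addrC /eta.
Qed.

(** Strong subadditivity for the label, [S] and [T]. A copy of the label in the purifying system
    makes it classical, so that the left side is H(XST) - H(XS) and the right side H(ST) - H(S). *)
Lemma cond_concave (X S T Z : finType) (g : X -> S -> T -> Z -> C) :
  \sum_x (entropy (fun (u : S * T) z => g x u.1 u.2 z)
          - entropy (fun s (v : T * Z) => g x s v.1 v.2))
  <= entropy (fun (u : S * T) (v : X * Z) => g v.1 u.1 u.2 v.2)
     - entropy (fun s (v : T * (X * Z)) => g v.2.1 s v.1 v.2.2).
Proof.
have := @strong_subadditivity R X S T (X * Z)%type
  (fun x s t w => (x == w.1)%:R * g x s t w.2).
have -> : entropy (fun (u : X * (S * T)) (z : X * Z) => (u.1 == z.1)%:R * g u.1 u.2.1 u.2.2 z.2)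
  = \sum_x entropy (fun (u : S * T) z => g x u.1 u.2 z).
  by rewrite -entropy_block.
have -> : entropy (fun (u : X * S) (v : T * (X * Z)) => (u.1 == v.2.1)%:R * g u.1 u.2 v.1 v.2.2)
  = \sum_x entropy (fun s (v : T * Z) => g x s v.1 v.2).
  rewrite -entropy_block; pose h (w : X * (T * Z)) := (w.2.1, (w.1, w.2.2)).
  rewrite -(entropy_bij_col (h := h)) //.
  by exists (fun w : T * (X * Z) => (w.2.1, (w.1, w.2.2))); [case=> ? []|case=> ? []].
have E1 : entropy (fun (u : S * T) (v : X * (X * Z)) => (v.1 == v.2.1)%:R * g v.1 u.1 u.2 v.2.2)
  = entropy (fun (u : S * T) (v : X * Z) => g v.1 u.1 u.2 v.2).
  apply: eq_entropy_row => u u'; rewrite !sum_pair; apply: eq_bigr => x _.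
  rewrite sum_pair -[RHS](sum_delta x (fun x => \sum_z g x u.1 u.2 z * (g x u'.1 u'.2 z)^*)).
  apply: eq_bigr => y _; rewrite mulr_sumr; apply: eq_bigr => z _ /=.
  by have [->|] := eqVneq x y; rewrite ?mul1r // !mul0r.
have E2 : entropy (fun s (v : X * (T * (X * Z))) => (v.1 == v.2.2.1)%:R * g v.1 s v.2.1 v.2.2.2)
  = entropy (fun s (v : T * (X * Z)) => g v.2.1 s v.1 v.2.2).
  apply: eq_entropy_row => u u'; rewrite sum_pair exchange_big /= sum_pair.
  rewrite [RHS]sum_pair; apply: eq_bigr => t _.
  rewrite sum_pair [RHS]sum_pair; apply: eq_bigr => x _; apply: eq_bigr => z _ /=.
  rewrite -[RHS](sum_delta' x (fun=> g x u t z * (g x u' t z)^*)).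
  apply: eq_bigr => y _.
  by have [->|] := eqVneq y x; rewrite ?mul1r // !mul0r.
rewrite E1 E2 sumrB; lra.
Qed.

(** [cond_concave] with a one-point [S], whose entropy is [eta] of the mass; this is the correction
    for missing normalisation. *)
Lemma entropy_concave (X T Z : finType) (g : X -> T -> Z -> C) :
  \sum_x (entropy (g x) - eta (mass (g x)))
  <= entropy (fun t (v : X * Z) => g v.1 t v.2) - eta (\sum_x mass (g x)).
Proof.
have := @cond_concave X unit T Z (fun x _ t z => g x t z).
have bu : bijective (pair tt : T -> unit * T) by exists snd => // -[[]].
rewrite entropy_unit.
have -> : mass (fun (_ : unit) (v : T * (X * Z)) => g v.2.1 v.1 v.2.2) =
   \sum_x mass (g x).
  rewrite /mass sum_unit.
  rewrite sum_pair exchange_big /=; under [RHS]eq_bigr do rewrite exchange_big.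
  by rewrite sum_pair.
rewrite -(entropy_bij_row _ bu) /=; congr (_ <= _); apply: eq_bigr => x _.
rewrite -(entropy_bij_row _ bu) /= entropy_unit; congr (_ - eta _).
rewrite /mass sum_unit.
by rewrite sum_pair.
Qed.

End Ensembles.

(** * Subadditivity, positive matrices and continuity of the entropy *)

Section Continuity.
Variable R : realType.
Local Notation C := (R[i]).

Lemma entropy_bij (S S' T T' : finType) (f : S -> T -> C) (g : S' -> T' -> C)
  (h : S' -> S) (h' : S -> S') (k : T' -> T) (k' : T -> T') :
  cancel h h' -> cancel h' h -> cancel k k' -> cancel k' k ->
  (forall s t, g s t = f (h s) (k t)) -> entropy g = entropy f.
Proof.
move=> hK h'K kK k'K e; rewrite (eq_entropy e).
rewrite (entropy_bij_row (fun s t => f s (k t)) (Bijective hK h'K)).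
exact: (entropy_bij_col f (Bijective kK k'K)).
Qed.

Lemma mul_delta (b b' : bool) (x y : C) :
  (b%:R * x) * (b'%:R * y)^* = (b && b')%:R * (x * y^*).
Proof. by case: b; case: b'; rewrite !(mul1r, mul0r, conjC0, mulr0). Qed.

(** Forgetting a classical label cannot raise the entropy: H(T) <= H(XT). Strong subadditivity is
    applied to two copies of the label; their joint entropy equals that of one copy and cancels. *)
Lemma entropy_subadd (X T Z : finType) (g : X -> T -> Z -> C) :
  entropy (fun t (v : X * Z) => g v.1 t v.2) <= \sum_x entropy (g x).
Proof.
have := @strong_subadditivity R X X (X * Z)%type T
  (fun x x' w t => ((x == x') && (x == w.1))%:R * g x t w.2).
have -> : entropy (fun (u : X * (X * (X * Z))) t =>
    ((u.1 == u.2.1) && (u.1 == u.2.2.1))%:R * g u.1 t u.2.2.2)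
  = entropy (fun t (v : X * Z) => g v.1 t v.2).
  rewrite -entropy_swap; apply: eq_entropy_row => t t'; rewrite sum_pair [RHS]sum_pair.
  apply: eq_bigr => x _; rewrite sum_pair.
  rewrite -[RHS](sum_delta x (fun=> \sum_z g x t z * (g x t' z)^*)).
  apply: eq_bigr => x' _; rewrite sum_pair /=.
  case: (x == x'); last first.
    by rewrite mul0r big1 // => x'' _; rewrite big1 // => z _; rewrite !mul0r.
  rewrite mul1r -[RHS](sum_delta x (fun=> \sum_z g x t z * (g x t' z)^*)).
  apply: eq_bigr => x'' _; rewrite !mulr_sumr; apply: eq_bigr => z _.
  by rewrite mul_delta andbb.
have -> : entropy (fun (u : X * X) (v : (X * Z) * T) =>
    ((u.1 == u.2) && (u.1 == v.1.1))%:R * g u.1 v.2 v.1.2)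
  = entropy (fun (u : X) (v : X * ((X * Z) * T)) =>
    ((v.1 == u) && (v.1 == v.2.1.1))%:R * g v.1 v.2.2 v.2.1.2).
  transitivity (entropy (fun (u : X) (v : (X * Z) * T) => (u == v.1.1)%:R * g u v.2 v.1.2)).
    apply: eq_entropy_col => v v'; rewrite sum_pair; apply: eq_bigr => x _ /=.
    rewrite mul_delta.
    rewrite -[RHS](sum_delta x (fun=> ((x == v.1.1) && (x == v'.1.1))%:R * (g x v.2 v.1.2 * (g x v'.2 v'.1.2)^*))).
    apply: eq_bigr => y _; rewrite mul_delta.
    by case: (x == y); rewrite /= ?mul1r ?mul0r.
  apply: eq_entropy_row => u u'; rewrite [RHS]sum_pair exchange_big; apply: eq_bigr => v _ /=.
  rewrite -[LHS](sum_delta' u (fun=> (u == v.1.1)%:R * g u v.2 v.1.2 * ((u' == v.1.1)%:R * g u' v.2 v.1.2)^*)).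
  apply: eq_bigr => x _; rewrite !mul_delta.
  have [->|] := eqVneq x u; last by rewrite !mul0r.
  rewrite mul1r; have [->|] := eqVneq u u'; first by [].
  move=> uu' /=; case: eqP => [e1|]; case: eqP => [e2|]; rewrite ?mul0r ?andbF //.
  by case/eqP: uu'; rewrite e1 e2.
have -> : entropy (fun (u : X * (X * Z)) (v : X * T) =>
    ((v.1 == u.1) && (v.1 == u.2.1))%:R * g v.1 v.2 u.2.2) = \sum_x entropy (g x).
  rewrite -entropy_swap -entropy_block; apply: eq_entropy_row => -[x t] [y t'] /=.
  rewrite sum_pair [RHS]sum_pair; apply: eq_bigr => w _.
  rewrite sum_pair exchange_big; apply: eq_bigr => z _ /=.
  rewrite mul_delta -[RHS](sum_delta w (fun=> ((x == w) && (y == w))%:R * (g x t z * (g y t' z)^*))).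
  apply: eq_bigr => v _; rewrite mul_delta.
  have [<-|nw] := eqVneq w v; first by rewrite mul1r; case: (x == w); case: (y == w).
  rewrite mul0r; case: eqP => [->|]; last by rewrite mul0r.
  by rewrite (negPf nw) mul0r.
lra.
Qed.

(** One use of strong subadditivity splits H(F1F2|E1E2) into H(F1|E1E2) + H(F2|E1E2); two more
    remove the foreign system from each condition. *)
Lemma cond_subadd (E1 F1 E2 F2 Z : finType) (f : E1 -> F1 -> E2 -> F2 -> Z -> C) :
  entropy (fun (u : (E1 * F1) * (E2 * F2)) z => f u.1.1 u.1.2 u.2.1 u.2.2 z)
  - entropy (fun (u : E1 * E2) (v : (F1 * F2) * Z) => f u.1 v.1.1 u.2 v.1.2 v.2)
  <= (entropy (fun (u : E1 * F1) (v : (E2 * F2) * Z) => f u.1 u.2 v.1.1 v.1.2 v.2)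
      - entropy (fun (u : E1) (v : F1 * ((E2 * F2) * Z)) => f u v.1 v.2.1.1 v.2.1.2 v.2.2))
   + (entropy (fun (u : E2 * F2) (v : (E1 * F1) * Z) => f v.1.1 v.1.2 u.1 u.2 v.2)
      - entropy (fun (u : E2) (v : F2 * ((E1 * F1) * Z)) => f v.2.1.1 v.2.1.2 u v.1 v.2.2)).
Proof.
have := @strong_subadditivity R F1 (E1 * E2)%type F2 Z (fun f1 e f2 z => f e.1 f1 e.2 f2 z).
have := @strong_subadditivity R F1 E1 E2 (F2 * Z)%type (fun f1 e1 e2 v => f e1 f1 e2 v.1 v.2).
have := @strong_subadditivity R F2 E2 E1 (F1 * Z)%type (fun f2 e2 e1 v => f e1 v.1 e2 f2 v.2).
have -> : entropy (fun (u : F1 * ((E1 * E2) * F2)) z => f u.2.1.1 u.1 u.2.1.2 u.2.2 z)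
  = entropy (fun (u : (E1 * F1) * (E2 * F2)) z => f u.1.1 u.1.2 u.2.1 u.2.2 z).
  by apply: (entropy_bij (h := fun u => ((u.2.1.1, u.1), (u.2.1.2, u.2.2)))
    (h' := fun u => (u.1.2, ((u.1.1, u.2.1), u.2.2))) (k := id) (k' := id)) => //;
   [case=> ? [[? ?] ?]|case=> [[? ?] [? ?]]].
set a := entropy (fun (u : (E1 * F1) * (E2 * F2)) z => _).
have -> : entropy (fun (u : E1 * E2) (v : F1 * (F2 * Z)) => f u.1 v.1 u.2 v.2.1 v.2.2) =
   entropy (fun (u : E1 * E2) (v : (F1 * F2) * Z) => f u.1 v.1.1 u.2 v.1.2 v.2).
  by apply: (entropy_bij (h := id) (h' := id) (k := fun u => ((u.1, u.2.1), u.2.2))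
    (k' := fun u => (u.1.1, (u.1.2, u.2)))) => //;
   [case=> ? [? ?]|case=> [[? ?] ?]].
set b := entropy (fun (u : E1 * E2) (v : (F1 * F2) * Z) => _).
have -> : entropy (fun (u : E2 * E1) (v : F2 * (F1 * Z)) => f u.2 v.2.1 u.1 v.1 v.2.2) = b.
  by apply: (entropy_bij (h := fun u => (u.2, u.1)) (h' := fun u => (u.2, u.1))
    (k := fun u => ((u.2.1, u.1), u.2.2)) (k' := fun u => (u.1.2, (u.1.1, u.2)))) => //;
   [case=> ? ?|case=> ? ?|case=> ? [? ?]|case=> [[? ?] ?]].
have -> : entropy (fun (u : F2 * (E2 * E1)) (v : F1 * Z) => f u.2.2 v.1 u.2.1 u.1 v.2)
  = entropy (fun (u : (E1 * E2) * F2) (v : F1 * Z) => f u.1.1 v.1 u.1.2 u.2 v.2).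
  by apply: (entropy_bij (h := fun u => ((u.2.2, u.2.1), u.1))
    (h' := fun u => (u.2, (u.1.2, u.1.1))) (k := id) (k' := id)) => //;
   [case=> ? [? ?]|case=> [[? ?] ?]].
set c := entropy (fun (u : (E1 * E2) * F2) (v : F1 * Z) => _).
set d := entropy (fun (u : F1 * (E1 * E2)) (v : F2 * Z) => _).
have -> : entropy (fun (u : F1 * E1) (v : E2 * (F2 * Z)) => f u.2 u.1 v.1 v.2.1 v.2.2)
  = entropy (fun (u : E1 * F1) (v : (E2 * F2) * Z) => f u.1 u.2 v.1.1 v.1.2 v.2).
  by apply: (entropy_bij (h := fun u => (u.2, u.1)) (h' := fun u => (u.2, u.1))
    (k := fun u => ((u.1, u.2.1), u.2.2)) (k' := fun u => (u.1.1, (u.1.2, u.2)))) => //;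
   [case=> ? ?|case=> ? ?|case=> ? [? ?]|case=> [[? ?] ?]].
have -> : entropy (fun (u : F2 * E2) (v : E1 * (F1 * Z)) => f v.1 v.2.1 u.2 u.1 v.2.2)
  = entropy (fun (u : E2 * F2) (v : (E1 * F1) * Z) => f v.1.1 v.1.2 u.1 u.2 v.2).
  by apply: (entropy_bij (h := fun u => (u.2, u.1)) (h' := fun u => (u.2, u.1))
    (k := fun u => ((u.1, u.2.1), u.2.2)) (k' := fun u => (u.1.1, (u.1.2, u.2)))) => //;
   [case=> ? ?|case=> ? ?|case=> ? [? ?]|case=> [[? ?] ?]].
have -> : entropy (fun (u : E1) (v : F1 * (E2 * (F2 * Z))) => f u v.1 v.2.1 v.2.2.1 v.2.2.2)
  = entropy (fun (u : E1) (v : F1 * ((E2 * F2) * Z)) => f u v.1 v.2.1.1 v.2.1.2 v.2.2).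
  by apply: (entropy_bij (h := id) (h' := id) 
    (k := fun u => (u.1, ((u.2.1, u.2.2.1), u.2.2.2)))
    (k' := fun u => (u.1, (u.2.1.1, (u.2.1.2, u.2.2))))) => //;
   [case=> ? [? [? ?]]|case=> ? [[? ?] ?]].
have -> : entropy (fun (u : E2) (v : F2 * (E1 * (F1 * Z))) => f v.2.1 v.2.2.1 u v.1 v.2.2.2)
  = entropy (fun (u : E2) (v : F2 * ((E1 * F1) * Z)) => f v.2.1.1 v.2.1.2 u v.1 v.2.2).
  by apply: (entropy_bij (h := id) (h' := id) 
    (k := fun u => (u.1, ((u.2.1, u.2.2.1), u.2.2.2)))
    (k' := fun u => (u.1, (u.2.1.1, (u.2.1.2, u.2.2))))) => //;
   [case=> ? [? [? ?]]|case=> ? [[? ?] ?]].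
lra.
Qed.

(** A nonnegative form is real. Polarisation with the coefficients 1 and ['i] then compares the
    entries (i, j) and (j, i). *)
Lemma psd_hermitian n (X : 'M[C]_n) : psd X -> adj X = X.
Proof.
move=> hX.
pose e (i : 'I_n) : 'cV[C]_n := delta_mx i 0.
have ee i j : (adj (e i) *m X *m e j) 0 0 = X i j.
  rewrite -mulmxA mxE (bigD1 i) //= big1 ?addr0 => [|k ki].
    rewrite adjE mxE !eqxx conjC1 mul1r mxE (bigD1 j) //= big1 ?addr0.
      by rewrite mxE !eqxx mulr1.
    by move=> k kj; rewrite mxE (negPf kj) mulr0.
  by rewrite adjE mxE (negPf ki) conjC0 mul0r.
have q (a : C) i j : 0 <= X i i + a * X i j + a^* * X j i + a * a^* * X j j.
  have := hX (e i + a *: e j); congr (_ <= _).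
  have -> : adj (e i + a *: e j) = adj (e i) + a^* *: adj (e j).
    by apply/matrixP => k l; rewrite !mxE rmorphD rmorphM.
  have ad (M N : 'M[C]_1) : (M + N) 0 0 = M 0 0 + N 0 0 by rewrite mxE.
  have sc b (M : 'M[C]_1) : (b *: M) 0 0 = b * M 0 0 by rewrite mxE.
  rewrite !mulmxDl !mulmxDr -!scalemxAl -!scalemxAr !ad !sc !ee; ring.
have rd i : (X i i)^* = X i i.
  apply/CrealP; have := q 0 i i; rewrite !mul0r conjC0 mul0r !addr0 => h.
  exact: ger0_real.
apply/matrixP => i j; rewrite adjE.
have h1 := ger0_real (q 1 j i); have h2 := ger0_real (q 'i j i).
move/CrealP: h1; move/CrealP: h2.
rewrite !rmorphD !rmorphM /= !conjCK conjCi conjC1 !rd.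
move: (X j i) (X i j) (X i i) (X j j) => x y p r; rewrite !mul1r => h1 h2.
have e1 : x^* + y^* = x + y.
  have : r + x^* + y^* + p - r - p = r + x + y + p - r - p by rewrite h2.
  by move=> h; apply: etrans (etrans h _); ring.
have e2 : 'i * (y^* - x^*) = 'i * (x - y).
  have : r + - 'i * x^* + 'i * y^* + - 'i * 'i * p - r + 'i * 'i * p
       = r + 'i * x + - 'i * y + 'i * - 'i * p - r + 'i * 'i * p by rewrite h1.
  by move=> h; apply: etrans (etrans h _); ring.
have {}e2 : y^* - x^* = x - y by apply: (mulfI (@neq0Ci C)).
have : x^* *+ 2 = y *+ 2.
  have -> : x^* *+ 2 = (x^* + y^*) - (y^* - x^*) by ring.
  by rewrite e1 e2; ring.
by move/eqP; rewrite -subr_eq0 -mulrnBl mulrn_eq0 /= subr_eq0 => /eqP.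
Qed.

Lemma psd_spectral n (X : 'M[C]_n) : psd X -> exists U (l : 'I_n -> R),
  [/\ unitary U, forall i, 0 <= l i & X = U *m diag_mx (\row_i realc (l i)) *m adj U].
Proof.
move=> hX; have [U [l [hU E]]] := hermitian_spectral (psd_hermitian hX).
exists U, l; split=> // i.
have := hX (col i U); rewrite -realc_ge0; congr (_ <= _).
have h : adj U *m X *m U = diag_mx (\row_i realc (l i)).
  by rewrite E !mulmxA (proj1 hU) mul1mx -mulmxA (proj1 hU) mulmx1.
transitivity ((adj U *m X *m U) i i); last by rewrite h !mxE eqxx.
rewrite !mxE; apply: eq_bigr => j _; rewrite !mxE; congr (_ * _).
by apply: eq_bigr => k _; rewrite !mxE.
Qed.

Lemma diag_factor n (U : 'M[C]_n) (l : 'I_n -> R) : (forall i, 0 <= l i) ->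
  let L := U *m diag_mx (\row_i realc (Num.sqrt (l i))) in
  U *m diag_mx (\row_i realc (l i)) *m adj U = L *m adj L.
Proof.
move=> l0 L; rewrite /L adjM adj_diag !mulmxA; congr (_ *m _); rewrite -!mulmxA.
congr (_ *m _); apply/matrixP => i j; rewrite mul_diag_mxE !mxE.
have [->|] := eqVneq i j; last by rewrite !mulr0n mulr0.
by rewrite !mulr1n -realcM -expr2 sqr_sqrtr.
Qed.

Lemma psd_factor n (X : 'M[C]_n) : psd X -> exists L : 'M[C]_n, X = L *m adj L.
Proof.
move=> /psd_spectral[U [l [_ l0 ->]]].
by exists (U *m diag_mx (\row_i realc (Num.sqrt (l i)))); exact: diag_factor.
Qed.

Lemma entropy_mass (S T T' : finType) (f : S -> T -> C) (g : S -> T' -> C) :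
  (forall s s', \sum_t f s t * (f s' t)^* = \sum_t g s t * (g s' t)^*) ->
  mass f = mass g.
Proof.
move=> h; apply: eq_bigr => s _; apply: realc_inj; rewrite !realc_sum.
under eq_bigr do rewrite nsqE; under [RHS]eq_bigr do rewrite nsqE.
exact: h.
Qed.

(** A crude bound on the binary entropy: two Gibbs inequalities against [m + t]. *)
Lemma eta_merge (m t : R) : 0 <= m -> 0 <= t -> eta t + eta m - eta (m + t) <= m + t.
Proof.
move=> m0 t0.
have [->|tn] := eqVneq t 0; first by rewrite /eta mul0r !addr0 oppr0; lra.
have [->|mn] := eqVneq m 0; first by rewrite /eta mul0r !add0r oppr0; lra.
have {}t0 : 0 < t by rewrite lt_neqAle eq_sym tn.
have {}m0 : 0 < m by rewrite lt_neqAle eq_sym mn.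
have mt : 0 < m + t by rewrite addr_gt0.
have := eta_gibbs (ltW t0) (ltW mt) (fun=> mt).
have := eta_gibbs (ltW m0) (ltW mt) (fun=> mt).
rewrite /eta mulrDl; lra.
Qed.

Lemma entropy_scale (S T : finType) (c : R) (f : S -> T -> C) : 0 <= c ->
  entropy (fun s t => realc (Num.sqrt c) * f s t) = c * entropy f + eta c * mass f.
Proof.
move=> c0; have [U [l [hU l0 E HfE]]] := entropy_spectral f.
have mE : mass f = \sum_i l i.
  by apply: realc_inj; rewrite mass_trace E tr_spectral.
have -> : entropy (fun s t => realc (Num.sqrt c) * f s t) =
   vN_entropy (U *m diag_mx (\row_i realc (c * l i)) *m adj U).
  rewrite entropyE; congr vN_entropy.
  have -> : U *m diag_mx (\row_i realc (c * l i)) *m adj U =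
    realc c *: (U *m diag_mx (\row_i realc (l i)) *m adj U).
    rewrite scalemxAl scalemxAr; congr (_ *m _ *m _).
    by apply/matrixP => i j; rewrite !mxE realcM mulrnAr.
  rewrite -E; apply: mxof_inj => s s'; rewrite entE /ent mxE.
  rewrite -/(ent (mxof f *m adj (mxof f)) s s') ent_mul mulr_sumr.
  apply: eq_bigr => t _; rewrite ent_adj !entE rmorphM /= realc_conj mulrACA.
  by rewrite -realcM -expr2 sqr_sqrtr.
rewrite vN_entropyE // HfE mE -!sumrN !mulr_sumr -big_split /=.
apply: eq_bigr => i _; rewrite /eta.
have [->|c'] := eqVneq c 0; first by rewrite !mul0r; lra.
have [->|l'] := eqVneq (l i) 0; first by rewrite !mulr0 !mul0r; lra.
rewrite lnM ?posrE; [|by rewrite lt_neqAle eq_sym c'|by rewrite lt_neqAle eq_sym l' l0].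
by ring.
Qed.

Lemma adjB m n (A B : 'M[C]_(m, n)) : adj (A - B) = adj A - adj B.
Proof. by apply/matrixP => i j; rewrite !mxE rmorphB. Qed.

(** Let [P] and [N] be the positive and negative parts of the difference, both of trace [t]; then f'
    plus [P] and f plus [N] are the same operator. Concavity bounds its entropy below through f' and
    [P], subadditivity bounds it above through f and [N]. The projector [Zp] onto the positive part
    is returned so that the trace norm can be tested against it. *)
Lemma fannes (S T T' : finType) (f : S -> T -> C) (f' : S -> T' -> C) :
  mass f = mass f' ->
  exists (Zp : 'M[C]_#|S|) (t : R),
  [/\ adj Zp = Zp /\ Zp *m Zp = Zp, 0 <= t,
      realc t = \tr (Zp *m (mxof f *m adj (mxof f) - mxof f' *m adj (mxof f'))) &
      entropy f' - entropy f <= t * ln #|S|%:R + (mass f + t)].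
Proof.
move=> hm; set D := mxof f *m adj (mxof f) - mxof f' *m adj (mxof f').
have hD : adj D = D.
  by rewrite /D adjB !herm_mul.
have [U [d [hU DE]]] := hermitian_spectral hD.
pose dp i := Num.max (d i) 0; pose dn i := Num.max (- d i) 0.
have dp0 i : 0 <= dp i by rewrite le_max lexx orbT.
have dn0 i : 0 <= dn i by rewrite le_max lexx orbT.
have dE i : d i = dp i - dn i.
  by rewrite /dp /dn; case: (leP (d i) 0); case: (leP (- d i) 0); lra.
pose ind i : R := (0 < d i)%R%:R.
have indd i : ind i * d i = dp i.
  by rewrite /ind /dp; case: (ltrP 0 (d i)); rewrite ?mul1r ?mul0r.
have trd : \sum_i d i = 0.
  apply: realc_inj; rewrite realc0 -(tr_spectral d hU) -DE /D raddfB /=.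
  by rewrite -!mass_trace hm subrr.
pose t := \sum_i dp i.
have tn : \sum_i dn i = t.
  have : t - \sum_i dn i = 0.
    by rewrite /t -sumrB -[RHS]trd; apply: eq_bigr => i _; rewrite dE.
  by move/eqP; rewrite subr_eq0 => /eqP.
exists (U *m diag_mx (\row_i realc (ind i)) *m adj U), t.
split.
- split; first by rewrite !adjM adjK adj_diag mulmxA.
  rewrite -!mulmxA (unitaryK _ hU); congr (_ *m _); rewrite mulmxA; congr (_ *m _).
  apply/matrixP => i j; rewrite mul_diag_mxE !mxE.
  have [->|] := eqVneq i j; last by rewrite !mulr0n mulr0.
  by rewrite !mulr1n -realcM /ind -natrM mulnb andbb.
- exact: sumr_ge0.
- rewrite DE -!mulmxA (unitaryK _ hU) mulmxA mulmxA -(mulmxA U) tr_cyc //.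
  rewrite /t realc_sum; apply: eq_bigr => i _.
  by rewrite mul_diag_mxE !mxE eqxx mulr1n -realcM indd.
have ker (l : 'I_#|S| -> R) : (forall i, 0 <= l i) -> exists h : S -> S -> C,
   mxof h *m adj (mxof h) = U *m diag_mx (\row_i realc (l i)) *m adj U /\
   mass h = \sum_i l i.
  move=> l0; pose L := U *m diag_mx (\row_i realc (Num.sqrt (l i))).
  have LE : mxof (ent L) *m adj (mxof (ent L)) =
      U *m diag_mx (\row_i realc (l i)) *m adj U by rewrite mxofK -diag_factor.
  exists (ent L); split=> //.
  by apply: realc_inj; rewrite mass_trace LE tr_spectral.
have [P [PE Pm]] := ker dp dp0; have [N [NE Nm]] := ker dn dn0.
have sq (T0 : finType) (h : S -> T0 -> C) : exists h' : S -> S -> C,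
   mxof h' *m adj (mxof h') = mxof h *m adj (mxof h).
  have [V [l [_ l0 -> _]]] := entropy_spectral h.
  by exists (ent (V *m diag_mx (\row_i realc (Num.sqrt (l i))))); rewrite mxofK diag_factor.
have gram (T0 T1 : finType) (h : S -> T0 -> C) (h' : S -> T1 -> C) :
   mxof h *m adj (mxof h) = mxof h' *m adj (mxof h') ->
   forall s s', \sum_t h s t * (h s' t)^* = \sum_t h' s t * (h' s' t)^*.
  move=> /(congr1 (fun M => ent M _ _)) h1 s s'; have := h1 s s'.
  rewrite !ent_mul; under eq_bigr do rewrite ent_adj !entE.
  by under [X in _ = X -> _]eq_bigr do rewrite ent_adj !entE.
have [g gE] := sq _ f; have [g' g'E] := sq _ f'.
have Hg : entropy g = entropy f by apply: eq_entropy_row; exact: gram.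
have Hg' : entropy g' = entropy f' by apply: eq_entropy_row; exact: gram.
have mg : mass g = mass f by apply: entropy_mass; exact: gram.
have mg' : mass g' = mass f by rewrite hm; apply: entropy_mass; exact: gram.
pose G1 (b : bool) := if b then g' else P.
pose G2 (b : bool) := if b then g else N.
have := entropy_concave G1; have := entropy_subadd G2.
have -> : entropy (fun t (v : bool * S) => G2 v.1 t v.2) = entropy (fun t (v : bool * S) => G1 v.1 t v.2).
  have sumb (G : bool -> S -> S -> C) s s' :
      \sum_(v : bool * S) G v.1 s v.2 * (G v.1 s' v.2)^* =
      ent (mxof (G true) *m adj (mxof (G true)) + mxof (G false) *m adj (mxof (G false))) s s'.
    rewrite sum_pair big_bool /ent mxE -/(ent _ s s') -/(ent (_ *m _) s s').
    rewrite !ent_mul; congr (_ + _); apply: eq_bigr => t0 _; by rewrite ent_adj !entE.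
  apply: eq_entropy_row => s s'; rewrite !sumb /G1 /G2; congr (ent _ s s').
  rewrite gE g'E PE NE.
  have -> : mxof f' *m adj (mxof f') = mxof f *m adj (mxof f) - D.
    by rewrite /D opprB addrC subrK.
  have -> : D = U *m diag_mx (\row_i realc (dp i)) *m adj U
              - U *m diag_mx (\row_i realc (dn i)) *m adj U.
    rewrite DE -mulmxBl -mulmxBr; congr (_ *m _ *m _).
    by apply/matrixP => i j; rewrite !mxE dE realcD realcN mulrnDl mulNrn.
  by rewrite opprB -addrA subrK.
rewrite !big_bool /= mg' Pm -/t Hg Hg' => h1 h2.
have := entropy_ge_eta P; rewrite Pm -/t => h3.
have := entropy_le_card N; rewrite Nm tn => h4.
have t0 : 0 <= t by exact: sumr_ge0.
have h5 := eta_merge (mass_ge0 f) t0.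
move: (entropy f) (entropy f') (entropy N) (entropy P) (entropy _) (ln _) (mass f) (eta _) (eta _) (eta _) h1 h2 h3 h4 h5.
clear; intros; lra.
Qed.

End Continuity.

(** * Fano, Holevo and Fannes bounds for key codes *)

Section Codes.
Variable R : realType.
Local Notation C := (R[i]).

Lemma tr_mul (S T : finType) (M : 'M[C]_(#|S|, #|T|)) (N : 'M[C]_(#|T|, #|S|)) :
  \tr (M *m N) = \sum_s \sum_t ent M s t * ent N t s.
Proof. by rewrite ent_tr; apply: eq_bigr => s _; rewrite ent_mul. Qed.

(** The squared row lengths of [W Z] and [W (1 - Z)] add up to those of [W], which are 1. *)
Lemma projector_row_le1 n (W Z : 'M[C]_n) i :
  unitary W -> adj Z = Z -> Z *m Z = Z -> \sum_k nsq ((W *m Z) i k) <= 1.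
Proof.
move=> hW hZ ZZ.
have rowE (A : 'M[C]_n) : realc (\sum_k nsq (A i k)) = (A *m adj A) i i.
  by rewrite mxE realc_sum; apply: eq_bigr => k _; rewrite nsqE adjE.
have h : W *m Z *m adj (W *m Z) + (W *m (1%:M - Z)) *m adj (W *m (1%:M - Z)) = 1%:M.
  have pr (P : 'M[C]_n) : adj P = P -> P *m P = P ->
      W *m P *m adj (W *m P) = W *m P *m adj W.
    by move=> aP PP; rewrite adjM aP mulmxA -(mulmxA W) PP.
  have a1 : adj (1%:M : 'M[C]_n) = 1%:M.
    by apply/matrixP => k l; rewrite adjE !mxE conjC_nat eq_sym.
  have p1 : (1%:M - Z) *m (1%:M - Z) = 1%:M - Z.
    by rewrite mulmxBl mulmxBr mulmxBr !mul1mx !mulmx1 ZZ subrr subr0.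
  rewrite (pr Z) // (pr (1%:M - Z)) ?adjB ?a1 ?hZ //.
  by rewrite -mulmxDl -mulmxDr addrC subrK mulmx1 (proj2 hW).
have : \sum_k nsq ((W *m Z) i k) + \sum_k nsq ((W *m (1%:M - Z)) i k) = 1.
  by apply: realc_inj; rewrite realcD !rowE; move/matrixP/(_ i i): h; rewrite mxE [RHS]mxE eqxx.
by move=> <-; rewrite lerDl; apply: sumr_ge0 => k _; exact: nsq_ge0.
Qed.

Lemma Re_mul_le (x y : C) : complex.Re (x * y) <= (nsq x + nsq y) / 2.
Proof.
case: x => a b; case: y => c d; rewrite /nsq !conj_complex /=.
rewrite -subr_ge0.
have -> : (a * a - b * - b + (c * c - d * - d)) / 2 - (a * c - b * d) =
   ((a - c) ^+ 2 + (b + d) ^+ 2) / 2 by field.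
by apply: divr_ge0 => //; apply: addr_ge0; exact: sqr_ge0.
Qed.

Lemma nsq_conj (x : C) : nsq x^* = nsq x.
Proof. by apply: realc_inj; rewrite !nsqE conjCK mulrC. Qed.

(** For any singular value decomposition, tr (X Z) is the sum of the singular values times diagonal
    entries of W Z U = (W Z)(Z U). Rows of the first factor and columns of the second have length at
    most 1, so these entries have real part at most 1. *)
Lemma trnorm_ge n (X Z : 'M[C]_n) : adj X = X -> adj Z = Z -> Z *m Z = Z ->
  complex.Re (\tr (X *m Z)) <= trnorm X.
Proof.
move=> hX hZ ZZ; rewrite /trnorm; set D := (D in xget _ D).
(* [xget] needs some decomposition to exist: moving the signs of the eigenvalues into one unitary
   turns a spectral decomposition into a singular value decomposition. *)
have [t0 Dt0] : exists t, D t.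
  have [U [d [hU E]]] := hermitian_spectral hX.
  pose sg i : R := if d i < 0 then -1 else 1.
  have sg2 i : sg i * sg i = 1 by rewrite /sg; case: ifP; rewrite ?mulrNN mulr1.
  have dsg i : d i = `|d i| * sg i.
    by rewrite /sg; case: ltrP => h; [rewrite ltr0_norm //|rewrite ger0_norm //]; ring.
  pose S := diag_mx (\row_i realc (sg i)).
  have SS : S *m S = 1%:M.
    apply/matrixP => i j; rewrite mul_diag_mxE !mxE.
    have [->|] := eqVneq i j; last by rewrite !mulr0n mulr0.
    by rewrite !mulr1n -realcM sg2.
  have hS : unitary S by rewrite /unitary /S adj_diag -/S SS.
  pose s (i j : 'I_n) : R := if i == j then `|d i| else 0.
  exists (\sum_i \sum_(j : 'I_n | nat_of_ord i == nat_of_ord j) s i j).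
  exists U, (S *m adj U), s; split=> //.
  - by split=> //; apply: unitaryM => //; exact: unitary_adj.
  - by move=> i j ij; rewrite /s; case: (eqVneq i j) ij => [->|//]; rewrite eqxx.
  - by move=> i j; rewrite /s; case: eqP.
  rewrite E -!mulmxA; congr (_ *m _); rewrite mulmxA; congr (_ *m _).
  apply/matrixP => i j; rewrite mul_mx_diagE !mxE /s.
  have [->|] := eqVneq i j; last by rewrite mulr0n mul0r.
  by rewrite mulr1n -realcM -dsg.
case: xgetP => [t _ [U [W [s [[hU hW] s0 s1 -> ->]]]]|/(_ t0) //].
have -> : \tr (U *m \matrix_(i, j) realc (s i j) *m W *m Z) =
   \tr (\matrix_(i, j) realc (s i j) *m (W *m Z *m U)).
  by rewrite -!mulmxA mxtrace_mulC !mulmxA.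
rewrite Re_sum; apply: ler_sum => i _.
rewrite mxE Re_sum (bigD1 i) //= big1 ?addr0; last first.
  move=> j ji; rewrite mxE s0 ?realc0 ?mul0r //.
  by apply: contraNneq ji => e; apply/eqP/esym/val_inj.
rewrite (big_pred1 i) => [|j]; last first.
  by rewrite /= eq_sym; apply/eqP/eqP => [/val_inj|->].
rewrite mxE ReZ -[leRHS]mulr1; apply: ler_wpM2l => //.
have -> : W *m Z *m U = (W *m Z) *m (Z *m U) by rewrite mulmxA -[W *m Z *m Z]mulmxA ZZ.
rewrite mxE Re_sum; apply: le_trans (_ : (1 + 1) / 2 <= _); last by rewrite -mulr2n divff.
apply: le_trans (_ : \sum_k (nsq ((W *m Z) i k) + nsq ((Z *m U) k i)) / 2 <= _).
  by apply: ler_sum => k _; exact: Re_mul_le.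
rewrite -mulr_suml big_split /= ler_pM2r ?invr_gt0 // lerD ?projector_row_le1 //.
have := projector_row_le1 i (unitary_adj hU) hZ ZZ; congr (_ <= _).
apply: eq_bigr => k _.
have -> : adj U *m Z = adj (Z *m U) by rewrite adjM hZ.
by rewrite adjE nsq_conj.
Qed.

Lemma isom_gram (O S T : finType) (W : O -> S -> C) (f : S -> T -> C) :
  (forall s s', \sum_o (W o s)^* * W o s' = (s == s')%:R) ->
  forall t t', \sum_o (\sum_s W o s * f s t) * (\sum_s W o s * f s t')^*
     = \sum_s f s t * (f s t')^*.
Proof.
move=> hW t t'.
transitivity (\sum_s \sum_s' (\sum_o (W o s')^* * W o s) * (f s t * (f s' t')^*)).
  under eq_bigr do rewrite conj_sum mulr_suml.
  rewrite exchange_big; apply: eq_bigr => s _ /=.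
  under eq_bigr do rewrite mulr_sumr.
  rewrite exchange_big; apply: eq_bigr => s' _ /=; rewrite mulr_suml.
  by apply: eq_bigr => o _; rewrite rmorphM /=; ring.
apply: eq_bigr => s _; under eq_bigr do rewrite hW.
by rewrite (sum_delta' s (fun s' => f s t * (f s' t')^*)).
Qed.

Lemma entropy_isom (O S T : finType) (W : O -> S -> C) (f : S -> T -> C) :
  (forall s s', \sum_o (W o s)^* * W o s' = (s == s')%:R) ->
  entropy (fun o t => \sum_s W o s * f s t) = entropy f.
Proof. by move=> hW; apply: eq_entropy_col => t t'; exact: isom_gram. Qed.

Lemma mass_isom (O S T : finType) (W : O -> S -> C) (f : S -> T -> C) :
  (forall s s', \sum_o (W o s)^* * W o s' = (s == s')%:R) ->
  mass (fun o t => \sum_s W o s * f s t) = mass f.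
Proof.
move=> hW; rewrite /mass exchange_big [RHS]exchange_big; apply: eq_bigr => t _ /=.
apply: realc_inj; rewrite !realc_sum; under eq_bigr do rewrite nsqE.
by under [RHS]eq_bigr do rewrite nsqE; exact: isom_gram.
Qed.

Lemma entropy_diag (I T : finType) (k : I -> T -> C) :
  entropy (fun i (v : I * T) => (i == v.1)%:R * k i v.2) = \sum_i eta (\sum_t nsq (k i t)).
Proof.
transitivity (\sum_i entropy (fun (_ : unit) => k i)).
  rewrite -entropy_block; pose h (u : I * unit) := u.1.
  rewrite -(entropy_bij_row (h := h)) //; by exists (fun i => (i, tt)) => // -[? []].
by apply: eq_bigr => i _; rewrite entropy_unit /mass sum_unit.
Qed.

(** The right side is -H(X|Y); Gibbs' inequality compares [p x y] with [q y * Q x y]. *)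
Lemma fano K (p : 'I_K -> 'I_K -> R) (eps : R) : (0 < K)%N ->
  (forall x y, 0 <= p x y) -> \sum_x \sum_y p x y = 1 ->
  \sum_x \sum_(y | y != x) p x y <= eps ->
  - (eps * ln K%:R) - ln 2 <=
    \sum_y eta (\sum_x p x y) - \sum_x \sum_y eta (p x y).
Proof.
move=> K0 p0 p1 pe; pose q y := \sum_x p x y.
have q0 y : 0 <= q y by exact: sumr_ge0.
have k0 : (0 : R) < K%:R by rewrite ltr0n.
have k1 : (1 : R) <= K%:R by rewrite ler1n.
have lnk : (0 : R) <= ln K%:R by exact: ln_ge0.
(* Reference law of [x] given [y]: half of it guesses [x = y], half is uniform. Its logarithm is at
   least -ln 2 on the diagonal and equals -ln 2 - ln K off it, whence the two terms of the bound. *)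
pose Q (x y : 'I_K) : R := (x == y)%:R / 2 + (K%:R * 2)^-1.
have Q0 x y : 0 < Q x y.
  by rewrite ltr_wpDl ?divr_ge0 ?ler0n // invr_gt0 mulr_gt0.
have Q1 y : \sum_x Q x y = 1.
  rewrite big_split /= -mulr_suml sumr_const card_ord (bigD1 y) //= eqxx big1.
    by rewrite mulr1n -[_^-1 *+ K]mulr_natr; field; rewrite gt_eqF.
  by move=> x /negPf->.
have lnQ x y : - ln 2 - (x != y)%R%:R * ln K%:R <= ln (Q x y).
  rewrite /Q; have [_|_] := eqVneq x y; rewrite ?mul0r ?mul1r.
    rewrite subr0 -lnV ?posrE // ler_ln ?posrE ?invr_gt0 //.
      by rewrite lerDl invr_ge0 mulr_ge0 // ltW.
  by rewrite add0r lnV ?posrE ?mulr_gt0 // lnM ?posrE // opprD addrC.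
have e1 x y : eta (p x y) <= q y * Q x y - p x y - p x y * (ln (q y) + ln (Q x y)).
  have [->|pn] := eqVneq (p x y) 0.
    by rewrite /eta !mul0r oppr0 !addr0 mulr_ge0 // ltW.
  have pp : 0 < p x y by rewrite lt_neqAle eq_sym pn p0.
  have qp : 0 < q y.
    by rewrite (lt_le_trans pp) // /q (bigD1 x) //= lerDl sumr_ge0.
  by rewrite -lnM ?posrE //; apply: eta_gibbs => //; rewrite ?mulr_ge0 ?mulr_gt0 // ltW.
have s1 : \sum_x \sum_y eta (p x y) <=
   \sum_x \sum_y (q y * Q x y - p x y - p x y * (ln (q y) + ln (Q x y))).
  by do 2 (apply: ler_sum => ? _).
have s2 : \sum_x \sum_y (q y * Q x y - p x y - p x y * (ln (q y) + ln (Q x y)))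
  = \sum_y eta (q y) - \sum_x \sum_y p x y * ln (Q x y).
  have -> : \sum_y eta (q y) = - \sum_x \sum_y p x y * ln (q y).
    rewrite exchange_big -sumrN; apply: eq_bigr => y _ /=.
    by rewrite -mulr_suml.
  have qQ : \sum_x \sum_y q y * Q x y = 1.
    rewrite exchange_big -p1 [RHS]exchange_big; apply: eq_bigr => y _ /=.
    by rewrite -mulr_sumr Q1 mulr1.
  transitivity (\sum_x \sum_y q y * Q x y - \sum_x \sum_y p x y -
    (\sum_x \sum_y p x y * ln (q y) + \sum_x \sum_y p x y * ln (Q x y))).
    rewrite -big_split -!sumrB; apply: eq_bigr => x _ /=.
    rewrite -big_split -!sumrB; apply: eq_bigr => y _ /=.
    ring.
  by rewrite qQ p1 subrr sub0r opprD.
have s3 : - (eps * ln K%:R) - ln 2 <= \sum_x \sum_y p x y * ln (Q x y).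
  apply: le_trans (_ : \sum_x \sum_y p x y * (- ln 2 - (x != y)%R%:R * ln K%:R) <= _); last first.
    by apply: ler_sum => x _; apply: ler_sum => y _; exact: ler_wpM2l.
  have -> : \sum_x \sum_y p x y * (- ln 2 - (x != y)%R%:R * ln K%:R) =
     (\sum_x \sum_y p x y) * - ln 2 - (\sum_x \sum_(y | y != x) p x y) * ln K%:R.
    rewrite !mulr_suml -sumrB; apply: eq_bigr => x _.
    rewrite !mulr_suml [X in _ = _ - X]big_mkcond -sumrB; apply: eq_bigr => y _ /=.
    by rewrite eq_sym; case: eqP => _ /=; ring.
  by rewrite p1 mul1r addrC lerD2l lerN2 ler_wpM2r.
move: s1 s2 s3; rewrite -/q; lra.
Qed.

End Codes.

(** * Private information of a good key code *)

Section CodeBound.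
Variable R : realType.
Local Notation C := (R[i]).

(** The joint probability of message [x] and outcome [y] when [L y] is a square root of the
    measurement operator of [y]; the weight of the message is part of [g x]. *)
Definition outcome_prob K (B Z : finType) (g : 'I_K -> B -> Z -> C)
  (L : 'I_K -> B -> B -> C) (x y : 'I_K) : R :=
  \sum_c \sum_z nsq (\sum_b (L y b c)^* * g x b z).

(** The right side is -H(X|B). Concavity of the conditional entropy given the outcome replaces [B]
    by the measured outcome, to which [fano] applies. *)
Lemma holevo_fano K (B Z : finType) (g : 'I_K -> B -> Z -> C)
  (L : 'I_K -> B -> B -> C) (eps : R) : (0 < K)%N ->
  (forall b b', \sum_y \sum_c L y b c * (L y b' c)^* = (b == b')%:R) ->
  \sum_x mass (g x) = 1 ->
  \sum_x \sum_(y | y != x) outcome_prob g L x y <= eps ->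
  - (eps * ln K%:R) - ln 2 <=
    entropy (fun b (v : 'I_K * Z) => g v.1 b v.2) - \sum_x entropy (g x).
Proof.
move=> K0 hL g1 he.
(* A Naimark isometry that records the outcome twice: the copy that is traced out makes the other
   one classical. *)
pose W (o : 'I_K * ('I_K * B)) b := (o.1 == o.2.1)%:R * (L o.2.1 b o.2.2)^*.
have hW b b' : \sum_o (W o b)^* * W o b' = (b == b')%:R.
  rewrite -hL sum_pair exchange_big /= sum_pair; apply: eq_bigr => y _.
  apply: eq_bigr => c _; rewrite /W /=.
  rewrite -[RHS](sum_delta' y (fun=> L y b c * (L y b' c)^*)); apply: eq_bigr => y' _.
  by rewrite mulrC mul_delta andbb conjCK [_ * L y b c]mulrC.
pose h x y (t : 'I_K * B) z := \sum_b W (y, t) b * g x b z.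
have hE x y t z : h x y t z = (y == t.1)%:R * \sum_b (L t.1 b t.2)^* * g x b z.
  by rewrite mulr_sumr; apply: eq_bigr => b _; rewrite mulrA.
have := cond_concave h.
have -> : entropy (fun (u : 'I_K * ('I_K * B)) (v : 'I_K * Z) => h v.1 u.1 u.2 v.2) =
    entropy (fun b (v : 'I_K * Z) => g v.1 b v.2).
  rewrite -(entropy_isom (fun b (v : 'I_K * Z) => g v.1 b v.2) hW).
  by apply: eq_entropy => -[y t] v.
have hx x : entropy (fun (u : 'I_K * ('I_K * B)) z => h x u.1 u.2 z) = entropy (g x).
  by rewrite -(entropy_isom (g x) hW); apply: eq_entropy => -[y t] v.
have hy x : entropy (fun y (v : ('I_K * B) * Z) => h x y v.1 v.2) =
    \sum_y eta (outcome_prob g L x y).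
  transitivity (entropy (fun y (v : 'I_K * (B * Z)) =>
      (y == v.1)%:R * \sum_b (L v.1 b v.2.1)^* * g x b v.2.2)).
    apply: (entropy_bij (h := id) (h' := id)
      (k := fun v : ('I_K * B) * Z => (v.1.1, (v.1.2, v.2)))
      (k' := fun v => ((v.1, v.2.1), v.2.2))) => //.
    - by case=> [[? ?] ?].
    - by case=> ? [? ?].
  transitivity (\sum_y eta (\sum_(v : B * Z) nsq (\sum_b (L y b v.1)^* * g x b v.2))).
    rewrite -entropy_diag; apply: eq_entropy => y [y' v] /=.
    by have [->|] := eqVneq y y'; rewrite ?mul0r.
  by apply: eq_bigr => y _; rewrite sum_pair.
have hav : entropy (fun y (v : ('I_K * B) * ('I_K * Z)) => h v.2.1 y v.1 v.2.2) =
    \sum_y eta (\sum_x outcome_prob g L x y).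
  transitivity (entropy (fun y (v : 'I_K * (B * ('I_K * Z))) =>
      (y == v.1)%:R * \sum_b (L v.1 b v.2.1)^* * g v.2.2.1 b v.2.2.2)).
    apply: (entropy_bij (h := id) (h' := id)
      (k := fun v : ('I_K * B) * ('I_K * Z) => (v.1.1, (v.1.2, v.2)))
      (k' := fun v => ((v.1, v.2.1), v.2.2))) => //.
    - by case=> [[? ?] ?].
    - by case=> ? [? ?].
  transitivity (\sum_y eta (\sum_(v : B * ('I_K * Z))
      nsq (\sum_b (L y b v.1)^* * g v.2.1 b v.2.2))).
    rewrite -entropy_diag; apply: eq_entropy => y [y' v] /=.
    by have [->|] := eqVneq y y'; rewrite ?mul0r.
  apply: eq_bigr => y _; rewrite sum_pair; under eq_bigr do rewrite sum_pair.
  by rewrite exchange_big.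
rewrite hav sumrB; under eq_bigr do rewrite hx.
under [X in _ - X <= _]eq_bigr do rewrite hy.
have p0 x y : 0 <= outcome_prob g L x y.
  by do 2 (apply: sumr_ge0 => ? _); exact: nsq_ge0.
have p1 : \sum_x \sum_y outcome_prob g L x y = 1.
  rewrite -g1; apply: eq_bigr => x _; rewrite -(mass_isom (g x) hW) /mass.
  rewrite sum_pair; apply: eq_bigr => y _; rewrite sum_pair.
  rewrite (bigD1 y) //= [X in _ + X]big1 ?addr0; last first.
    move=> y' yy; apply: big1 => c _; apply: big1 => z _.
    rewrite -[X in nsq X]/(h x y (y', c) z) hE /= eq_sym (negPf yy) mul0r.
    by apply/eqP; rewrite nsq_eq0 eqxx.
  apply: eq_bigr => c _; apply: eq_bigr => z _.
  by rewrite -[X in _ = nsq X]/(h x y (y, c) z) hE /= eqxx mul1r.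
have := fano K0 p0 p1 he; lra.
Qed.

Lemma mass_scale (S T : finType) (c : R) (f : S -> T -> C) : 0 <= c ->
  mass (fun s t => realc (Num.sqrt c) * f s t) = c * mass f.
Proof.
move=> c0; rewrite /mass mulr_sumr; apply: eq_bigr => s _.
rewrite mulr_sumr; apply: eq_bigr => t _.
by rewrite nsqM nsq_realc sqr_sqrtr.
Qed.

Lemma mass_family (X S Z : finType) (g : X -> S -> Z -> C) :
  mass (fun s (v : X * Z) => g v.1 s v.2) = \sum_x mass (g x).
Proof.
rewrite /mass exchange_big /= sum_pair; apply: eq_bigr => x _.
by rewrite exchange_big.
Qed.

(** The last left side is I(X;E). Each [g x] is compared by [fannes] with the average scaled by 1/K;
    the entropies of the [K] scaled copies add up to that of the average plus [ln K]. *)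
Lemma leak K (E Z : finType) (g : 'I_K -> E -> Z -> C) : (0 < K)%N ->
  (forall x, mass (g x) = K%:R^-1) ->
  let avg := mxof (fun e (v : 'I_K * Z) => g v.1 e v.2) in
  exists (Zp : 'I_K -> 'M[C]_#|E|) (t : 'I_K -> R),
  [/\ forall x, adj (Zp x) = Zp x /\ Zp x *m Zp x = Zp x, 
      forall x, realc (t x) = \tr (Zp x *m (mxof (g x) *m adj (mxof (g x))
                                 - (K%:R)^-1 *: (avg *m adj avg))) &
      entropy (fun e (v : 'I_K * Z) => g v.1 e v.2) - \sum_x entropy (g x) + ln K%:R
      <= (\sum_x t x) * ln #|E|%:R + (1 + \sum_x t x)].
Proof.
move=> K0 gm avg; have k0 : (0 : R) < K%:R by rewrite ltr0n.
have ki : (0 : R) <= K%:R^-1 by rewrite invr_ge0 ltW.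
pose f' e (v : 'I_K * Z) := realc (Num.sqrt K%:R^-1) * g v.1 e v.2.
have m1 : \sum_x mass (g x) = 1.
  under eq_bigr do rewrite gm.
  by rewrite sumr_const card_ord -[_^-1 *+ K]mulr_natr mulVf // gt_eqF.
have mf x : mass (g x) = mass f'.
  by rewrite gm /f' mass_scale // mass_family m1 mulr1.
have /fin_all_exists[Zt hZ] : forall x, exists Zt : 'M[C]_#|E| * R,
  [/\ adj Zt.1 = Zt.1 /\ Zt.1 *m Zt.1 = Zt.1, 0 <= Zt.2,
      realc Zt.2 = \tr (Zt.1 *m (mxof (g x) *m adj (mxof (g x)) - mxof f' *m adj (mxof f'))) &
      entropy f' - entropy (g x) <= Zt.2 * ln #|E|%:R + (mass (g x) + Zt.2)].
  by move=> x; have [Zp [t ?]] := fannes (mf x); exists (Zp, t).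
exists (fun x => (Zt x).1), (fun x => (Zt x).2); split.
- by move=> x; have [] := hZ x.
- move=> x; have [_ _ -> _] := hZ x; congr (\tr (_ *m (_ - _))).
  apply: mxof_inj => e e'; rewrite ent_mul /ent mxE -/(ent (avg *m adj avg) e e').
  rewrite ent_mul mulr_sumr; apply: eq_bigr => v _.
  rewrite -/(ent (mxof f') e v) -/(ent (adj (mxof f')) v e') !ent_adj !entE /f'.
  rewrite rmorphM /= realc_conj mulrACA -realcM -expr2 sqr_sqrtr //.
  by rewrite realcE fmorphV rmorph_nat.
have Hf' : \sum_(x < K) entropy f' = entropy (fun e (v : 'I_K * Z) => g v.1 e v.2) + ln K%:R.
  rewrite sumr_const card_ord entropy_scale // mass_family m1 mulr1 -[(_ + _) *+ K]mulr_natr /eta.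
  by rewrite lnV ?posrE //; field; rewrite gt_eqF.
have : \sum_x (entropy f' - entropy (g x)) <= \sum_x ((Zt x).2 * ln #|E|%:R + (mass (g x) + (Zt x).2)).
  by apply: ler_sum => x _; have [] := hZ x.
rewrite sumrB Hf' 2!big_split /= m1 -mulr_suml; lra.
Qed.

Lemma entB (S T : finType) (M N : 'M[C]_(#|S|, #|T|)) s t :
  ent (M - N) s t = ent M s t - ent N s t.
Proof. by rewrite /ent !mxE. Qed.
Lemma entZ (S T : finType) a (M : 'M[C]_(#|S|, #|T|)) s t :
  ent (a *: M) s t = a * ent M s t.
Proof. by rewrite /ent mxE. Qed.

Lemma exchange4 (I J I' J' : finType) (F : I -> J -> I' -> J' -> C) :
  \sum_i \sum_j \sum_k \sum_l F i j k l = \sum_k \sum_l \sum_i \sum_j F i j k l.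
Proof.
transitivity (\sum_(p : I * J) \sum_(q : I' * J') F p.1 p.2 q.1 q.2).
  rewrite sum_pair; apply: eq_bigr => i _; apply: eq_bigr => j _.
  by rewrite sum_pair.
rewrite exchange_big sum_pair; apply: eq_bigr => k _; apply: eq_bigr => l _ /=.
by rewrite sum_pair.
Qed.

Definition ideal_state K (B E : finType) (s : 'M[C]_#|{: 'I_K * (B * E)}|) :
  'M[C]_#|{: 'I_K * ('I_K * E)}| :=
  mxof (fun u v => if (u.1 == v.1) && (u.2.1 == v.2.1) && (u.1 == u.2.1)
                   then (K%:R)^-1 * ent (ptrL (ptrL s)) u.2.2 v.2.2 else 0).

(** One trace-norm hypothesis serves both halves. Tested with the projector onto disagreeing message
    and outcome, it bounds the error probability for [holevo_fano]; tested with the block projectors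
    of [leak], it bounds the leaked information. *)
Lemma code_bound K (B E Z : finType) (g : 'I_K -> B -> E -> Z -> C)
  (M : 'I_K -> 'M[C]_#|B|) (eps : R) (s : 'M[C]_#|{: 'I_K * (B * E)}|) :
  (0 < K)%N -> (0 < #|E|)%N ->
  (forall x, \sum_b \sum_e \sum_z nsq (g x b e z) = K%:R^-1) ->
  povm M ->
  (forall u v, ent s u v = if u.1 == v.1 then
     \sum_z g u.1 u.2.1 u.2.2 z * (g u.1 v.2.1 v.2.2 z)^* else 0) ->
  trnorm (mid_map (meas M) s - ideal_state s) < eps ->
  (1 - eps) * ln K%:R - ln 2 - eps * ln #|E|%:R - 1 - eps <=
  (entropy (fun b (v : 'I_K * (E * Z)) => g v.1 b v.2.1 v.2.2)
   - \sum_x entropy (fun b (v : E * Z) => g x b v.1 v.2))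
  - (entropy (fun e (v : 'I_K * (B * Z)) => g v.1 v.2.1 e v.2.2)
   - \sum_x entropy (fun e (v : B * Z) => g x v.1 e v.2)).
Proof.
move=> K0 E0 gm [Mp M1] sE; set D := _ - _ => hD.
have k0 : (0 : R) < K%:R by rewrite ltr0n.
have /fin_all_exists[L0 hL] : forall y, exists L : 'M[C]_#|B|, M y = L *m adj L.
  by move=> y; exact: psd_factor.
pose L y b c := ent (L0 y) b c.
have ME y b b' : ent (M y) b b' = \sum_c L y b c * (L y b' c)^*.
  by rewrite hL ent_mul; apply: eq_bigr => c _; rewrite ent_adj.
have L1 b b' : \sum_y \sum_c L y b c * (L y b' c)^* = (b == b')%:R.
  rewrite -ent1 -M1 /ent summxE; apply: eq_bigr => y _.
  by rewrite -/(ent (M y) b b') ME.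
pose A x y c e z := \sum_b (L y b c)^* * g x b e z.
have midE u v : ent (mid_map (meas M) s) u v =
  ((u.1 == v.1) && (u.2.1 == v.2.1))%:R *
   \sum_c \sum_z A u.1 u.2.1 c u.2.2 z * (A u.1 u.2.1 c v.2.2 z)^*.
  rewrite /mid_map entE /meas entE.
  case: (u.2.1 == v.2.1); last by rewrite andbF mul0r.
  rewrite andbT tr_mul; have [e1|ne] := eqVneq u.1 v.1; last first.
    by rewrite mul0r big1 // => b _; rewrite big1 // => b' _; rewrite entE sE /= (negPf ne) mulr0.
  rewrite mul1r.
  under eq_bigr do under eq_bigr do rewrite entE sE /= e1 eqxx ME.
  rewrite e1.
  transitivity (\sum_b \sum_b' \sum_c \sum_z (L u.2.1 b' c)^* * g v.1 b' u.2.2 z *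
      ((L u.2.1 b c)^* * g v.1 b v.2.2 z)^*).
    apply: eq_bigr => b _; apply: eq_bigr => b' _; rewrite mulr_suml.
    apply: eq_bigr => c _; rewrite mulr_sumr; apply: eq_bigr => z _.
    by rewrite rmorphM /= conjCK; ring.
  rewrite exchange4; apply: eq_bigr => c _; apply: eq_bigr => z _.
  rewrite conj_sum mulr_sumr; apply: eq_bigr => b _.
  by rewrite mulr_suml.
pose rE := ptrL (ptrL s).
have rhoE e e' : ent rE e e' =
   \sum_x \sum_b \sum_z g x b e z * (g x b e' z)^*.
  rewrite /rE entE; under eq_bigr do rewrite entE.
  rewrite exchange_big /=; apply: eq_bigr => x _; apply: eq_bigr => b _.
  by rewrite sE eqxx.
have idE u v : ent (ideal_state s) u v =
  ((u.1 == v.1) && (u.2.1 == v.2.1) && (u.1 == u.2.1))%:R * (K%:R^-1 * ent rE u.2.2 v.2.2).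
  by rewrite entE -/rE; case: ifP; rewrite ?mul1r ?mul0r.
have DE u v : ent D u v = ent (mid_map (meas M) s) u v - ent (ideal_state s) u v.
  by rewrite /D /ent !mxE.
have hDa : adj D = D.
  apply: mxof_inj => u v; rewrite ent_adj !DE rmorphB /=; congr (_ - _).
    rewrite !midE rmorphM /= conjC_nat eq_sym [v.2.1 == _]eq_sym.
    have [e1|] := eqVneq u.1 v.1; last by rewrite !mul0r.
    have [e2|] := eqVneq u.2.1 v.2.1; last by rewrite !mul0r.
    rewrite e1 e2 !mul1r conj_sum; apply: eq_bigr => c _; rewrite conj_sum.
    by apply: eq_bigr => z _; rewrite rmorphM /= conjCK mulrC.
  rewrite !idE rmorphM /= conjC_nat eq_sym [v.2.1 == _]eq_sym.
  have [e1|] := eqVneq u.1 v.1; last by rewrite !mul0r.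
  have [e2|] := eqVneq u.2.1 v.2.1; last by rewrite !mul0r.
  rewrite e1 e2 rmorphM /= fmorphV rmorph_nat !rhoE; congr (_ * (_ * _)).
  rewrite conj_sum; apply: eq_bigr => x _; rewrite conj_sum; apply: eq_bigr => b _.
  rewrite conj_sum; apply: eq_bigr => z _.
  by rewrite rmorphM /= conjCK mulrC.
pose gB x b (v : E * Z) := g x b v.1 v.2.
pose gE x e (v : B * Z) := g x v.1 e v.2.
have gB1 x : mass (gB x) = K%:R^-1.
  by rewrite -(gm x); apply: eq_bigr => b _; rewrite sum_pair.
have gE1 x : mass (gE x) = K%:R^-1.
  rewrite -(gm x) exchange_big; apply: eq_bigr => e _ /=.
  by rewrite sum_pair.
have b1 : \sum_x \sum_(y | y != x) outcome_prob gB L x y <= eps.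
  pose P1 : 'M[C]_#|{: 'I_K * ('I_K * E)}| :=
    mxof (fun u v => (u == v)%:R * (u.1 != u.2.1)%:R).
  have a1 : adj P1 = P1.
    apply: mxof_inj => u v; rewrite ent_adj !entE rmorphM /= !conjC_nat eq_sym.
    by have [->|] := eqVneq u v; rewrite ?mul0r.
  have a2 : P1 *m P1 = P1.
    apply: mxof_inj => u v; rewrite ent_mul !entE.
    under eq_bigr do rewrite !entE -mulrA.
    rewrite (sum_delta u (fun t => (u.1 != u.2.1)%:R * ((t == v)%:R * (t.1 != t.2.1)%:R))).
    by case: (u.1 != u.2.1); rewrite ?mul1r ?mul0r ?mulr0.
  apply/ltW/le_lt_trans/hD/(le_trans _ (trnorm_ge hDa a1 a2)).
  have -> : \tr (D *m P1) = \sum_x \sum_(y | y != x) realc (outcome_prob gB L x y).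
    rewrite tr_mul sum_pair; apply: eq_bigr => x _; rewrite sum_pair.
    rewrite [RHS]big_mkcond; apply: eq_bigr => y _ /=.
    under eq_bigr do (under eq_bigr do rewrite entE [_ == (x, _)]eq_sym mulrCA;
       rewrite sum_delta).
    case: ifPn => [yx|]; last first.
      by rewrite negbK => /eqP->; rewrite big1 // => e _; rewrite eqxx mulr0.
    have xy : (x == y) = false by rewrite eq_sym (negPf yx).
    under eq_bigr do rewrite /= xy mulr1 DE midE idE /= !eqxx xy mul0r subr0 mul1r.
    rewrite /outcome_prob exchange_big realc_sum; apply: eq_bigr => c _ /=.
    rewrite sum_pair realc_sum; apply: eq_bigr => e _; rewrite realc_sum.
    by apply: eq_bigr => z _; rewrite nsqE.
  rewrite Re_sum le_eqVlt; apply/orP; left; apply/eqP; apply: eq_bigr => x _.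
  by rewrite Re_sum.
have [Zp [t [hZ tE tle]]] := leak K0 gE1.
have b2 : \sum_x t x <= eps.
  pose P2 : 'M[C]_#|{: 'I_K * ('I_K * E)}| :=
    mxof (fun u v => ((u.1 == v.1) && (u.2.1 == v.2.1))%:R * ent (Zp u.1) u.2.2 v.2.2).
  have a1 : adj P2 = P2.
    apply: mxof_inj => u v; rewrite ent_adj !entE rmorphM /= conjC_nat eq_sym.
    rewrite [v.2.1 == _]eq_sym.
    have [->|] := eqVneq u.1 v.1; last by rewrite !mul0r.
    by rewrite -ent_adj (proj1 (hZ v.1)).
  have a2 : P2 *m P2 = P2.
    apply: mxof_inj => -[x [y e]] [x' [y' e']]; rewrite ent_mul !entE sum_pair /=.
    have [<-|xx] := eqVneq x x'; last first.
      rewrite mul0r big1 // => w _; rewrite big1 // => v _; rewrite !entE /=.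
      have [<-|] := eqVneq x w; last by rewrite !mul0r.
      by rewrite (negPf xx) mul0r mulr0.
    rewrite -[RHS](sum_delta x (fun=> (y == y')%:R * ent (Zp x) e e')).
    apply: eq_bigr => w _; have [<-|xw] := eqVneq x w; last first.
      by rewrite mul0r big1 // => v _; rewrite entE /= (negPf xw) !mul0r.
    rewrite mul1r sum_pair /= -[RHS](sum_delta y (fun=> (y == y')%:R * ent (Zp x) e e')).
    apply: eq_bigr => w' _; have [<-|yw] := eqVneq y w'; last first.
      by rewrite mul0r big1 // => v _; rewrite entE /= (negPf yw) andbF !mul0r.
    rewrite mul1r -[in RHS](proj2 (hZ x)) ent_mul mulr_sumr; apply: eq_bigr => v _.
    by rewrite !entE /= !eqxx /= mul1r mulrCA.
  apply/ltW/le_lt_trans/hD/(le_trans _ (trnorm_ge hDa a1 a2)).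
  have -> : \tr (D *m P2) = realc (\sum_x t x); last by rewrite ReK.
  rewrite tr_mul sum_pair realc_sum; apply: eq_bigr => x _; rewrite tE mxtrace_mulC tr_mul.
  rewrite sum_pair exchange_big /=; apply: eq_bigr => e _.
  transitivity (\sum_e' (\sum_y ent D (x, (y, e)) (x, (y, e'))) * ent (Zp x) e' e).
    transitivity (\sum_y \sum_e' ent D (x, (y, e)) (x, (y, e')) * ent (Zp x) e' e).
      apply: eq_bigr => y _; rewrite sum_pair.
      rewrite -[RHS](sum_delta x (fun=> \sum_e' ent D (x, (y, e)) (x, (y, e')) * ent (Zp x) e' e)).
      apply: eq_bigr => x' _; have [<-|xx] := eqVneq x x'; last first.
        by rewrite mul0r big1 // => v _; rewrite entE /= eq_sym (negPf xx) mul0r mulr0.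
      rewrite mul1r sum_pair -[RHS](sum_delta y (fun=> \sum_e' ent D (x, (y, e)) (x, (y, e')) * ent (Zp x) e' e)).
      apply: eq_bigr => y' _; have [<-|yy] := eqVneq y y'; last first.
        by rewrite mul0r big1 // => v _; rewrite entE /= [y' == y]eq_sym (negPf yy) andbF mul0r mulr0.
      by rewrite mul1r; apply: eq_bigr => e' _; rewrite entE /= !eqxx mul1r.
    by rewrite exchange_big; apply: eq_bigr => e' _ /=; rewrite mulr_suml.
  apply: eq_bigr => e' _; congr (_ * _).
  have -> : \sum_y ent D (x, (y, e)) (x, (y, e')) =
     \sum_y ent (mid_map (meas M) s) (x, (y, e)) (x, (y, e')) - K%:R^-1 * ent rE e e'.
    rewrite -(sum_delta x (fun=> K%:R^-1 * ent rE e e')) -sumrB.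
    by apply: eq_bigr => y _; rewrite DE [ent (ideal_state s) _ _]idE /= !eqxx.
  rewrite entB entZ; congr (_ - _ * _).
    under eq_bigr do rewrite midE /= !eqxx mul1r.
    (* Summed over its outcomes the measurement acts as an isometry on [B], so the state of the
       environment is unchanged. *)
    pose W (o : 'I_K * B) b := (L o.1 b o.2)^*.
    have hW b b' : \sum_o (W o b)^* * W o b' = (b == b')%:R.
      by rewrite -L1 sum_pair; apply: eq_bigr => y _; apply: eq_bigr => c _; rewrite /W conjCK.
    rewrite ent_mul sum_pair [RHS]exchange_big /=.
    transitivity (\sum_z \sum_y \sum_c A x y c e z * (A x y c e' z)^*).
      rewrite [RHS]exchange_big /=; apply: eq_bigr => y _.
      by rewrite exchange_big.
    apply: eq_bigr => z _.
    have := isom_gram (fun b (e : E) => g x b e z) hW e e'; rewrite sum_pair => ->.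
    by apply: eq_bigr => b _; rewrite ent_adj !entE.
  rewrite rhoE ent_mul sum_pair; apply: eq_bigr => w _; rewrite sum_pair.
  by apply: eq_bigr => b _; apply: eq_bigr => z _; rewrite ent_adj !entE.
have gBs : \sum_x mass (gB x) = 1.
  under eq_bigr do rewrite gB1.
  by rewrite sumr_const card_ord -[_^-1 *+ K]mulr_natr mulVf // gt_eqF.
have h1 := holevo_fano K0 L1 gBs b1.
have le0 : (0 : R) <= ln #|E|%:R by apply: ln_ge0; rewrite ler1n.
have h2 : (\sum_x t x) * ln #|E|%:R <= eps * ln #|E|%:R by exact: ler_wpM2r.
move: h1 h2 tle b2; rewrite /gB /gE.
move: (entropy _) (entropy _) (\sum_x entropy _) (\sum_x entropy _) (ln _) (ln _) (ln _) (\sum_x t x).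
clear; intros; lra.
Qed.

End CodeBound.

(** * Tensor powers and the rate of a code *)

Section Powers.
Variable R : realType.
Local Notation C := (R[i]).

Lemma sum_tupleS (V : nmodType) (T : finType) n (F : n.+1.-tuple T -> V) :
  \sum_t F t = \sum_x \sum_(t : n.-tuple T) F (cons_tuple x t).
Proof.
rewrite -(sum_pair (fun p : T * n.-tuple T => F (cons_tuple p.1 p.2))).
apply: (reindex (fun p : T * n.-tuple T => cons_tuple p.1 p.2)).
exists (fun t => (thead t, behead_tuple t)) => [[x t] _|t _] /=.
  by congr (_, _); apply/val_inj.
by rewrite [RHS]tuple_eta; apply/val_inj.
Qed.

Lemma prod_tupleS (T : finType) n (F : 'I_n.+1 -> T -> C) x (t : n.-tuple T) :
  \prod_i F i (tnth (cons_tuple x t) i) =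
  F ord0 x * \prod_i F (lift ord0 i) (tnth t i).
Proof.
rewrite big_ord_recl; congr (_ * _).
by apply: eq_bigr => i _; rewrite tnthS.
Qed.

Lemma sum_prod_tuple (T : finType) n (F : 'I_n -> T -> C) :
  \sum_(t : n.-tuple T) \prod_i F i (tnth t i) = \prod_i \sum_x F i x.
Proof.
elim: n F => [|n IHn] F.
  rewrite big_ord0 (big_pred1 [tuple]) ?big_ord0 // => t; exact/esym/eqP/tuple0.
rewrite sum_tupleS big_ord_recl mulr_suml; apply: eq_bigr => x _.
rewrite -IHn mulr_sumr; apply: eq_bigr => t _.
by rewrite prod_tupleS.
Qed.

(** Three output systems cover the dilation [Z] as well as, with a one-point first system, the
    isometry [V] of the channel. *)
Definition pow3 (P Q S A : finType) (k : P -> Q -> S -> A -> C) n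
  (p : n.-tuple P) (q : n.-tuple Q) (s : n.-tuple S) (a : n.-tuple A) : C :=
  \prod_(i < n) k (tnth p i) (tnth q i) (tnth s i) (tnth a i).

Arguments pow3 {P Q S A} k {n} p q s a.

Lemma pow3_gram12 (P Q S A P' Q' : finType) (k : P -> Q -> S -> A -> C)
  (k' : P' -> Q' -> S -> A -> C) n :
  (forall s s' a a', \sum_p \sum_q k p q s a * (k p q s' a')^*
     = \sum_p \sum_q k' p q s a * (k' p q s' a')^*) ->
  forall s s' a a', \sum_p \sum_q pow3 k p q s a * (pow3 k p q s' a')^*
     = \sum_p \sum_q pow3 (n := n) k' p q s a * (pow3 k' p q s' a')^*.
Proof.
move=> h s s' a a'.
have E (P0 Q0 : finType) (k0 : P0 -> Q0 -> S -> A -> C) :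
    \sum_p \sum_q pow3 k0 p q s a * (pow3 k0 p q s' a')^* =
    \prod_i \sum_p \sum_q k0 p q (tnth s i) (tnth a i) * (k0 p q (tnth s' i) (tnth a' i))^*.
  rewrite -(sum_prod_tuple (fun i p => \sum_q k0 p q (tnth s i) (tnth a i) *
    (k0 p q (tnth s' i) (tnth a' i))^*)); apply: eq_bigr => p _.
  rewrite -(sum_prod_tuple (fun i q => k0 (tnth p i) q (tnth s i) (tnth a i) *
    (k0 (tnth p i) q (tnth s' i) (tnth a' i))^*)); apply: eq_bigr => q _.
  by rewrite /pow3 rmorph_prod -big_split.
by rewrite !E; apply: eq_bigr => i _; exact: h.
Qed.

Lemma pow3_isom (P Q S A : finType) (k : P -> Q -> S -> A -> C) n :
  (forall a a', \sum_p \sum_q \sum_s (k p q s a)^* * k p q s a' = (a == a')%:R) ->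
  forall a a', \sum_p \sum_q \sum_s (pow3 (n := n) k p q s a)^* * pow3 k p q s a'
   = (a == a')%:R.
Proof.
move=> h a a'.
transitivity (\prod_i \sum_p \sum_q \sum_s (k p q s (tnth a i))^* * k p q s (tnth a' i)).
  rewrite -(sum_prod_tuple (fun i p => \sum_q \sum_s (k p q s (tnth a i))^* *
    k p q s (tnth a' i))); apply: eq_bigr => p _.
  rewrite -(sum_prod_tuple (fun i q => \sum_s (k (tnth p i) q s (tnth a i))^* *
    k (tnth p i) q s (tnth a' i))); apply: eq_bigr => q _.
  rewrite -(sum_prod_tuple (fun i s => (k (tnth p i) (tnth q i) s (tnth a i))^* *
    k (tnth p i) (tnth q i) s (tnth a' i))); apply: eq_bigr => s _.
  by rewrite /pow3 rmorph_prod -big_split.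
under eq_bigr do rewrite h.
have [->|na] := eqVneq a a'; first by rewrite big1 // => i _; rewrite eqxx.
have [i ni] : exists i, tnth a i != tnth a' i.
  apply/existsP; rewrite -negb_forall; apply: contra na => /forallP e.
  by apply/eqP/eq_from_tnth => i; exact/eqP.
by rewrite (bigD1 i) //= (negPf ni) mul0r.
Qed.

Lemma pow3S (P Q S A : finType) (k : P -> Q -> S -> A -> C) n p0 q0 s0 a0 p q s a :
  pow3 k (cons_tuple p0 p) (cons_tuple q0 q) (cons_tuple s0 s) (cons_tuple a0 a)
  = k p0 q0 s0 a0 * pow3 (n := n) k p q s a.
Proof.
rewrite /pow3 big_ord_recl; congr (_ * _).
by apply: eq_bigr => i _; rewrite !tnthS.
Qed.

(** Only the Gram sums over the discarded system enter, so dilations that agree on them can be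
    exchanged in front of every input [h]. *)
Lemma gram_transfer (I I' O O' A Q : finType) (k : I -> O -> A -> C)
  (k' : I' -> O' -> A -> C) (h : A -> Q -> C) i1 i2 i1' i2' q1 q2 :
  (forall a a', \sum_o k i1 o a * (k i2 o a')^* = \sum_o k' i1' o a * (k' i2' o a')^*) ->
  \sum_o (\sum_a k i1 o a * h a q1) * (\sum_a k i2 o a * h a q2)^* =
  \sum_o (\sum_a k' i1' o a * h a q1) * (\sum_a k' i2' o a * h a q2)^*.
Proof.
move=> e.
have E (J P : finType) (k0 : J -> P -> A -> C) j1 j2 :
   \sum_o (\sum_a k0 j1 o a * h a q1) * (\sum_a k0 j2 o a * h a q2)^* =
   \sum_a \sum_a' (\sum_o k0 j1 o a * (k0 j2 o a')^*) * (h a q1 * (h a' q2)^*).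
  under eq_bigr do rewrite mulr_suml.
  rewrite exchange_big; apply: eq_bigr => a _ /=.
  under eq_bigr do rewrite conj_sum mulr_sumr.
  rewrite exchange_big; apply: eq_bigr => a' _ /=; rewrite mulr_suml.
  by apply: eq_bigr => o _; rewrite rmorphM /=; ring.
by rewrite !E; apply: eq_bigr => a _; apply: eq_bigr => a' _; rewrite e.
Qed.

Lemma entropy_transfer_row (I O O' A Q : finType) (k : I -> O -> A -> C)
  (k' : I -> O' -> A -> C) (h : Q -> A -> C) :
  (forall i i' a a', \sum_o k i o a * (k i' o a')^* = \sum_o k' i o a * (k' i' o a')^*) ->
  entropy (fun i (v : O * Q) => \sum_a k i v.1 a * h v.2 a) =
  entropy (fun i (v : O' * Q) => \sum_a k' i v.1 a * h v.2 a).
Proof.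
move=> e; apply: eq_entropy_row => i i'; rewrite !sum_pair exchange_big [RHS]exchange_big.
apply: eq_bigr => q _ /=.
exact: (gram_transfer (fun a q => h q a) q q (e i i')).
Qed.

Lemma entropy_transfer_col (I O O' A Q : finType) (k : I -> O -> A -> C)
  (k' : I -> O' -> A -> C) (h : Q -> A -> C) :
  (forall i i' a a', \sum_o k i o a * (k i' o a')^* = \sum_o k' i o a * (k' i' o a')^*) ->
  entropy (fun o (v : I * Q) => \sum_a k v.1 o a * h v.2 a) =
  entropy (fun o (v : I * Q) => \sum_a k' v.1 o a * h v.2 a).
Proof.
move=> e; apply: eq_entropy_col => v v' /=.
exact: (gram_transfer (fun a q => h q a) v.2 v'.2 (e v.1 v'.1)).
Qed.

(** H(F|P) of the output of the dilation [k], for an input purified by [Q]; the systems [S] and [Q]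
    are traced out. *)
Definition cond_ent (P F S A Q : finType) (k : P -> F -> S -> A -> C)
  (h : Q -> A -> C) : R :=
  entropy (fun (u : P * F) (v : S * Q) => \sum_a k u.1 u.2 v.1 a * h v.2 a)
  - entropy (fun p (v : F * (S * Q)) => \sum_a k p v.1 v.2.1 a * h v.2.2 a).

(** Systems of 0-tuples have one point: the first entropy is at most, and the second at least, [eta]
    of their common mass. *)
Lemma cond_ent_pow0 (P F S A Q : finType) (k : P -> F -> S -> A -> C)
  (h : Q -> 0.-tuple A -> C) : cond_ent (pow3 (n := 0) k) h <= 0.
Proof.
rewrite /cond_ent.
set f := (X in entropy X - _); set g := (X in _ - entropy X).
have := entropy_le_card f; rewrite card_prod !card_tuple !expn0 muln1 ln1 mulr0 addr0.
have := entropy_ge_eta g.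
have -> : mass g = mass f; last by lra.
rewrite /mass sum_pair; apply: eq_bigr => p _; rewrite sum_pair.
by apply: eq_bigr => q _.
Qed.

(** [cond_subadd] separates the first use from the others. In each resulting term all outputs of the
    other part are traced out, so its isometry can be undone and its input joins the reference.
    Hence the need for arbitrary reference systems. *)
Lemma cond_ent_powS (P F S A Q : finType) (k : P -> F -> S -> A -> C) n
  (h : Q -> n.+1.-tuple A -> C) :
  (forall a a', \sum_p \sum_q \sum_s (k p q s a)^* * k p q s a' = (a == a')%:R) ->
  cond_ent (pow3 k) h <=
   cond_ent k (fun (v : n.-tuple A * Q) a => h v.2 (cons_tuple a v.1))
   + cond_ent (pow3 k) (fun (v : A * Q) a => h v.2 (cons_tuple v.1 a)).
Proof.
move=> hk.
pose f p1 q1 (p : n.-tuple P) (q : n.-tuple F) (w : (S * n.-tuple S) * Q) :=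
  \sum_a1 \sum_a (k p1 q1 w.1.1 a1 * pow3 k p q w.1.2 a) * h w.2 (cons_tuple a1 a).
have := cond_subadd f.
have hS w p1 q1 p q : \sum_a pow3 k (cons_tuple p1 p) (cons_tuple q1 q)
    (cons_tuple w.1.1 w.1.2) a * h w.2 a = f p1 q1 p q w.
  rewrite sum_tupleS; apply: eq_bigr => a1 _; apply: eq_bigr => a _.
  by rewrite pow3S.
have ctK (T : finType) m (t : m.+1.-tuple T) : cons_tuple (thead t) (behead_tuple t) = t.
  by rewrite [RHS]tuple_eta; apply/val_inj.
have thc (T : finType) m x (t : m.-tuple T) : thead (cons_tuple x t) = x by [].
have btc (T : finType) m x (t : m.-tuple T) : behead_tuple (cons_tuple x t) = t.
  exact/val_inj.
have -> : entropy (fun (u : (P * F) * (n.-tuple P * n.-tuple F)) z => f u.1.1 u.1.2 u.2.1 u.2.2 z)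
  = entropy (fun (u : n.+1.-tuple P * n.+1.-tuple F) (v : n.+1.-tuple S * Q) =>
     \sum_a pow3 k u.1 u.2 v.1 a * h v.2 a).
  apply: (entropy_bij
    (h := fun u => (cons_tuple u.1.1 u.2.1, cons_tuple u.1.2 u.2.2))
    (h' := fun u => ((thead u.1, thead u.2), (behead_tuple u.1, behead_tuple u.2)))
    (k := fun v => (cons_tuple v.1.1 v.1.2, v.2))
    (k' := fun v => ((thead v.1, behead_tuple v.1), v.2))).
  - by case=> [[? ?] [? ?]] /=; rewrite !btc.
  - by case=> ? ? /=; rewrite !ctK.
  - by case=> [[? ?] ?] /=; rewrite !btc.
  - by case=> ? ? /=; rewrite !ctK.
  by move=> u v /=; rewrite hS.
have -> : entropy (fun (u : P * n.-tuple P) (v : (F * n.-tuple F) * ((S * n.-tuple S) * Q)) =>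
     f u.1 v.1.1 u.2 v.1.2 v.2)
  = entropy (fun p (v : n.+1.-tuple F * (n.+1.-tuple S * Q)) =>
     \sum_a pow3 k p v.1 v.2.1 a * h v.2.2 a).
  apply: (entropy_bij
    (h := fun u => cons_tuple u.1 u.2)
    (h' := fun u => (thead u, behead_tuple u))
    (k := fun v => (cons_tuple v.1.1 v.1.2, (cons_tuple v.2.1.1 v.2.1.2, v.2.2)))
    (k' := fun v => ((thead v.1, behead_tuple v.1), ((thead v.2.1, behead_tuple v.2.1), v.2.2)))).
  - by case=> [? ?] /=; rewrite !btc.
  - by move=> ?; rewrite !ctK.
  - by case=> [[? ?] [[? ?] ?]] /=; rewrite !btc.
  - by case=> ? [? ?] /=; rewrite !ctK.
  by move=> u v /=; rewrite hS.
have iso1 (w : (P * F) * S) (w' : (P * F) * S) q q' :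
   \sum_p0 \sum_q0 \sum_s f w.1.1 w.1.2 p0 q0 ((w.2, s), q) *
     (f w'.1.1 w'.1.2 p0 q0 ((w'.2, s), q'))^*
   = \sum_a (\sum_a1 k w.1.1 w.1.2 w.2 a1 * h q (cons_tuple a1 a)) *
            (\sum_a1 k w'.1.1 w'.1.2 w'.2 a1 * h q' (cons_tuple a1 a))^*.
  pose W (o : n.-tuple P * (n.-tuple F * n.-tuple S)) a := pow3 k o.1 o.2.1 o.2.2 a.
  have hW a a' : \sum_o (W o a)^* * W o a' = (a == a')%:R.
    rewrite -(pow3_isom hk a a') sum_pair; apply: eq_bigr => p _.
    by rewrite sum_pair.
  have := isom_gram (fun a (t : ((P * F) * S) * Q) =>
     \sum_a1 k t.1.1.1 t.1.1.2 t.1.2 a1 * h t.2 (cons_tuple a1 a)) hW (w, q) (w', q').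
  move=> /= <-; rewrite sum_pair; apply: eq_bigr => p _; rewrite sum_pair.
  apply: eq_bigr => q0 _; apply: eq_bigr => s _.
  by congr (_ * Num.conj _); rewrite /f /= exchange_big; apply: eq_bigr => a _ /=;
     rewrite mulr_sumr; apply: eq_bigr => a1 _; rewrite /W /=; ring.
have iso2 (w : (n.-tuple P * n.-tuple F) * n.-tuple S) (w' : (n.-tuple P * n.-tuple F) * n.-tuple S) q q' :
   \sum_p0 \sum_q0 \sum_s f p0 q0 w.1.1 w.1.2 ((s, w.2), q) *
     (f p0 q0 w'.1.1 w'.1.2 ((s, w'.2), q'))^*
   = \sum_a (\sum_a1 pow3 k w.1.1 w.1.2 w.2 a1 * h q (cons_tuple a a1)) *
            (\sum_a1 pow3 k w'.1.1 w'.1.2 w'.2 a1 * h q' (cons_tuple a a1))^*.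
  pose W (o : P * (F * S)) a := k o.1 o.2.1 o.2.2 a.
  have hW a a' : \sum_o (W o a)^* * W o a' = (a == a')%:R.
    rewrite -(hk a a') sum_pair; apply: eq_bigr => p _.
    by rewrite sum_pair.
  have := isom_gram (fun a (t : ((n.-tuple P * n.-tuple F) * n.-tuple S) * Q) =>
     \sum_a1 pow3 k t.1.1.1 t.1.1.2 t.1.2 a1 * h t.2 (cons_tuple a a1)) hW (w, q) (w', q').
  move=> /= <-; rewrite sum_pair; apply: eq_bigr => p _; rewrite sum_pair.
  apply: eq_bigr => q0 _; apply: eq_bigr => s _.
  by congr (_ * Num.conj _); rewrite /f /=; apply: eq_bigr => a _ /=;
     rewrite mulr_sumr; apply: eq_bigr => a1 _; rewrite /W /=; ring.
have -> : entropy (fun (u : P * F) (v : (n.-tuple P * n.-tuple F) * ((S * n.-tuple S) * Q)) =>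
     f u.1 u.2 v.1.1 v.1.2 v.2)
  = entropy (fun (u : P * F) (v : S * (n.-tuple A * Q)) =>
      \sum_a k u.1 u.2 v.1 a * h v.2.2 (cons_tuple a v.2.1)).
  transitivity (entropy (fun (u : P * F) (v : S * (Q * (n.-tuple P * (n.-tuple F * n.-tuple S)))) =>
     f u.1 u.2 v.2.2.1 v.2.2.2.1 ((v.1, v.2.2.2.2), v.2.1))).
    apply: (entropy_bij (h := id) (h' := id)
      (k := fun v => (v.2.1.1, (v.2.2, (v.1.1, (v.1.2, v.2.1.2)))))
      (k' := fun v => ((v.2.2.1, v.2.2.2.1), ((v.1, v.2.2.2.2), v.2.1)))) => //.
    - by case=> [[? ?] [[? ?] ?]].
    - by case=> ? [? [? [? ?]]].
  apply: eq_entropy_row => u u'; rewrite sum_pair [RHS]sum_pair; apply: eq_bigr => s1 _.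
  rewrite sum_pair [RHS]sum_pair [RHS]exchange_big; apply: eq_bigr => q _ /=.
  rewrite sum_pair; apply: etrans (iso1 (u, s1) (u', s1) q q).
  by apply: eq_bigr => p _; rewrite sum_pair.
have -> : entropy (fun (u : P) (v : F * ((n.-tuple P * n.-tuple F) * ((S * n.-tuple S) * Q))) =>
     f u v.1 v.2.1.1 v.2.1.2 v.2.2)
  = entropy (fun (u : P) (v : F * (S * (n.-tuple A * Q))) =>
      \sum_a k u v.1 v.2.1 a * h v.2.2.2 (cons_tuple a v.2.2.1)).
  transitivity (entropy (fun (u : P) (v : F * (S * (Q * (n.-tuple P * (n.-tuple F * n.-tuple S))))) =>
     f u v.1 v.2.2.2.1 v.2.2.2.2.1 ((v.2.1, v.2.2.2.2.2), v.2.2.1))).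
    apply: (entropy_bij (h := id) (h' := id)
      (k := fun v => (v.1, (v.2.2.1.1, (v.2.2.2, (v.2.1.1, (v.2.1.2, v.2.2.1.2))))))
      (k' := fun v => (v.1, ((v.2.2.2.1, v.2.2.2.2.1), ((v.2.1, v.2.2.2.2.2), v.2.2.1))))) => //.
    - by case=> ? [[? ?] [[? ?] ?]].
    - by case=> ? [? [? [? [? ?]]]].
  apply: eq_entropy_row => u u'; rewrite sum_pair [RHS]sum_pair; apply: eq_bigr => f1 _.
  rewrite sum_pair [RHS]sum_pair; apply: eq_bigr => s1 _.
  rewrite sum_pair [RHS]sum_pair [RHS]exchange_big; apply: eq_bigr => q _ /=.
  rewrite sum_pair; apply: etrans (iso1 ((u, f1), s1) ((u', f1), s1) q q).
  by apply: eq_bigr => p _; rewrite sum_pair.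
have -> : entropy (fun (u : n.-tuple P * n.-tuple F) (v : (P * F) * ((S * n.-tuple S) * Q)) =>
     f v.1.1 v.1.2 u.1 u.2 v.2)
  = entropy (fun (u : n.-tuple P * n.-tuple F) (v : n.-tuple S * (A * Q)) =>
      \sum_a pow3 k u.1 u.2 v.1 a * h v.2.2 (cons_tuple v.2.1 a)).
  transitivity (entropy (fun (u : n.-tuple P * n.-tuple F) (v : n.-tuple S * (Q * (P * (F * S)))) =>
     f v.2.2.1 v.2.2.2.1 u.1 u.2 ((v.2.2.2.2, v.1), v.2.1))).
    apply: (entropy_bij (h := id) (h' := id)
      (k := fun v => (v.2.1.2, (v.2.2, (v.1.1, (v.1.2, v.2.1.1)))))
      (k' := fun v => ((v.2.2.1, v.2.2.2.1), ((v.2.2.2.2, v.1), v.2.1)))) => //.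
    - by case=> [[? ?] [[? ?] ?]].
    - by case=> ? [? [? [? ?]]].
  apply: eq_entropy_row => u u'; rewrite sum_pair [RHS]sum_pair; apply: eq_bigr => s1 _.
  rewrite sum_pair [RHS]sum_pair [RHS]exchange_big; apply: eq_bigr => q _ /=.
  rewrite sum_pair; apply: etrans (iso2 (u, s1) (u', s1) q q).
  by apply: eq_bigr => p _; rewrite sum_pair.
have -> : entropy (fun (u : n.-tuple P) (v : n.-tuple F * ((P * F) * ((S * n.-tuple S) * Q))) =>
     f v.2.1.1 v.2.1.2 u v.1 v.2.2)
  = entropy (fun (u : n.-tuple P) (v : n.-tuple F * (n.-tuple S * (A * Q))) =>
      \sum_a pow3 k u v.1 v.2.1 a * h v.2.2.2 (cons_tuple v.2.2.1 a)).
  transitivity (entropy (fun (u : n.-tuple P) (v : n.-tuple F * (n.-tuple S * (Q * (P * (F * S))))) =>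
     f v.2.2.2.1 v.2.2.2.2.1 u v.1 ((v.2.2.2.2.2, v.2.1), v.2.2.1))).
    apply: (entropy_bij (h := id) (h' := id)
      (k := fun v => (v.1, (v.2.2.1.2, (v.2.2.2, (v.2.1.1, (v.2.1.2, v.2.2.1.1))))))
      (k' := fun v => (v.1, ((v.2.2.2.1, v.2.2.2.2.1), ((v.2.2.2.2.2, v.2.1), v.2.2.1))))) => //.
    - by case=> ? [[? ?] [[? ?] ?]].
    - by case=> ? [? [? [? [? ?]]]].
  apply: eq_entropy_row => u u'; rewrite sum_pair [RHS]sum_pair; apply: eq_bigr => f1 _.
  rewrite sum_pair [RHS]sum_pair; apply: eq_bigr => s1 _.
  rewrite sum_pair [RHS]sum_pair [RHS]exchange_big; apply: eq_bigr => q _ /=.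
  rewrite sum_pair; apply: etrans (iso2 ((u, f1), s1) ((u', f1), s1) q q).
  by apply: eq_bigr => p _; rewrite sum_pair.
exact: id.
Qed.

Lemma cond_ent_pow (P F S A : finType) (k : P -> F -> S -> A -> C) (c : R) :
  (forall a a', \sum_p \sum_q \sum_s (k p q s a)^* * k p q s a' = (a == a')%:R) ->
  (forall (Q : finType) (h : Q -> A -> C), mass h = 1 -> cond_ent k h <= c) ->
  forall n (Q : finType) (h : Q -> n.-tuple A -> C), mass h = 1 ->
    cond_ent (pow3 k) h <= n%:R * c.
Proof.
move=> hk hc; elim=> [|n IHn] Q h h1; first by rewrite mul0r cond_ent_pow0.
apply: (le_trans (cond_ent_powS _ hk)); rewrite -natr1 mulrDl mul1r addrC.
apply: lerD.
  apply: IHn; rewrite -h1 /mass sum_pair exchange_big; apply: eq_bigr => q _ /=.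
  by rewrite [RHS]sum_tupleS.
apply: hc; rewrite -h1 /mass sum_pair exchange_big; apply: eq_bigr => q _ /=.
by rewrite [RHS]sum_tupleS exchange_big.
Qed.

End Powers.

(** * Private information of a degradable extension *)

Section Core.
Variable R : realType.
Local Notation C := (R[i]).

Lemma cond_ent_concave (X P F S A Q : finType) (k : P -> F -> S -> A -> C)
  (h : X * Q -> A -> C) :
  \sum_x cond_ent k (fun q => h (x, q)) <= cond_ent k h.
Proof.
have := cond_concave (fun x p f (w : S * Q) => \sum_a k p f w.1 a * h (x, w.2) a).
congr (_ <= _); rewrite /cond_ent; congr (_ - _).
  apply: (entropy_bij (h := id) (h' := id) (k := fun v => (v.2.1, (v.1, v.2.2)))
    (k' := fun v => (v.2.1, (v.1, v.2.2)))) => //.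
  - by case=> ? [? ?].
  - by case=> ? [? ?].
apply: (entropy_bij (h := id) (h' := id) (k := fun v => (v.1, (v.2.2.1, (v.2.1, v.2.2.2))))
  (k' := fun v => (v.1, (v.2.2.1, (v.2.1, v.2.2.2))))) => //.
- by case=> ? [? [? ?]].
- by case=> ? [? [? ?]].
Qed.

Section Degraded.
Variables (A B E F F' T : finType).
Variables (v : B -> E -> A -> C) (Y : B -> F -> T -> A -> C) (Z : T -> F' -> T -> A -> C).

(* Y purifies the degraded channel v, and Z purifies the degrading map: both
   have the same marginal on (T, A), and the two T-outputs of Z are equal. *)
Hypothesis vY : forall b b' a a',
  \sum_e v b e a * (v b' e a')^* = \sum_f \sum_t Y b f t a * (Y b' f t a')^*.
Hypothesis YZ : forall t t' a a',
  \sum_b \sum_f Y b f t a * (Y b f t' a')^* = \sum_s \sum_f Z s f t a * (Z s f t' a')^*.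
Hypothesis ZZ : forall t t' a a',
  \sum_f \sum_s Z t f s a * (Z t' f s a')^* = \sum_f \sum_s Z s f t a * (Z s f t' a')^*.

Lemma out_entropy (Q : finType) (h : Q -> A -> C) :
  entropy (fun b (w : E * Q) => \sum_a v b w.1 a * h w.2 a) =
  entropy (fun b (w : F * (T * Q)) => \sum_a Y b w.1 w.2.1 a * h w.2.2 a).
Proof.
rewrite (entropy_transfer_row (k' := fun b (o : F * T) => Y b o.1 o.2)); last first.
  by move=> b b' a a'; rewrite vY sum_pair.
apply: (entropy_bij (h := id) (h' := id) (k := fun u => (u.1.1, (u.1.2, u.2)))
  (k' := fun u => ((u.1, u.2.1), u.2.2))) => //.
- by case=> [[? ?] ?].
- by case=> ? [? ?].
Qed.

Lemma env_entropy (Q : finType) (h : Q -> A -> C) :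
  entropy (fun e (w : B * Q) => \sum_a v w.1 e a * h w.2 a) =
  entropy (fun (u : T * F) (w : B * Q) => \sum_a Y w.1 u.2 u.1 a * h w.2 a).
Proof.
rewrite (entropy_transfer_col (k := fun b e => v b e)
  (k' := fun b (o : T * F) => Y b o.2 o.1)) //.
by move=> b b' a a'; rewrite vY sum_pair exchange_big.
Qed.

Lemma out_entropy_ext (Q : finType) (h : Q -> A -> C) :
  entropy (fun (u : B * F) (w : T * Q) => \sum_a Y u.1 u.2 w.1 a * h w.2 a) =
  entropy (fun (u : T * F') (w : T * Q) => \sum_a Z u.1 u.2 w.1 a * h w.2 a).
Proof.
rewrite (entropy_transfer_col (k := fun t (o : B * F) => Y o.1 o.2 t)
  (k' := fun t (o : T * F') => Z o.1 o.2 t)) //.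
by move=> t t' a a'; rewrite !sum_pair YZ.
Qed.

(** The environment's [T] is the second output of [Z]; [ZZ] exchanges it for the first, so that it
    becomes the condition in [cond_ent Z]. *)
Lemma env_entropy_ext (Q : finType) (h : Q -> A -> C) :
  entropy (fun t (w : F * (B * Q)) => \sum_a Y w.2.1 w.1 t a * h w.2.2 a) =
  entropy (fun t (w : F' * (T * Q)) => \sum_a Z t w.1 w.2.1 a * h w.2.2 a).
Proof.
transitivity (entropy (fun t (w : (F * B) * Q) => \sum_a Y w.1.2 w.1.1 t a * h w.2 a)).
  apply: (entropy_bij (h := id) (h' := id) (k := fun u => ((u.1, u.2.1), u.2.2))
    (k' := fun u => (u.1.1, (u.1.2, u.2)))) => //.
  - by case=> ? [? ?].
  - by case=> [[? ?] ?].
rewrite (entropy_transfer_row (k := fun t (o : F * B) => Y o.2 o.1 t)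
  (k' := fun t (o : F' * T) => Z t o.1 o.2)); last first.
  by move=> t t' a a'; rewrite !sum_pair exchange_big YZ ZZ exchange_big.
apply: (entropy_bij (h := id) (h' := id) (k := fun u => (u.1.1, (u.1.2, u.2)))
  (k' := fun u => ((u.1, u.2.1), u.2.2))) => //.
- by case=> [[? ?] ?].
- by case=> ? [? ?].
Qed.

(** Concavity reduces to pure inputs. There the first two outputs of [Z] together have the entropy
    of the third, and by [ZZ] this is the entropy of the first. *)
Lemma cond_ent_ge0 (Q : finType) (h : Q -> A -> C) : 0 <= cond_ent Z h.
Proof.
(* With [Q * unit] as reference, all of [Q] becomes a label and a one-point reference remains, that
   is, a pure input. *)
have := cond_ent_concave Z (fun (w : Q * unit) => h w.1).
have -> : cond_ent Z (fun (w : Q * unit) => h w.1) = cond_ent Z h.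
  rewrite /cond_ent; congr (_ - _).
    apply: (entropy_bij (h := id) (h' := id) (k := fun u => (u.1, u.2.1))
      (k' := fun u => (u.1, (u.2, tt)))) => //.
    - by case=> ? [? []].
    - by case.
  apply: (entropy_bij (h := id) (h' := id) (k := fun u => (u.1, (u.2.1, u.2.2.1)))
    (k' := fun u => (u.1, (u.2.1, (u.2.2, tt))))) => //.
  - by case=> ? [? [? []]].
  - by case=> ? [].
congr (_ <= _); rewrite big1 // => q _; rewrite /cond_ent -entropy_swap.
apply/eqP; rewrite subr_eq0; apply/eqP.
transitivity (entropy (fun (t : T) (w : (F' * T) * unit) => \sum_a Z w.1.2 w.1.1 t a * h q a)).
  apply: (entropy_bij (h := fun t : T * unit => t.1) (h' := fun t => (t, tt))
    (k := fun u => ((u.2, u.1), tt)) (k' := fun u => (u.1.2, u.1.1))) => //.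
  - by case=> ? [].
  - by case.
  - by case=> [[? ?] []].
rewrite (entropy_transfer_row (k := fun t (o : F' * T) => Z o.2 o.1 t)
  (k' := fun t (o : F' * T) => Z t o.1 o.2) (fun _ : unit => h q)); last first.
  by move=> t t' a a'; rewrite !sum_pair ZZ.
apply: (entropy_bij (h := id) (h' := id) (k := fun u => (u.1.1, (u.1.2, u.2)))
  (k' := fun u => ((u.1, u.2.1), u.2.2))) => //.
- by case=> [[? ?] ?].
- by case=> ? [? ?].
Qed.

(** Enlarging [B] to [B] and [F], and reducing [E] to [T], can only raise the difference: these are
    the two uses of concavity. Then the receiver holds [T] and [F'] and the environment a system in
    the state of that [T], so what remains is [cond_ent Z h] minus a nonnegative sum over the
    messages. *)
Lemma private_info_le (X Q : finType) (h : X * Q -> A -> C) :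
  (entropy (fun b (w : X * (E * Q)) => \sum_a v b w.2.1 a * h (w.1, w.2.2) a)
   - \sum_x entropy (fun b (w : E * Q) => \sum_a v b w.1 a * h (x, w.2) a))
  - (entropy (fun e (w : X * (B * Q)) => \sum_a v w.2.1 e a * h (w.1, w.2.2) a)
   - \sum_x entropy (fun e (w : B * Q) => \sum_a v w.1 e a * h (x, w.2) a))
  <= cond_ent Z h.
Proof.
have -> : entropy (fun b (w : X * (E * Q)) => \sum_a v b w.2.1 a * h (w.1, w.2.2) a)
  = entropy (fun b (w : E * (X * Q)) => \sum_a v b w.1 a * h w.2 a).
  apply: (entropy_bij (h := id) (h' := id) (k := fun v => (v.2.1, (v.1, v.2.2)))
    (k' := fun v => (v.2.1, (v.1, v.2.2)))) => //.
  - by case=> ? [? ?].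
  - by case=> ? [? ?].
have -> : entropy (fun e (w : X * (B * Q)) => \sum_a v w.2.1 e a * h (w.1, w.2.2) a)
  = entropy (fun e (w : B * (X * Q)) => \sum_a v w.1 e a * h w.2 a).
  apply: (entropy_bij (h := id) (h' := id) (k := fun v => (v.2.1, (v.1, v.2.2)))
    (k' := fun v => (v.2.1, (v.1, v.2.2)))) => //.
  - by case=> ? [? ?].
  - by case=> ? [? ?].
rewrite out_entropy env_entropy.
under eq_bigr do rewrite (out_entropy (fun q => h (_, q))).
under [X in _ - (_ - X)]eq_bigr do rewrite (env_entropy (fun q => h (_, q))).
have := cond_ent_concave Y h.
have := cond_ent_concave (fun t f b a => Y b f t a) h.
have : 0 <= \sum_x cond_ent Z (fun q => h (x, q)).
  by apply: sumr_ge0 => x _; exact: cond_ent_ge0.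
rewrite /cond_ent !sumrB out_entropy_ext env_entropy_ext.
under [X in _ -> _ -> X - _ <= _ -> _]eq_bigr do rewrite (out_entropy_ext (fun q => h (_, q))).
under [X in _ -> _ - X <= _ -> _ -> _]eq_bigr do rewrite (env_entropy_ext (fun q => h (_, q))).
move: (entropy _) (entropy _) (entropy _) (entropy _) (\sum_x entropy _) (\sum_x entropy _) (\sum_x entropy _) (\sum_x entropy _).
clear; intros; lra.
Qed.

End Degraded.
End Core.

Lemma isometry_sum (R : realType) (A B E : finType)
  (V : 'M[R[i]]_(#|{: B * E}|, #|A|)) a a' : Defs.isometry V ->
  \sum_b \sum_e (ent V (b, e) a)^* * ent V (b, e) a' = (a == a')%:R.
Proof.
move=> isoV; rewrite -ent1 -isoV ent_mul sum_pair; apply: eq_bigr => b _.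
by apply: eq_bigr => e _; rewrite ent_adj.
Qed.

(** * From a code to the bound on its rate *)

Section Rates.
Variable R : realType.
Local Notation C := (R[i]).
Variables (A B E F F' T : finType).
Variables (V : 'M[C]_(#|{: B * E}|, #|A|)).
Variables (Y : B -> F -> T -> A -> C) (Z : T -> F' -> T -> A -> C).
Hypothesis A0 : (0 < #|A|)%N.
Hypothesis isoV : Defs.isometry V.
Hypothesis vY : forall b b' a a',
  \sum_e ent V (b, e) a * (ent V (b', e) a')^*
  = \sum_f \sum_t Y b f t a * (Y b' f t a')^*.
Hypothesis YZ : forall t t' a a',
  \sum_b \sum_f Y b f t a * (Y b f t' a')^* = \sum_s \sum_f Z s f t a * (Z s f t' a')^*.
Hypothesis ZZ : forall t t' a a',
  \sum_f \sum_s Z t f s a * (Z t' f s a')^* = \sum_f \sum_s Z s f t a * (Z s f t' a')^*.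
Hypothesis isoZ : forall a a',
  \sum_t \sum_f \sum_s (Z t f s a)^* * Z t f s a' = (a == a')%:R.
Variable c : R.
Hypothesis single_letter : forall (Q : finType) (h : Q -> A -> C),
  mass h = 1 -> cond_ent Z h <= c.

Lemma env_nonempty : (0 < #|E|)%N.
Proof.
rewrite lt0n; apply/negP => /eqP E0; have /card_gt0P[a _] := A0.
have := isometry_sum a a isoV; rewrite eqxx big1 => [/esym/eqP|b _]; first by rewrite oner_eq0.
by rewrite big1 // => e; have := max_card (pred1 e); rewrite E0 card1.
Qed.

Let vn n (b : n.-tuple B) (e : n.-tuple E) (a : n.-tuple A) : C := ent (isom_pow V n) (b, e) a.

Lemma sum_unit_tuple n (G : n.-tuple unit -> C) : \sum_t G t = G [tuple of nseq n tt].
Proof.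
rewrite (big_pred1 [tuple of nseq n tt]) // => t; apply/esym/eqP/eq_from_tnth => i.
by case: (tnth t i); case: (tnth _ i).
Qed.

Let kv (_ : unit) e b a := ent V (b, e) a.

Lemma vn_pow n b e a : vn b e a = pow3 kv [tuple of nseq n tt] e b a.
Proof. by rewrite /vn /isom_pow entE. Qed.

Lemma vYn n b b' a a' : \sum_e vn (n := n) b e a * (vn b' e a')^*
  = \sum_f \sum_t pow3 Y b f t a * (pow3 Y b' f t a')^*.
Proof.
have := @pow3_gram12 R _ _ _ _ _ _ kv (fun f t b a => Y b f t a) n.
move=> /(_ _ b b' a a') h.
transitivity (\sum_p \sum_q pow3 kv p q b a * (pow3 kv p q b' a')^*).
  rewrite sum_unit_tuple; apply: eq_bigr => e _.
  by rewrite !vn_pow.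
rewrite h // => s s' x x'; rewrite sum_unit; exact: vY.
Qed.

Lemma vn_isom n a a' :
  \sum_b \sum_e (vn (n := n) b e a)^* * vn b e a' = (a == a')%:R.
Proof.
have h x x' : \sum_p \sum_q \sum_s (kv p q s x)^* * kv p q s x' = (x == x')%:R.
  by rewrite sum_unit exchange_big (isometry_sum _ _ isoV).
rewrite -(pow3_isom h a a') sum_unit_tuple exchange_big.
by apply: eq_bigr => e _; apply: eq_bigr => b _; rewrite !vn_pow.
Qed.

(** Mixed codewords are purified by their square roots [L x]; the message and the purifying index
    together form the reference system in [cond_ent_pow]. *)
Lemma code_rate n K (rho : 'I_K -> 'M[C]_#|{: n.-tuple A}|)
  (M : 'I_K -> 'M[C]_#|{: n.-tuple B}|) (eps : R) : (0 < K)%N ->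
  good_code V rho M eps ->
  (1 - eps) * ln K%:R - ln 2 - eps * (n%:R * ln #|E|%:R) - 1 - eps <= n%:R * c.
Proof.
move=> K0 [hrho hM htr]; have k0 : (0 : R) < K%:R by rewrite ltr0n.
have ki : (0 : R) <= K%:R^-1 by rewrite invr_ge0 ltW.
have /fin_all_exists[L hL] : forall x, exists L : 'M[C]_#|{: n.-tuple A}|,
    rho x = L *m adj L.
  by move=> x; apply: psd_factor; exact: (proj1 (hrho x)).
pose h (w : 'I_K * n.-tuple A) (y : n.-tuple A) : C :=
  realc (Num.sqrt K%:R^-1) * ent (L w.1) y w.2.
have hm x : mass (fun z => h (x, z)) = K%:R^-1.
  rewrite mass_scale // -[RHS]mulr1; congr (_ * _).
  apply: realc_inj; rewrite realc1 -(proj2 (hrho x)) hL ent_tr /mass exchange_big.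
  rewrite realc_sum; apply: eq_bigr => y _ /=; rewrite ent_mul realc_sum.
  by apply: eq_bigr => z _; rewrite ent_adj nsqE.
pose W (o : n.-tuple B * n.-tuple E) a := vn o.1 o.2 a.
have hW a a' : \sum_o (W o a)^* * W o a' = (a == a')%:R.
  by rewrite sum_pair -vn_isom.
pose g x b e z := \sum_y vn b e y * h (x, z) y.
have gm x : \sum_b \sum_e \sum_z nsq (g x b e z) = K%:R^-1.
  transitivity (mass (fun y z => h (x, z) y)).
    by rewrite -(mass_isom (fun y z => h (x, z) y) hW) /mass sum_pair.
  by rewrite -(hm x) /mass exchange_big.
have sE u v : ent (cq_state V rho) u v = if u.1 == v.1 then
     \sum_z g u.1 u.2.1 u.2.2 z * (g u.1 v.2.1 v.2.2 z)^* else 0.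
  rewrite /cq_state entE; case: ifP => // _.
  have -> : isom_pow V n *m rho u.1 *m adj (isom_pow V n) =
    (isom_pow V n *m L u.1) *m adj (isom_pow V n *m L u.1).
    by rewrite hL adjM !mulmxA.
  rewrite ent_mul mulr_sumr; apply: eq_bigr => z _.
  have gE b e : g u.1 b e z = realc (Num.sqrt K%:R^-1) * ent (isom_pow V n *m L u.1) (b, e) z.
    rewrite ent_mul mulr_sumr; apply: eq_bigr => y _.
    by rewrite /h /vn /=; ring.
  rewrite ent_adj !gE -!surjective_pairing rmorphM /= realc_conj mulrACA.
  by rewrite -realcM -expr2 sqr_sqrtr // realcE fmorphV rmorph_nat.
have En : (0 < #|{: n.-tuple E}|)%N by rewrite card_tuple expn_gt0 env_nonempty.
have := code_bound K0 En gm hM sE htr.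
have -> : ln #|{: n.-tuple E}|%:R = n%:R * ln #|E|%:R :> R.
  by rewrite card_tuple natrX lnXn ?ltr0n ?env_nonempty // mulr_natl.
move=> /le_trans; apply.
have YZn := pow3_gram12 (n := n) YZ.
have ZZn (t t' : n.-tuple T) (a a' : n.-tuple A) :
    \sum_f \sum_s pow3 Z t f s a * (pow3 Z t' f s a')^*
    = \sum_f \sum_s pow3 Z s f t a * (pow3 Z s f t' a')^*.
  have := @pow3_gram12 R _ _ _ _ _ _ (fun f s t a => Z t f s a) (fun f s t a => Z s f t a) n.
  by move=> /(_ ZZ t t' a a').
apply: (le_trans (private_info_le (@vYn n) YZn ZZn h)).
apply: cond_ent_pow => //.
rewrite /mass sum_pair; under eq_bigr do rewrite -/(mass (fun z => h (_, z))) hm.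
by rewrite sumr_const card_ord -[_^-1 *+ K]mulr_natr mulVf // gt_eqF.
Qed.

Lemma achievable_le (r : R) : 0 <= c -> achievable V r -> r <= c.
Proof.
move=> c0 hr; have [r0|r0] := lerP r 0; first exact: le_trans c0.
set l : R := ln #|E|%:R.
have l0 : 0 <= l by apply: ln_ge0; rewrite ler1n env_nonempty.
(* Division of [code_rate] by [n]. Taking n >= 1/e puts the constants ln 2 + 1 + e <= 3 below 3 e n,
   which [4 * e] covers. *)
have key e : 0 < e -> e < 1 -> e < r -> (1 - e) * (r - e) - e * l - 4 * e <= c.
  move=> e0 e1 er; have [K [n0 [hK hrate]]] := hr e e0.
  have [n1 hn1] := hrate e e0.
  pose n2 := Num.bound e^-1.
  pose n := maxn n0 (maxn n1 n2).
  have nn0 : (n0 <= n)%N by rewrite leq_maxl.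
  have nn1 : (n1 <= n)%N by rewrite /n leq_max leq_maxl orbT.
  have nn2 : (n2 <= n)%N by rewrite /n leq_max leq_maxr orbT.
  have n20 : (0 < n2)%N.
    by rewrite -(ltr0n R); apply: lt_trans (archi_boundP _); rewrite ?invr_gt0 ?invr_ge0 ?ltW.
  have np : (0 < n)%N by exact: leq_trans nn2.
  have np' : (0 : R) < n%:R by rewrite ltr0n.
  have en : 1 <= e * n%:R.
    rewrite -ler_pdivrMl // mulr1; apply: (le_trans _ (_ : n2%:R <= n%:R)).
      by apply/ltW/archi_boundP; rewrite invr_ge0 ltW.
    by rewrite ler_nat.
  have [rho [M hgood]] := hK n nn0.
  have hrn := hn1 n nn1.
  (* With the convention ln 0 = 0 an empty code has rate 0, which contradicts [e < r]. *)
  have K0 : (0 < K n)%N.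
    rewrite lt0n; apply/negP => /eqP k0; move: hrn; rewrite k0 ln0 // mul0r.
    by rewrite leNgt subr_gt0 er.
  have := code_rate K0 hgood; rewrite -/l => hc.
  have h1 : (r - e) * n%:R <= ln (K n)%:R by rewrite -ler_pdivlMr.
  have h2 : (1 - e) * ((r - e) * n%:R) <= (1 - e) * ln (K n)%:R.
    by rewrite ler_wpM2l // subr_ge0 ltW.
  have ln2 : ln (2 : R) <= 1.
    have := le_ln1Dx (_ : -1 < (1 : R)); rewrite -[1 + 1]/(2 : R); apply.
    by rewrite (lt_trans (ltrN10 _)).
  rewrite -(ler_pM2r np'); lra.
apply/ler_addgt0Pr => d d0.
(* In [key] the loss from [r] is at most e (r + l + 5), hence below [e * M]. The other two bounds in
   the minimum ensure [e < 1] and [e < r]. *)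
pose M := r + l + 6.
have M0 : 0 < M by rewrite /M; lra.
pose e := Num.min (2^-1) (Num.min (r / 2) (d / M)).
have e0 : 0 < e by rewrite !lt_min invr_gt0 ltr0n !divr_gt0.
have e1 : e < 1.
  by apply: le_lt_trans (_ : e <= 2^-1) _; [rewrite /e ge_min lexx|lra].
have er : e < r.
  by apply: le_lt_trans (_ : e <= r / 2) _; [rewrite /e !ge_min lexx orbT|lra].
have eM : e * M <= d.
  by rewrite -ler_pdivlMr // /e !ge_min lexx !orbT.
have := key e e0 e1 er; move: eM; rewrite /M => eM h.
have : 0 <= e * e by rewrite mulr_ge0 // ltW.
lra.
Qed.

End Rates.

(** * Stinespring dilation and coherent information *)

Section Channels.
Variable R : realType.
Local Notation C := (R[i]).

Definition munit (A : finType) (a a' : A) : 'M[C]_#|A| :=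
  mxof (fun s t => ((s == a) && (t == a'))%:R).

Lemma psd_mul m n (L : 'M[C]_(m, n)) : psd (L *m adj L).
Proof.
move=> v; rewrite -!mulmxA mulmxA; have -> : adj v *m L = adj (adj L *m v).
  by rewrite adjM adjK.
rewrite mxE; apply: sumr_ge0 => k _; rewrite adjE mulrC -normCK.
exact: exprn_ge0.
Qed.

Lemma munit_sum (A : finType) (X : 'M[C]_#|A|) :
  X = \sum_a \sum_a' ent X a a' *: munit a a'.
Proof.
apply: mxof_inj => s t; rewrite [in RHS]/ent summxE.
transitivity (\sum_a (s == a)%:R * ent X a t); first by rewrite sum_delta.
apply: eq_bigr => a _; rewrite summxE -(sum_delta t (fun a' => (s == a)%:R * ent X a a')).
apply: eq_bigr => a' _; rewrite -/(ent (_ *: _) s t) entZ entE.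
by case: (s == a); case: (t == a'); rewrite /= !(mul1r, mul0r, mulr1, mulr0).
Qed.

Lemma channel_linear_sum (A B : finType) (N : 'M[C]_#|A| -> 'M[C]_#|B|)
  (I : finType) (k : I -> C) (X : I -> 'M[C]_#|A|) : linear N ->
  N (\sum_i k i *: X i) = \sum_i k i *: N (X i).
Proof.
move=> lN; have N0 : N 0 = 0.
  have := lN 1 0 0; rewrite !scale1r addr0 => h.
  by apply: (addrI (N 0)); rewrite addr0 -h.
elim/big_rec2: _ => [//|i y1 y2 _ <-]; exact: lN.
Qed.

Lemma channel_munit (A B : finType) (N : 'M[C]_#|A| -> 'M[C]_#|B|) X b b' :
  linear N ->
  ent (N X) b b' = \sum_a \sum_a' ent X a a' * ent (N (munit a a')) b b'.
Proof.
move=> lN; rewrite {1}(munit_sum X).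
rewrite -(sum_pair (fun p => ent X p.1 p.2 * ent (N (munit p.1 p.2)) b b')).
rewrite -(sum_pair (fun p => ent X p.1 p.2 *: munit p.1 p.2)).
rewrite channel_linear_sum // {1}/ent summxE; apply: eq_bigr => p _.
by rewrite -/(ent (_ *: _) b b') entZ.
Qed.

(* The Choi matrix of N is positive semidefinite; its square root gives the
   Stinespring isometry. *)
Lemma stinespring (A B : finType) (N : 'M[C]_#|A| -> 'M[C]_#|B|) : is_channel N ->
  exists (F : finType) (W : B -> F -> A -> C),
  (forall b b' a a', \sum_f W b f a * (W b' f a')^* = ent (N (munit a a')) b b') /\
  (forall a a', \sum_b \sum_f (W b f a)^* * W b f a' = (a == a')%:R).
Proof.
move=> [lN trN cpN].
pose phi : 'M[C]_(#|{: A * A}|, #|{: unit}|) := mxof (fun u _ => (u.1 == u.2)%:R).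
have [L hL] := psd_factor (cpN A _ (psd_mul phi)).
have JE a a' b b' : \sum_f ent L (a, b) f * (ent L (a', b') f)^* =
    ent (N (munit a a')) b b'.
  under eq_bigr do rewrite -ent_adj; rewrite -ent_mul -hL entE /=.
  congr (ent (N _) b b'); apply: eq_mxof => s t.
  rewrite ent_mul sum_unit ent_adj !entE /= conjC_nat -natrM mulnb.
  by rewrite eq_sym [a' == t]eq_sym.
exists (A * B)%type, (fun b f a => ent L (a, b) f); split=> [b b' a a'|a a'].
  exact: JE.
transitivity (\sum_b ent (N (munit a' a)) b b).
  by apply: eq_bigr => b _; rewrite -JE; apply: eq_bigr => f _; rewrite mulrC.
rewrite -ent_tr trN ent_tr (bigD1 a) //= entE eqxx andbT big1 ?addr0 // => s /negPf sa.
by rewrite entE sa andbF.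
Qed.

Lemma isom_ext_munit (A B E : finType) (N : 'M[C]_#|A| -> 'M[C]_#|B|)
  (V : 'M[C]_(#|{: B * E}|, #|A|)) a a' b b' : isom_ext N V ->
  ent (N (munit a a')) b b' = \sum_e ent V (b, e) a * (ent V (b', e) a')^*.
Proof.
move=> [_ hN]; rewrite hN entE; apply: eq_bigr => e _; rewrite ent_mul.
transitivity (\sum_x (x == a')%:R * (ent V (b, e) a * (ent V (b', e) x)^*)).
  apply: eq_bigr => x _; rewrite ent_adj ent_mul mulrA; congr (_ * _).
  rewrite -(sum_delta' a (fun y => (x == a')%:R * ent V (b, e) y)).
  apply: eq_bigr => y _; rewrite entE.
  by case: (y == a); case: (x == a'); rewrite /= !(mul1r, mul0r, mulr1, mulr0).
by rewrite sum_delta'.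
Qed.

Lemma compl_munit (A B E : finType) (V : 'M[C]_(#|{: B * E}|, #|A|)) a a' e e' :
  ent (compl V (munit a a')) e e' = \sum_b ent V (b, e) a * (ent V (b, e') a')^*.
Proof.
rewrite entE; apply: eq_bigr => b _; rewrite ent_mul.
transitivity (\sum_x (x == a')%:R * (ent V (b, e) a * (ent V (b, e') x)^*)).
  apply: eq_bigr => x _; rewrite ent_adj ent_mul mulrA; congr (_ * _).
  rewrite -(sum_delta' a (fun y => (x == a')%:R * ent V (b, e) y)).
  apply: eq_bigr => y _; rewrite entE.
  by case: (y == a); case: (x == a'); rewrite /= !(mul1r, mul0r, mulr1, mulr0).
by rewrite sum_delta'.
Qed.

Definition purification (Q A : finType) (h : Q -> A -> C) : 'cV[C]_#|{: Q * A}| :=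
  \col_i h (enum_val i).1 (enum_val i).2.

Lemma ent_purification (Q A : finType) (h : Q -> A -> C) u w :
  ent (purification h *m adj (purification h)) u w = h u.1 u.2 * (h w.1 w.2)^*.
Proof. by rewrite /ent mxE big_ord1 adjE !mxE !enum_rankK. Qed.

(** The vector on reference, output and environment is pure, so the joint entropy of reference and
    output is that of the environment. *)
Lemma coh_infoE (A B E Q : finType) (N : 'M[C]_#|A| -> 'M[C]_#|B|)
  (V : 'M[C]_(#|{: B * E}|, #|A|)) (h : Q -> A -> C) : isom_ext N V ->
  coh_info N (purification h) =
  entropy (fun b (w : E * Q) => \sum_a ent V (b, w.1) a * h w.2 a)
  - entropy (fun e (w : B * Q) => \sum_a ent V (w.1, e) a * h w.2 a).
Proof.
move=> [_ hN]; rewrite /coh_info; set w := idtens _ _.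
have wE q b q' b' : ent w (q, b) (q', b') =
  \sum_e (\sum_a ent V (b, e) a * h q a) * (\sum_a ent V (b', e) a * h q' a)^*.
  rewrite /w entE hN entE /=; apply: eq_bigr => e _; rewrite ent_mul.
  rewrite conj_sum mulr_sumr; apply: eq_bigr => a' _; rewrite ent_mul mulr_suml mulr_suml.
  apply: eq_bigr => a _; rewrite entE ent_purification ent_adj rmorphM /=.
  by ring.
congr (_ - _).
  rewrite entropyE; congr vN_entropy; apply: mxof_inj => b b'; rewrite !entE.
  rewrite sum_pair exchange_big; apply: eq_bigr => q _ /=.
  exact: wE.
transitivity (entropy (fun (u : Q * B) e => \sum_a ent V (u.2, e) a * h u.1 a)).
  rewrite entropyE; congr vN_entropy; apply: mxof_inj => -[q b] [q' b'].
  by rewrite !entE -wE entE.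
rewrite -entropy_swap.
apply: (entropy_bij (h := id) (h' := id) (k := fun u => (u.2, u.1))
  (k' := fun u => (u.2, u.1))) => //; by case.
Qed.

Lemma coh_info_le_Q1 (A B E Q : finType) (N : 'M[C]_#|A| -> 'M[C]_#|B|)
  (V : 'M[C]_(#|{: B * E}|, #|A|)) (h : Q -> A -> C) : isom_ext N V -> mass h = 1 ->
  ((entropy (fun b (w : E * Q) => (\sum_a ent V (b, w.1) a * h w.2 a)%R)
  - entropy (fun e (w : B * Q) => (\sum_a ent V (w.1, e) a * h w.2 a)%R))%:E <= Q1 N)%E.
Proof.
move=> hV h1; apply: ereal_sup_ubound; exists Q, (purification h); split.
  apply/matrixP => i j; rewrite !ord1 !mxE eqxx -[RHS]/(realc 1) -h1 /mass.
  rewrite realc_sum; under [RHS]eq_bigr do rewrite realc_sum.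
  rewrite -(sum_pair (fun p => realc (nsq (h p.1 p.2)))) -[RHS]sum_enum_val.
  by apply: eq_bigr => k _; rewrite !mxE nsqE mulrC.
by rewrite (coh_infoE h hV).
Qed.

(** A pure input with a one-point reference gives output and environment equal entropies, hence
    coherent information 0. *)
Lemma Q1_ge0 (A B E : finType) (N : 'M[C]_#|A| -> 'M[C]_#|B|)
  (V : 'M[C]_(#|{: B * E}|, #|A|)) : (0 < #|A|)%N -> isom_ext N V -> (0 <= Q1 N)%E.
Proof.
move=> /card_gt0P[a0 _] hV.
pose h (_ : unit) (a : A) : C := (a == a0)%:R.
have h1 : mass h = 1.
  rewrite /mass sum_unit (bigD1 a0) //= big1 ?addr0 => [|a /negPf aa].
    by rewrite /h eqxx /nsq conjC1 mulr1.
  by rewrite /h aa /nsq mul0r.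
have := coh_info_le_Q1 hV h1; congr (_ <= _)%E; congr (_%:E).
apply/eqP; rewrite subr_eq0; apply/eqP; rewrite -entropy_swap.
apply: (entropy_bij (h := fun u => u.1) (h' := fun e => (e, tt))
  (k := fun b => (b, tt)) (k' := fun u => u.1)) => //.
- by case=> ? [].
- by case=> ? [].
Qed.

End Channels.

Arguments munit {R A} a a'.

(** * Degradable and anti-degradable channels *)

Section Cells.
Variable R : realType.
Local Notation C := (R[i]).
Variables A B : finType.

(* Both Z1 and Z2 purify degrading maps: the first T-output of each has the same
   state as the second T-output of the other. The Y's purify, with the same
   marginal on the second T-output, the channel whose value on the matrix unit
   (a, a') is D a a'. *)
Definition cell_spec (T1 T2 G1 G2 F1 F2 : finType)
  (Z1 : T2 -> G1 -> T1 -> A -> C) (Z2 : T1 -> G2 -> T2 -> A -> C)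
  (Y1 : B -> F1 -> T1 -> A -> C) (Y2 : B -> F2 -> T2 -> A -> C)
  (D : A -> A -> B -> B -> C) (q : \bar R) : Prop :=
  [/\ (forall b b' a a', \sum_f \sum_t Y1 b f t a * (Y1 b' f t a')^* = D a a' b b') /\
      (forall b b' a a', \sum_f \sum_t Y2 b f t a * (Y2 b' f t a')^* = D a a' b b'),
      (forall t t' a a', \sum_b \sum_f Y1 b f t a * (Y1 b f t' a')^*
         = \sum_s \sum_f Z1 s f t a * (Z1 s f t' a')^*) /\
      (forall t t' a a', \sum_b \sum_f Y2 b f t a * (Y2 b f t' a')^*
         = \sum_s \sum_f Z2 s f t a * (Z2 s f t' a')^*),
      (forall t t' a a', \sum_f \sum_s Z1 t f s a * (Z1 t' f s a')^*
         = \sum_s \sum_f Z2 s f t a * (Z2 s f t' a')^*) /\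
      (forall t t' a a', \sum_f \sum_s Z2 t f s a * (Z2 t' f s a')^*
         = \sum_s \sum_f Z1 s f t a * (Z1 s f t' a')^*),
      (forall a a', \sum_t \sum_f \sum_s (Z1 t f s a)^* * Z1 t f s a' = (a == a')%:R) /\
      (forall a a', \sum_t \sum_f \sum_s (Z2 t f s a)^* * Z2 t f s a' = (a == a')%:R) &
      forall (Q : finType) (h : Q -> A -> C), mass h = 1 ->
        ((cond_ent Z1 h)%:E <= q)%E /\ ((cond_ent Z2 h)%:E <= q)%E].

Lemma post_process_out (B1 S F : finType) (D1 : 'M[C]_#|B1| -> 'M[C]_#|B|)
  (N1 : 'M[C]_#|A| -> 'M[C]_#|B1|) (W : B -> F -> B1 -> C) (u : B1 -> S -> A -> C) :
  linear D1 ->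
  (forall b b' a a', \sum_f W b f a * (W b' f a')^* = ent (D1 (munit a a')) b b') ->
  (forall b b' a a', \sum_s u b s a * (u b' s a')^* = ent (N1 (munit a a')) b b') ->
  forall b b' a a', \sum_f \sum_s (\sum_c W b f c * u c s a) * (\sum_c W b' f c * u c s a')^*
    = ent (D1 (N1 (munit a a'))) b b'.
Proof.
move=> lD hW hu b b' a a'; rewrite channel_munit //.
transitivity (\sum_f \sum_s \sum_c \sum_c' (W b f c * (W b' f c')^*) * (u c s a * (u c' s a')^*)).
  apply: eq_bigr => f _; apply: eq_bigr => s _; rewrite mulr_suml; apply: eq_bigr => c _.
  rewrite conj_sum mulr_sumr; apply: eq_bigr => c' _.
  by rewrite rmorphM /=; ring.
rewrite exchange4; apply: eq_bigr => c _; apply: eq_bigr => c' _.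
rewrite -hW -hu mulrC mulr_suml; apply: eq_bigr => f _.
by rewrite mulr_sumr.
Qed.

Lemma post_process_env (B1 S F : finType) (W : B -> F -> B1 -> C) (u : B1 -> S -> A -> C) :
  (forall c c', \sum_b \sum_f (W b f c)^* * W b f c' = (c == c')%:R) ->
  forall s s' a a', \sum_b \sum_f (\sum_c W b f c * u c s a) * (\sum_c W b f c * u c s' a')^*
    = \sum_c u c s a * (u c s' a')^*.
Proof.
move=> hW s s' a a'.
pose W' (o : B * F) c := W o.1 o.2 c.
have hW' c c' : \sum_o (W' o c)^* * W' o c' = (c == c')%:R.
  by rewrite sum_pair -hW.
have := isom_gram (fun c (v : S * A) => u c v.1 v.2) hW' (s, a) (s', a').
by rewrite sum_pair.
Qed.

End Cells.

Section CellInstances.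
Variable R : realType.
Local Notation C := (R[i]).
Variables A B : finType.

(** [Z] is [V] followed by a dilation of the degrading map, [Y] is [V] followed by a dilation of
    [D1]; one kernel serves both flags, since the two outputs of [Z] already agree. As [W] is
    isometric, its outputs jointly have the entropy of the channel output; by degradability the
    first of them has that of the environment. So [cond_ent Z] is the coherent information. *)
Lemma degradable_cell (B1 : finType) (N1 : 'M[C]_#|A| -> 'M[C]_#|B1|)
  (D1 : 'M[C]_#|B1| -> 'M[C]_#|B|) : degradable N1 -> is_channel D1 ->
  exists (T G F : finType) (Z : T -> G -> T -> A -> C) (Y : B -> F -> T -> A -> C),
    cell_spec Z Z Y Y (fun a a' => ent (D1 (N1 (munit a a')))) (Q1 N1).
Proof.
move=> [E [V [D [hV hD hdeg]]]] hD1.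
have [G [W [WE WI]]] := stinespring hD.
have [F [W1 [W1E W1I]]] := stinespring hD1.
pose u b e a := ent V (b, e) a.
have uE b b' a a' : \sum_e u b e a * (u b' e a')^* = ent (N1 (munit a a')) b b'.
  by rewrite (isom_ext_munit _ _ _ _ hV).
pose Z t f e a := \sum_b W t f b * u b e a.
have lD : linear D by case: hD.
have lD1 : linear D1 by case: hD1.
have c1 := post_process_env u WI.
have c2 t t' a a' : \sum_f \sum_s Z t f s a * (Z t' f s a')^* =
    \sum_b u b t a * (u b t' a')^*.
  by rewrite (post_process_out lD WE uE) hdeg compl_munit.
exists E, G, F, Z, (fun b f e a => \sum_c W1 b f c * u c e a).
have pa := post_process_out lD1 W1E uE.
have pb t t' a a' : \sum_b \sum_f (\sum_c W1 b f c * u c t a) * (\sum_c W1 b f c * u c t' a')^*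
    = \sum_s \sum_f Z s f t a * (Z s f t' a')^*.
  by rewrite (post_process_env u W1I) c1.
have pc t t' a a' : \sum_f \sum_s Z t f s a * (Z t' f s a')^*
    = \sum_s \sum_f Z s f t a * (Z s f t' a')^*.
  by rewrite c2 c1.
have pd a a' : \sum_t \sum_f \sum_s (Z t f s a)^* * Z t f s a' = (a == a')%:R.
  transitivity (\sum_s \sum_t \sum_f Z t f s a' * (Z t f s a)^*).
    rewrite [RHS]exchange_big; apply: eq_bigr => t _ /=; rewrite exchange_big.
    by apply: eq_bigr => f _; apply: eq_bigr => s _; rewrite mulrC.
  under eq_bigr do rewrite c1.
  rewrite -(isometry_sum a a' (proj1 hV)) exchange_big; apply: eq_bigr => b _ /=.
  by apply: eq_bigr => e _; rewrite mulrC.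
have pe (Q : finType) (h : Q -> A -> C) : mass h = 1 -> ((cond_ent Z h)%:E <= Q1 N1)%E.
  move=> h1; have := coh_info_le_Q1 hV h1; congr (_ <= _)%E; congr (_%:E).
  apply/esym; rewrite /cond_ent; congr (_ - _).
    pose W' (o : E * G) b := W o.1 o.2 b.
    have hW' c c' : \sum_o (W' o c)^* * W' o c' = (c == c')%:R.
      by rewrite sum_pair -WI.
    rewrite -(entropy_isom _ hW'); apply: eq_entropy => o v.
    under eq_bigr do rewrite mulr_suml.
    rewrite exchange_big; apply: eq_bigr => b _ /=; rewrite mulr_sumr.
    by apply: eq_bigr => a _; rewrite mulrA.
  transitivity (entropy (fun t (w : (G * E) * Q) => \sum_a Z t w.1.1 w.1.2 a * h w.2 a)).
    apply: (entropy_bij (h := id) (h' := id) (k := fun u => ((u.1, u.2.1), u.2.2))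
      (k' := fun u => (u.1.1, (u.1.2, u.2)))) => //.
    - by case=> ? [? ?].
    - by case=> [[? ?] ?].
  rewrite (entropy_transfer_row (k := fun t (o : G * E) => Z t o.1 o.2)
    (k' := fun e b => u b e)) // => t t' a a'.
  by rewrite sum_pair c2.
by split; split => //; exact: pe.
Qed.

(* z purifies the map degrading the complementary channel to N1: both outputs b
   and b' of z carry the state N1 rho, and the remaining system f is given either
   to the one or to the other side. *)
Lemma antidegradable_cell (B1 : finType) (N1 : 'M[C]_#|A| -> 'M[C]_#|B1|)
  (D1 : 'M[C]_#|B1| -> 'M[C]_#|B|) : (0 < #|A|)%N ->
  antidegradable N1 -> is_channel D1 ->
  exists (T1 T2 G F1 F2 : finType) (Z1 : T2 -> G -> T1 -> A -> C)
     (Z2 : T1 -> G -> T2 -> A -> C)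
     (Y1 : B -> F1 -> T1 -> A -> C) (Y2 : B -> F2 -> T2 -> A -> C),
    cell_spec Z1 Z2 Y1 Y2 (fun a a' => ent (D1 (N1 (munit a a')))) (Q1 N1).
Proof.
move=> A0 [E [V [D [hV hD hdeg]]]] hD1.
have [F [W [WE WI]]] := stinespring hD.
have [F1 [W1 [W1E W1I]]] := stinespring hD1.
have lD : linear D by case: hD.
have lD1 : linear D1 by case: hD1.
pose u e (b' : B1) a := ent V (b', e) a.
pose z b f b' a := \sum_e W b f e * u e b' a.
have uE e e' a a' : \sum_b u e b a * (u e' b a')^* = ent (compl V (munit a a')) e e'.
  by rewrite compl_munit.
have zB b b2 a a' : \sum_f \sum_b' z b f b' a * (z b2 f b' a')^* =
    ent (N1 (munit a a')) b b2.
  by rewrite (post_process_out lD WE uE) hdeg.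
have zE b' b2' a a' : \sum_b \sum_f z b f b' a * (z b f b2' a')^* =
    \sum_e u e b' a * (u e b2' a')^* by exact: post_process_env.
have zB' b' b2' a a' : \sum_b \sum_f z b f b' a * (z b f b2' a')^* =
    ent (N1 (munit a a')) b' b2'.
  by rewrite zE (isom_ext_munit _ _ _ _ hV).
exists B1, (B1 * F)%type, unit, (F1 * F)%type, F1,
  (fun bf _ b' => z bf.1 bf.2 b'), (fun b' _ bf => z bf.1 bf.2 b'),
  (fun bo ff b' a => \sum_b W1 bo ff.1 b * z b ff.2 b' a),
  (fun bo f1 bf a => \sum_b' W1 bo f1 b' * z bf.1 bf.2 b' a).
pose u1 b (s : F * B1) a := z b s.1 s.2 a.
pose u2 b' (s : B1 * F) a := z s.1 s.2 b' a.
have u1E b b2 a a' : \sum_s u1 b s a * (u1 b2 s a')^* = ent (N1 (munit a a')) b b2.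
  by rewrite sum_pair zB.
have u2E b b2 a a' : \sum_s u2 b s a * (u2 b2 s a')^* = ent (N1 (munit a a')) b b2.
  by rewrite sum_pair zB'.
have zI a a' : \sum_b' \sum_b \sum_f (z b f b' a)^* * z b f b' a' = (a == a')%:R.
  rewrite -(isometry_sum a a' (proj1 hV)); apply: eq_bigr => b' _.
  transitivity (\sum_b \sum_f z b f b' a' * (z b f b' a)^*).
    by apply: eq_bigr => b _; apply: eq_bigr => f _; rewrite mulrC.
  by rewrite zE; apply: eq_bigr => e _; rewrite mulrC.
have Q0 := Q1_ge0 A0 hV.
split.
- split=> b b' a a'.
    rewrite -(post_process_out lD1 W1E u1E) sum_pair; apply: eq_bigr => f1 _.
    by rewrite [RHS]sum_pair.
  by rewrite -(post_process_out lD1 W1E u2E).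
- split=> t t' a a'.
    transitivity (\sum_f \sum_c z c f t a * (z c f t' a')^*).
      rewrite -(eq_bigr _ (fun f _ => post_process_env u1 W1I (f, t) (f, t') a a')).
      rewrite [RHS]exchange_big; apply: eq_bigr => b _ /=.
      by rewrite sum_pair exchange_big.
    rewrite exchange_big sum_pair; apply: eq_bigr => b _ /=.
    by apply: eq_bigr => f _; rewrite sum_unit.
  rewrite (post_process_env u2 W1I t t' a a').
  by apply: eq_bigr => b' _; rewrite sum_unit.
- split=> t t' a a'; rewrite sum_unit; apply: eq_bigr => s _; by rewrite sum_unit.
- split=> a a'; rewrite -[RHS]zI.
    rewrite [RHS]exchange_big sum_pair; apply: eq_bigr => b _ /=.
    by rewrite [RHS]exchange_big; apply: eq_bigr => f _; rewrite sum_unit.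
  apply: eq_bigr => b' _; rewrite sum_unit sum_pair.
  by apply: eq_bigr => b _; apply: eq_bigr.
move=> Q h _.
(* The middle system has one point, so the conditional entropy is 0 and nonnegativity of [Q1]
   suffices. *)
have triv (T S : finType) (k : T -> unit -> S -> A -> C) : cond_ent k h = 0.
  apply/eqP; rewrite /cond_ent subr_eq0; apply/eqP.
  apply: (entropy_bij (h := fun u => u.1) (h' := fun t => (t, tt))
    (k := fun w => (tt, w)) (k' := fun w => w.2)) => //.
  - by case=> ? [].
  - by case=> [[] ?].
  - by case=> ? [].
by rewrite !triv.
Qed.

End CellInstances.

(** * Isometric padding of finite systems *)

Section Padding.
Variable R : realType.
Local Notation C := (R[i]).

Definition isom (O S : finType) (P : O -> S -> C) : Prop :=
  forall s s', \sum_o (P o s)^* * P o s' = (s == s')%:R.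

Lemma pad_isom (S : finType) M : (#|S| <= M)%N -> exists P : 'I_M -> S -> C, isom P.
Proof.
move=> h; exists (fun o s => (o == widen_ord h (enum_rank s))%:R) => s s'.
under eq_bigr do rewrite conjC_nat.
rewrite sum_delta' /= -val_eqE /= val_eqE (inj_eq enum_rank_inj).
by [].
Qed.

Lemma delta_isom (S : finType) : isom (fun s s' : S => (s == s')%:R).
Proof.
by move=> s s'; under eq_bigr do rewrite conjC_nat; rewrite sum_delta'.
Qed.

Definition pad (O S : finType) (P : O -> S -> C) (x : S -> C) o := \sum_s P o s * x s.

Lemma eq_pad (O S : finType) (P : O -> S -> C) x y o : x =1 y -> pad P x o = pad P y o.
Proof. by move=> e; apply: eq_bigr => s _; rewrite e. Qed.

Lemma pad_delta (S : finType) (x : S -> C) s : pad (fun s s' : S => (s == s')%:R) x s = x s.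
Proof. by rewrite /pad sum_delta. Qed.

Lemma pad_gram (O S : finType) (P : O -> S -> C) x x' : isom P ->
  \sum_o pad P x o * (pad P x' o)^* = \sum_s x s * (x' s)^*.
Proof.
by move=> hP; have := isom_gram (fun s (b : bool) => if b then x s else x' s) hP true false.
Qed.

Lemma padC (O S O' S' : finType) (P : O -> S -> C) (P' : O' -> S' -> C) x o o' :
  pad P (fun s => pad P' (x s) o') o = pad P' (fun s' => pad P (x^~ s') o) o'.
Proof.
rewrite /pad; under eq_bigr do rewrite mulr_sumr.
rewrite exchange_big; apply: eq_bigr => s' _ /=; rewrite mulr_sumr.
by apply: eq_bigr => s _; rewrite mulrCA.
Qed.

Lemma pad_suml (O S I : finType) (P : O -> S -> C) (x : I -> S -> C) (c : I -> C) o :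
  \sum_i pad P (x i) o * c i = pad P (fun s => \sum_i x i s * c i) o.
Proof.
rewrite /pad; under eq_bigr do rewrite mulr_suml.
rewrite exchange_big; apply: eq_bigr => s _ /=; rewrite mulr_sumr.
by apply: eq_bigr => i _; rewrite mulrA.
Qed.

Lemma pad_transfer (O S I I' : finType) (P : O -> S -> C) (k1 k2 : I -> S -> C)
  (m1 m2 : I' -> S -> C) o o' :
  (forall s s', \sum_i k1 i s * (k2 i s')^* = \sum_i m1 i s * (m2 i s')^*) ->
  \sum_i pad P (k1 i) o * (pad P (k2 i) o')^* = \sum_i pad P (m1 i) o * (pad P (m2 i) o')^*.
Proof.
move=> e.
pose k (b : bool) i s := if b then k1 i s else k2 i s.
pose m (b : bool) i s := if b then m1 i s else m2 i s.
have := @gram_transfer R bool bool I I' S O k m (fun s o => P o s) true false true false o o' e.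
have swp (J : finType) (n1 n2 : J -> S -> C) :
   \sum_i (\sum_a n1 i a * P o a) * (\sum_a n2 i a * P o' a)^*
   = \sum_i pad P (n1 i) o * (pad P (n2 i) o')^*.
  by apply: eq_bigr => i _; congr (_ * Num.conj _); apply: eq_bigr => s _; rewrite mulrC.
by rewrite /k /m !swp.
Qed.

Section Pad3.
Variables (X X0 G G0 Y Y0 : finType).
Variables (P : X -> X0 -> C) (Q : G -> G0 -> C) (S : Y -> Y0 -> C).
Hypotheses (hP : isom P) (hQ : isom Q) (hS : isom S).

Definition pad3 (k : X0 -> G0 -> Y0 -> C) i j l :=
  pad P (fun x => pad Q (fun g => pad S (k x g) l) j) i.

Lemma pad3E k i j l :
  pad3 k i j l = pad Q (fun g => pad S (fun y => pad P (fun x => k x g y) i) l) j.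
Proof. by rewrite /pad3 padC; apply: eq_pad => g; rewrite padC. Qed.

Lemma pad3_gram_last k k' i i' :
  \sum_j \sum_l pad3 k i j l * (pad3 k' i' j l)^* =
  \sum_g \sum_y pad P (fun x => k x g y) i * (pad P (fun x => k' x g y) i')^*.
Proof.
rewrite exchange_big /=.
transitivity (\sum_l \sum_g pad S (fun y => pad P (fun x => k x g y) i) l *
   (pad S (fun y => pad P (fun x => k' x g y) i') l)^*).
  apply: eq_bigr => l _; rewrite -(pad_gram _ _ hQ); apply: eq_bigr => j _.
  by rewrite !pad3E.
by rewrite exchange_big; apply: eq_bigr => g _ /=; rewrite pad_gram.
Qed.

Lemma pad3_gram_first k k' l l' :
  \sum_i \sum_j pad3 k i j l * (pad3 k' i j l')^* =
  \sum_x \sum_g pad S (k x g) l * (pad S (k' x g) l')^*.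
Proof.
rewrite exchange_big /=.
transitivity (\sum_j \sum_x pad Q (fun g => pad S (k x g) l) j *
    (pad Q (fun g => pad S (k' x g) l') j)^*).
  by apply: eq_bigr => j _; rewrite -(pad_gram _ _ hP).
by rewrite exchange_big; apply: eq_bigr => x _ /=; rewrite pad_gram.
Qed.

Lemma pad3_gram k k' :
  \sum_i \sum_j \sum_l pad3 k i j l * (pad3 k' i j l)^* =
  \sum_x \sum_g \sum_y k x g y * (k' x g y)^*.
Proof.
under eq_bigr do rewrite pad3_gram_last.
rewrite exchange_big [RHS]exchange_big; apply: eq_bigr => g _ /=.
rewrite exchange_big [RHS]exchange_big; apply: eq_bigr => y _ /=.
by rewrite pad_gram.
Qed.

(** Isometries on the individual output systems keep the nonzero spectrum of every marginal. *)
Lemma cond_ent_pad3 (A J : finType) (k : X0 -> G0 -> Y0 -> A -> C) (h : J -> A -> C) :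
  cond_ent (fun i j l a => pad3 (fun x g y => k x g y a) i j l) h = cond_ent k h.
Proof.
pose kh q x g y := \sum_a k x g y a * h q a.
have E q i j l : \sum_a pad3 (fun x g y => k x g y a) i j l * h q a = pad3 (kh q) i j l.
  rewrite /pad3 pad_suml; apply: eq_pad => x; rewrite pad_suml; apply: eq_pad => g.
  by rewrite pad_suml.
rewrite /cond_ent; congr (_ - _).
  transitivity (entropy (fun (u : X0 * G0) (w : Y * J) => pad S (kh w.2 u.1 u.2) w.1)).
    apply: eq_entropy_col => w w'; rewrite !sum_pair.
    under eq_bigr do under eq_bigr do rewrite !E.
    by rewrite pad3_gram_first.
  apply: eq_entropy_row => u u'; rewrite !sum_pair exchange_big [RHS]exchange_big.
  by apply: eq_bigr => q _ /=; rewrite pad_gram.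
transitivity (entropy (fun i (w : G0 * (Y0 * J)) => pad P (fun x => kh w.2.2 x w.1 w.2.1) i)).
  have re (U V : finType) i i' (f : X -> U -> V -> J -> C) :
     \sum_(w : U * (V * J)) f i w.1 w.2.1 w.2.2 * (f i' w.1 w.2.1 w.2.2)^* =
     \sum_q \sum_u \sum_v f i u v q * (f i' u v q)^*.
    rewrite sum_pair [RHS]exchange_big; apply: eq_bigr => g _ /=.
    by rewrite sum_pair exchange_big.
  apply: eq_entropy_row => i i'.
  rewrite (re _ _ i i' (fun i j l q => \sum_a pad3 (fun x g y => k x g y a) i j l * h q a)).
  rewrite (re _ _ i i' (fun i g y q => pad P (fun x => kh q x g y) i)).
  apply: eq_bigr => q _; rewrite -pad3_gram_last.
  by apply: eq_bigr => j _; apply: eq_bigr => l _; rewrite !E.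
by apply: eq_entropy_col => w w'; rewrite pad_gram.
Qed.

End Pad3.
End Padding.

(** * Cells on a common index set *)

Section UniformCells.
Variable R : realType.
Local Notation C := (R[i]).
Variables A B : finType.

(** The boolean selects one of the two kernels of [cell_spec]. All inner systems are indexed by the
    same ['I_M], so that cells of different channels fit into one kernel without dependent types. *)
Definition cell M (D : A -> A -> B -> B -> C) (q : \bar R) : Prop :=
  exists (Z : bool -> 'I_M -> 'I_M -> 'I_M -> A -> C)
         (Y : bool -> B -> 'I_M -> 'I_M -> A -> C), forall s,
  [/\ forall b b' a a', \sum_f \sum_t Y s b f t a * (Y s b' f t a')^* = D a a' b b',
      forall t t' a a', \sum_b \sum_f Y s b f t a * (Y s b f t' a')^*
         = \sum_x \sum_f Z s x f t a * (Z s x f t' a')^*,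
      forall t t' a a', \sum_f \sum_x Z s t f x a * (Z s t' f x a')^*
         = \sum_x \sum_f Z (~~ s) x f t a * (Z (~~ s) x f t' a')^*,
      forall a a', \sum_t \sum_f \sum_x (Z s t f x a)^* * Z s t f x a' = (a == a')%:R &
      forall (Q : finType) (h : Q -> A -> C), mass h = 1 -> ((cond_ent (Z s) h)%:E <= q)%E].

Lemma cell_of_spec (T1 T2 G1 G2 F1 F2 : finType)
  (Z1 : T2 -> G1 -> T1 -> A -> C) (Z2 : T1 -> G2 -> T2 -> A -> C)
  (Y1 : B -> F1 -> T1 -> A -> C) (Y2 : B -> F2 -> T2 -> A -> C) D q :
  cell_spec Z1 Z2 Y1 Y2 D q -> exists M0, forall M, (M0 <= M)%N -> cell M D q.
Proof.
move=> [[a1 a2] [b1 b2] [c1 c2] [d1 d2] e].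
exists (#|T1| + #|T2| + #|G1| + #|G2| + #|F1| + #|F2|)%N => M hM.
have le (S : finType) : (#|S| <= #|T1| + #|T2| + #|G1| + #|G2| + #|F1| + #|F2|)%N ->
   exists P : 'I_M -> S -> C, isom P.
  by move=> h; apply: pad_isom; exact: leq_trans hM.
have [P1 h1] : exists P : 'I_M -> T1 -> C, isom P by apply: le; lia.
have [P2 h2] : exists P : 'I_M -> T2 -> C, isom P by apply: le; lia.
have [PG1 g1] : exists P : 'I_M -> G1 -> C, isom P by apply: le; lia.
have [PG2 g2] : exists P : 'I_M -> G2 -> C, isom P by apply: le; lia.
have [PF1 f1] : exists P : 'I_M -> F1 -> C, isom P by apply: le; lia.
have [PF2 f2] : exists P : 'I_M -> F2 -> C, isom P by apply: le; lia.
pose dB := fun b b' : B => (b == b')%:R : C.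
have hB : isom dB := @delta_isom R B.
pose Z s := if s then (fun i j l a => pad3 P2 PG1 P1 (fun x g y => Z1 x g y a) i j l)
            else (fun i j l a => pad3 P1 PG2 P2 (fun x g y => Z2 x g y a) i j l).
pose Y s := if s then (fun b j l a => pad3 dB PF1 P1 (fun x g y => Y1 x g y a) b j l)
            else (fun b j l a => pad3 dB PF2 P2 (fun x g y => Y2 x g y a) b j l).
have pairs (U V O S : finType) (P : O -> S -> C) (k k' : U -> V -> S -> C) o o' :
   \sum_u \sum_v pad P (k u v) o * (pad P (k' u v) o')^* =
   \sum_(w : U * V) pad P (k w.1 w.2) o * (pad P (k' w.1 w.2) o')^*.
  by rewrite sum_pair.
exists Z, Y; case; split.
- move=> b b' a a'; rewrite /Y (pad3_gram_last dB f1 h1) -a1.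
  by apply: eq_bigr => f _; apply: eq_bigr => t _; rewrite !pad_delta.
- move=> t t' a a'; rewrite /Y /Z (pad3_gram_first P1 hB f1) (pad3_gram_first P1 h2 g1).
  by rewrite !pairs; apply: pad_transfer => s s'; rewrite !sum_pair b1.
- move=> t t' a a'; rewrite /Z (pad3_gram_last P2 g1 h1) (pad3_gram_first P2 h1 g2).
  rewrite (pairs _ _ _ _ P2 (fun g y x => Z1 x g y a) (fun g y x => Z1 x g y a')) pairs.
  by apply: pad_transfer => s s'; rewrite !sum_pair c1.
- move=> a a'; rewrite eq_sym.
  have := pad3_gram h2 g1 h1 (fun x g y => Z1 x g y a') (fun x g y => Z1 x g y a).
  under eq_bigr do under eq_bigr do under eq_bigr do rewrite mulrC.
  move=> ->; rewrite eq_sym -d1; apply: eq_bigr => t _; apply: eq_bigr => f _.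
  by apply: eq_bigr => s _; rewrite mulrC.
- move=> Q h hm; rewrite /Z (cond_ent_pad3 h2 g1 h1 Z1 h).
  by have [] := e Q h hm.
- move=> b b' a a'; rewrite /Y (pad3_gram_last dB f2 h2) -a2.
  by apply: eq_bigr => f _; apply: eq_bigr => t _; rewrite !pad_delta.
- move=> t t' a a'; rewrite /Y /Z (pad3_gram_first P2 hB f2) (pad3_gram_first P2 h1 g2).
  by rewrite !pairs; apply: pad_transfer => s s'; rewrite !sum_pair b2.
- move=> t t' a a'; rewrite /Z (pad3_gram_last P1 g2 h2) (pad3_gram_first P1 h2 g1).
  rewrite (pairs _ _ _ _ P1 (fun g y x => Z2 x g y a) (fun g y x => Z2 x g y a')) pairs.
  by apply: pad_transfer => s s'; rewrite !sum_pair c2.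
- move=> a a'; rewrite eq_sym.
  have := pad3_gram h1 g2 h2 (fun x g y => Z2 x g y a') (fun x g y => Z2 x g y a).
  under eq_bigr do under eq_bigr do under eq_bigr do rewrite mulrC.
  move=> ->; rewrite eq_sym -d2; apply: eq_bigr => t _; apply: eq_bigr => f _.
  by apply: eq_bigr => s _; rewrite mulrC.
move=> Q h hm; rewrite /Z (cond_ent_pad3 h1 g2 h2 Z2 h).
by have [] := e Q h hm.
Qed.

End UniformCells.

(** * The flagged mixture *)

Section Mixture.
Variable R : realType.
Local Notation C := (R[i]).
Variables (A B I : finType) (M : nat).
Variables (D : I -> A -> A -> B -> B -> C) (p : I -> R).
Variables (Z : I -> bool -> 'I_M -> 'I_M -> 'I_M -> A -> C)
          (Y : I -> bool -> B -> 'I_M -> 'I_M -> A -> C).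
Hypothesis p0 : forall i, 0 <= p i.
Hypothesis p1 : \sum_i p i = 1.
Hypothesis Ya : forall i s b b' a a',
  \sum_f \sum_t Y i s b f t a * (Y i s b' f t a')^* = D i a a' b b'.
Hypothesis Yb : forall i s t t' a a', \sum_b \sum_f Y i s b f t a * (Y i s b f t' a')^*
         = \sum_x \sum_f Z i s x f t a * (Z i s x f t' a')^*.
Hypothesis Zc : forall i s t t' a a', \sum_f \sum_x Z i s t f x a * (Z i s t' f x a')^*
         = \sum_x \sum_f Z i (~~ s) x f t a * (Z i (~~ s) x f t' a')^*.
Hypothesis Zd : forall i s a a',
  \sum_t \sum_f \sum_x (Z i s t f x a)^* * Z i s t f x a' = (a == a')%:R.

Let J := (I * bool)%type.
(** Splitting each [p i] evenly makes the weights invariant under [flip], which [mixZ_sym] uses. *)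
Let w (j : J) : R := p j.1 / 2.
Let flip (j : J) : J := (j.1, ~~ j.2).
Let T := (J * 'I_M)%type.

Let w0 j : 0 <= w j. Proof. by rewrite /w divr_ge0. Qed.

Let sqrtw_sqr (j : J) x y :
  (realc (Num.sqrt (w j)) * x) * (realc (Num.sqrt (w j)) * y)^* = realc (w j) * (x * y^*).
Proof. by rewrite rmorphM /= realc_conj mulrACA -realcM -expr2 sqr_sqrtr. Qed.

Let flipK : involutive flip. Proof. by case=> i s; rewrite /flip /= negbK. Qed.

Let w_flip j : w (flip j) = w j. Proof. by []. Qed.

Let sum_w (F : I -> C) : \sum_j realc (w j) * F j.1 = \sum_i realc (p i) * F i.
Proof.
rewrite sum_pair; apply: eq_bigr => i _; rewrite big_bool /= -mulrDl -realcD /w /=.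
by congr (realc _ * _); field.
Qed.

(* The mixture carries its label j in each of the systems T and G. *)
Definition mixZ (t' f t : T) a : C :=
  ((t'.1 == flip t.1) && (f.1 == t.1))%:R *
  (realc (Num.sqrt (w t.1)) * Z t.1.1 t.1.2 t'.2 f.2 t.2 a).
Definition mixY b (f t : T) a : C :=
  (f.1 == t.1)%:R * (realc (Num.sqrt (w t.1)) * Y t.1.1 t.1.2 b f.2 t.2 a).

Let sumT (j : J) (F : T -> C) : \sum_t (t.1 == j)%:R * F t = \sum_x F (j, x).
Proof.
rewrite sum_pair -[RHS](sum_delta' j (fun k => \sum_x F (k, x))).
by apply: eq_bigr => k _; rewrite mulr_sumr.
Qed.

Let sumTT (j k : J) (F : T -> T -> C) :
  \sum_t \sum_u ((t.1 == j) && (u.1 == k))%:R * F t u = \sum_x \sum_y F (j, x) (k, y).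
Proof.
rewrite -(sumT j (fun t => \sum_y F t (k, y))); apply: eq_bigr => t _.
rewrite -(sumT k (F t)) mulr_sumr.
by apply: eq_bigr => u _; rewrite -mulnb natrM mulrA.
Qed.

Lemma mixY_out b b' a a' : \sum_f \sum_t mixY b f t a * (mixY b' f t a')^* =
  \sum_i realc (p i) * D i a a' b b'.
Proof.
rewrite -sum_w exchange_big sum_pair; apply: eq_bigr => j _ /=.
rewrite -(Ya j.1 j.2) [X in _ * X]exchange_big mulr_sumr; apply: eq_bigr => t _ /=.
rewrite -(sumT j (fun f => Y j.1 j.2 b f.2 t a * (Y j.1 j.2 b' f.2 t a')^*)) mulr_sumr.
by apply: eq_bigr => f _; rewrite /mixY /= mul_delta andbb sqrtw_sqr mulrCA.
Qed.

Lemma mixY_env t t' a a' : \sum_b \sum_f mixY b f t a * (mixY b f t' a')^* =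
  \sum_x \sum_f mixZ x f t a * (mixZ x f t' a')^*.
Proof.
case: t => j t; case: t' => j' t'.
transitivity ((j == j')%:R * (realc (w j) *
   \sum_b \sum_f Y j.1 j.2 b f t a * (Y j.1 j.2 b f t' a')^*)).
  rewrite !mulr_sumr; apply: eq_bigr => b _.
  rewrite -(sumT j (fun f => Y j.1 j.2 b f.2 t a * (Y j.1 j.2 b f.2 t' a')^*)).
  rewrite !mulr_sumr; apply: eq_bigr => f _; rewrite /mixY /= mul_delta.
  have [->|] := eqVneq f.1 j; last by rewrite /= !mul0r !mulr0.
  have [<-|] := eqVneq j j'; last by rewrite /= !mul0r.
  by rewrite sqrtw_sqr !mul1r.
rewrite Yb -(sumTT (flip j) j
  (fun x f => Z j.1 j.2 x.2 f.2 t a * (Z j.1 j.2 x.2 f.2 t' a')^*)).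
rewrite !mulr_sumr; apply: eq_bigr => x _; rewrite !mulr_sumr; apply: eq_bigr => f _.
rewrite /mixZ /= mul_delta; have [<-|] := eqVneq j j'.
  by rewrite andbb sqrtw_sqr mul1r mulrCA.
move=> /negPf jj; rewrite mul0r.
have [->|] := eqVneq f.1 j; first by rewrite jj !andbF mul0r.
by rewrite andbF mul0r.
Qed.

(** When the first output carries the flag [j], the kernel in force is that of [flip j]; by [Zc] its
    first output has the state of the second output of the kernel of [j]. *)
Lemma mixZ_sym t t' a a' : \sum_f \sum_x mixZ t f x a * (mixZ t' f x a')^* =
  \sum_x \sum_f mixZ x f t a * (mixZ x f t' a')^*.
Proof.
case: t => j t; case: t' => j' t'.
have fe (k l : J) : (k == flip l) = (l == flip k).
  by apply/eqP/eqP => ->; rewrite flipK.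
transitivity ((j == j')%:R * (realc (w j) *
   \sum_x \sum_f Z j.1 j.2 x f t a * (Z j.1 j.2 x f t' a')^*)).
  have -> : \sum_x \sum_f Z j.1 j.2 x f t a * (Z j.1 j.2 x f t' a')^* =
     \sum_f \sum_x Z j.1 (~~ j.2) t f x a * (Z j.1 (~~ j.2) t' f x a')^*.
    by rewrite Zc negbK.
  rewrite -(sumTT (flip j) (flip j)
    (fun f x => Z j.1 (~~ j.2) t f.2 x.2 a * (Z j.1 (~~ j.2) t' f.2 x.2 a')^*)).
  rewrite !mulr_sumr; apply: eq_bigr => f _; rewrite !mulr_sumr; apply: eq_bigr => x _.
  rewrite /mixZ /= mul_delta !(fe _ x.1).
  have [xj|] := eqVneq x.1 (flip j); last by rewrite andbF /= !mul0r !mulr0.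
  rewrite xj (inj_eq (can_inj flipK)).
  have [_|_] := eqVneq j j'; last by rewrite andbF !mul0r.
  by rewrite andbb /= sqrtw_sqr w_flip andbT mul1r mulrCA.
rewrite -(sumTT (flip j) j
  (fun x f => Z j.1 j.2 x.2 f.2 t a * (Z j.1 j.2 x.2 f.2 t' a')^*)).
rewrite !mulr_sumr; apply: eq_bigr => x _; rewrite !mulr_sumr; apply: eq_bigr => f _.
rewrite /mixZ /= mul_delta; have [<-|] := eqVneq j j'.
  by rewrite andbb sqrtw_sqr mul1r mulrCA.
move=> /negPf jj; rewrite mul0r.
have [->|] := eqVneq f.1 j; first by rewrite jj !andbF mul0r.
by rewrite andbF mul0r.
Qed.

Lemma mixZ_isom a a' :
  \sum_t \sum_f \sum_x (mixZ t f x a)^* * mixZ t f x a' = (a == a')%:R.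
Proof.
transitivity (\sum_j realc (w j) * \sum_x \sum_t \sum_f
    (Z j.1 j.2 t f x a)^* * Z j.1 j.2 t f x a').
  rewrite exchange_big; under eq_bigr do rewrite exchange_big.
  rewrite exchange_big sum_pair; apply: eq_bigr => j _ /=.
  rewrite mulr_sumr; apply: eq_bigr => x _; rewrite exchange_big /=.
  rewrite -(sumTT (flip j) j
    (fun t f => (Z j.1 j.2 t.2 f.2 x a)^* * Z j.1 j.2 t.2 f.2 x a')).
  rewrite mulr_sumr; apply: eq_bigr => t _; rewrite mulr_sumr; apply: eq_bigr => f _.
  by rewrite /mixZ /= mulrC mul_delta andbb sqrtw_sqr mulrCA [X in _ = _ * (_ * X)]mulrC.
transitivity (\sum_j realc (w j) * (a == a')%:R).
  apply: eq_bigr => j _; congr (_ * _); rewrite -(Zd j.1 j.2) exchange_big.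
  by apply: eq_bigr => t _ /=; rewrite exchange_big.
by rewrite (sum_w (fun=> (a == a')%:R)) -mulr_suml -realc_sum p1 mul1r.
Qed.

(** Rescaling adds [eta c] times the mass to each of the two entropies; the masses are equal, so
    this cancels. *)
Lemma cond_ent_scale (P F S Q : finType) (c : R) (k : P -> F -> S -> A -> C)
  (h : Q -> A -> C) : 0 <= c ->
  cond_ent (fun x f y a => realc (Num.sqrt c) * k x f y a) h = c * cond_ent k h.
Proof.
move=> c0; rewrite /cond_ent.
set f1 := fun (u : P * F) (v : S * Q) => \sum_a k u.1 u.2 v.1 a * h v.2 a.
set f2 := fun x (v : F * (S * Q)) => \sum_a k x v.1 v.2.1 a * h v.2.2 a.
have E1 : entropy (fun (u : P * F) (v : S * Q) =>
     \sum_a realc (Num.sqrt c) * k u.1 u.2 v.1 a * h v.2 a) =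
   entropy (fun u v => realc (Num.sqrt c) * f1 u v).
  by apply: eq_entropy => u v; rewrite mulr_sumr; apply: eq_bigr => a _; rewrite mulrA.
have E2 : entropy (fun x (v : F * (S * Q)) =>
     \sum_a realc (Num.sqrt c) * k x v.1 v.2.1 a * h v.2.2 a) =
   entropy (fun u v => realc (Num.sqrt c) * f2 u v).
  by apply: eq_entropy => u v; rewrite mulr_sumr; apply: eq_bigr => a _; rewrite mulrA.
rewrite E1 E2 !entropy_scale //; have -> : mass f2 = mass f1.
  by rewrite /mass sum_pair; apply: eq_bigr => x _; rewrite sum_pair.
ring.
Qed.

(** The traced-out systems also reveal the label, so both states are block diagonal in it and the
    entropies add up over the blocks. *)
Lemma cond_ent_mixZ (Q : finType) (h : Q -> A -> C) :
  cond_ent mixZ h = \sum_j w j * cond_ent (Z j.1 j.2) h.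
Proof.
pose k j x f y a := realc (Num.sqrt (w j)) * Z j.1 j.2 x f y a.
under eq_bigr do rewrite -(cond_ent_scale _ h (w0 _)).
pose K j x f y q := \sum_a k j x f y a * h q a.
have mE t' f t q : \sum_a mixZ t' f t a * h q a =
    ((t'.1 == flip t.1) && (f.1 == t.1))%:R * K t.1 t'.2 f.2 t.2 q.
  by rewrite /K mulr_sumr; apply: eq_bigr => a _; rewrite mulrA.
rewrite /cond_ent sumrB; congr (_ - _).
  rewrite -(entropy_block (fun j (u : 'I_M * 'I_M) (v : 'I_M * Q) => K j u.1 u.2 v.1 v.2)).
  transitivity (entropy (fun (u : J * ('I_M * 'I_M)) (v : T * Q) =>
     (u.1 == v.1.1)%:R * K u.1 u.2.1 u.2.2 v.1.2 v.2)); last first.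
    apply: (entropy_bij (h := id) (h' := id) (k := fun v => (v.1.1, (v.1.2, v.2)))
      (k' := fun v => ((v.1, v.2.1), v.2.2))) => //.
    - by case=> [[? ?] ?].
    - by case=> ? [? ?].
  apply: eq_entropy_col => -[[j y] q] [[j' y'] q'] /=.
  transitivity ((j == j')%:R * \sum_x \sum_f K j x f y q * (K j x f y' q')^*).
    rewrite -(sumTT (flip j) j (fun x f => K j x.2 f.2 y q * (K j x.2 f.2 y' q')^*)).
    rewrite sum_pair mulr_sumr; apply: eq_bigr => x _.
    rewrite mulr_sumr; apply: eq_bigr => f _.
    rewrite !mE /= mul_delta; have [<-|] := eqVneq j j'.
      by rewrite andbb mul1r.
    move=> /negPf jj; rewrite mul0r.
    have [->|] := eqVneq f.1 j; first by rewrite jj !andbF mul0r.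
    by rewrite andbF mul0r.
  rewrite sum_pair -[LHS](sum_delta' j (fun=> (j == j')%:R *
     \sum_x \sum_f K j x f y q * (K j x f y' q')^*)).
  apply: eq_bigr => i _; rewrite sum_pair !mulr_sumr; apply: eq_bigr => x _.
  rewrite !mulr_sumr; apply: eq_bigr => f _ /=; rewrite mul_delta.
  have [->|] := eqVneq i j; last by rewrite !mul0r.
  by rewrite mul1r.
rewrite -(entropy_block (fun j (x : 'I_M) (v : 'I_M * ('I_M * Q)) => K j x v.1 v.2.1 v.2.2)).
transitivity (entropy (fun (u : T) (v : T * (T * Q)) =>
   ((u.1 == v.2.1.1) && (v.1.1 == v.2.1.1))%:R * K v.2.1.1 u.2 v.1.2 v.2.1.2 v.2.2)).
  apply: (entropy_bij (h := fun u : T => (flip u.1, u.2)) (h' := fun u => (flip u.1, u.2))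
    (k := id) (k' := id)) => //.
  - by case=> j x /=; rewrite flipK.
  - by case=> j x /=; rewrite flipK.
  move=> u [f [t q]]; rewrite mE.
  have -> // : (u.1 == flip t.1) = (flip u.1 == t.1).
  by apply/eqP/eqP => [->|<-]; rewrite flipK.
transitivity (entropy (fun (u : T) (v : T * (Q * T)) =>
   ((u.1 == v.1.1) && (v.2.2.1 == v.1.1))%:R * K v.1.1 u.2 v.2.2.2 v.1.2 v.2.1)).
  apply: (entropy_bij (h := id) (h' := id) (k := fun v => (v.2.1, (v.2.2, v.1)))
    (k' := fun v => (v.2.2, (v.1, v.2.1)))) => //.
  - by case=> ? [? ?].
  - by case=> ? [? ?].
transitivity (entropy (fun (u : T) (v : T * (Q * 'I_M)) =>
   (u.1 == v.1.1)%:R * K u.1 u.2 v.2.2 v.1.2 v.2.1)); last first.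
  apply: (entropy_bij (h := id) (h' := id)
    (k := fun v : T * (Q * 'I_M) => (v.1.1, (v.2.2, (v.1.2, v.2.1))))
    (k' := fun v => ((v.1, v.2.2.1), (v.2.2.2, v.2.1)))) => //.
  - by case=> [[? ?] [? ?]].
  - by case=> ? [? [? ?]].
apply: eq_entropy_row => u u'; rewrite sum_pair [RHS]sum_pair; apply: eq_bigr => t _.
rewrite sum_pair [RHS]sum_pair; apply: eq_bigr => q _ /=.
rewrite -(sumT t.1 (fun f => (u.1 == t.1)%:R * K u.1 u.2 f.2 t.2 q *
  ((u'.1 == t.1)%:R * K u'.1 u'.2 f.2 t.2 q)^*)).
apply: eq_bigr => f _; rewrite !mul_delta.
have [->|] := eqVneq u.1 t.1; last by rewrite /= !mul0r mulr0.
have [->|] := eqVneq u'.1 t.1; last by rewrite /= andbF /= !mul0r mulr0.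
by rewrite /= andbb mul1r.
Qed.

End Mixture.

(** * The capacity against an arbitrary decomposition *)

Local Open Scope ereal_scope.

Theorem theorem11 (R : realType) (A B E : finType)
  (N : 'M[R[i]]_#|A| -> 'M[R[i]]_#|B|)
  (V : 'M[R[i]]_(#|{: B * E}|, #|A|)) :
  (0 < #|A|)%N -> is_channel N -> isom_ext N V ->
  C_p V <= C_DM N.
Proof.
move=> A0 _ hV; apply: le_ereal_inf_tmp => _ [m [p [Bi [Ni [Di [[p0 p1] hN hD NE ->]]]]]].
have Q0 i : 0 <= Q1 (Ni i).
  by have [_ [|] [F [W [D [hW _ _]]]]] := hN i; exact: (Q1_ge0 A0 hW).
have x0 : 0 <= \sum_i (p i)%:E * Q1 (Ni i).
  by apply: sume_ge0 => i _; apply: mule_ge0 => //; rewrite lee_fin.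
have /fin_all_exists[Mi hM] : forall i, exists M0, forall M, (M0 <= M)%N ->
    cell M (fun a a' => ent (Di i (Ni i (munit a a')))) (Q1 (Ni i)).
  move=> i; have [_ [hdeg|hdeg]] := hN i.
    have [T [G [F [Z [Y hZ]]]]] := degradable_cell hdeg (hD i).
    exact: cell_of_spec hZ.
  have [T1 [T2 [G [F1 [F2 [Z1 [Z2 [Y1 [Y2 hZ]]]]]]]]] := antidegradable_cell A0 hdeg (hD i).
  exact: cell_of_spec hZ.
pose M := (\sum_i Mi i)%N.
have Mi_le i : (Mi i <= M)%N by rewrite /M (bigD1 i) //= leq_addr.
have /fin_all_exists[Z] := fun i => hM i M (Mi_le i).
move=> /fin_all_exists[Y hZ].
apply: ge_ereal_sup => _ [r [hr ->]].
(* [Q1] is a supremum in the extended reals, so the cost of the decomposition may a priori be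
   infinite; the bound is then trivial. *)
case: (eqVneq (\sum_i (p i)%:E * Q1 (Ni i)) +oo) => [->|xoo]; first exact: leey.
have xfin : \sum_i (p i)%:E * Q1 (Ni i) \is a fin_num.
  by rewrite ge0_fin_numE // ltey.
rewrite -(fineK xfin) lee_fin.
(* Discarding the flag after processing by the [Di] gives back [N], so [V] and [mixY] dilate the
   same channel. *)
have mixY_N b b' a a' : (\sum_e ent V (b, e) a * (ent V (b', e) a')^*
   = \sum_f \sum_t mixY p Y b f t a * (mixY p Y b' f t a')^*)%R.
  rewrite (@mixY_out R A B _ M (fun i a a' => ent (Di i (Ni i (munit a a'))))) //.
    rewrite -(isom_ext_munit _ _ _ _ hV) NE {1}/ent summxE; apply: eq_bigr => i _.
    by rewrite -entZ.
  by move=> i s; have [] := hZ i s.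
have c0 : (0 <= fine (\sum_i (p i)%:E * Q1 (Ni i)))%R by exact: fine_ge0.
apply: (achievable_le A0 (proj1 hV) mixY_N _ _ _ _ c0 hr).
- by apply: mixY_env => // i s; have [] := hZ i s.
- move=> t t' a a'; rewrite mixZ_sym //; last by move=> i s; have [] := hZ i s.
  exact: exchange_big.
- by apply: mixZ_isom => // i s; have [] := hZ i s.
move=> Q h h1; rewrite -lee_fin fineK // cond_ent_mixZ // -sumEFin.
rewrite sum_pair; apply: lee_sum => i _; rewrite big_bool /=.
have hs s : (cond_ent (Z i s) h)%:E <= Q1 (Ni i).
  by have [_ _ _ _] := hZ i s; apply.
(* Each of the two flags of [i] accounts for half of its weight. *)
have -> : (p i)%:E * Q1 (Ni i) = (p i / 2)%:E * Q1 (Ni i) + (p i / 2)%:E * Q1 (Ni i).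
  rewrite -ge0_muleDl; [|by rewrite lee_fin divr_ge0..].
  by rewrite -EFinD -splitr.
by apply: leeD; rewrite EFinM; apply: lee_wpmul2l => //; rewrite lee_fin divr_ge0.
Qed.
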